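(* Let $p$ be a prime, $\Gamma$ a finite abelian $p$-group with duality pairing $\delta$, and let $r=\dim_{\mathbb{Z}/p\mathbb{Z}}\Gamma/p\Gamma$. Choose $A\in\mathrm{Sym}^0_n(\mathbb{Z}_p)$ randomly with respect to additive Haar measure, and let $\mu_n(\Gamma,\delta)$ be the probability that the finite cokernel of $A$ with its duality pairing is isomorphic to $(\Gamma,\delta)$. Then \[ \mu_n(\Gamma,\delta)=\frac{\prod_{j=n-r}^{n-1}(1-p^{-j})\prod_{i=1}^{\lceil (n-1-r)/2\rceil}(1-p^{1-2i})}{\#\Gamma\cdot\#\mathrm{Aut}(\Gamma,\delta)}, \] and in particular \[ \lim_{n\to\infty}\mu_n(\Gamma,\delta)=\frac{\prod_{i=1}^\infty(1-p^{1-2i})}{\#\Gamma\cdot\#\mathrm{Aut}(\Gamma,\delta)}. \]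
   Context: A duality pairing on a finite abelian group $\Gamma$ is a symmetric bilinear map $\delta:\Gamma\times\Gamma\to\mathbb{Q}/\mathbb{Z}$ such that $g\mapsto\delta(g,\cdot)$ is an isomorphism onto $\mathrm{Hom}(\Gamma,\mathbb{Q}/\mathbb{Z})$; $\mathrm{Aut}(\Gamma,\delta)$ is the group of pairing-preserving automorphisms. $\mathrm{Sym}^0_n(\mathbb{Z}_p)$ is the additive group of symmetric $n\times n$ matrices over $\mathbb{Z}_p$ with every row sum and column sum equal to $0$. For $A\in\mathrm{Sym}_n(\mathbb{Z}_p)$ (possibly singular), let $L_A=\mathbb{Z}_p^n\cap A\mathbb{Q}_p^n$; the finite cokernel of $A$ is $L_A/A\mathbb{Z}_p^n$ (the torsion subgroup of $\mathrm{coker}A$), with the duality pairing induced from the pairing on $L_A$ given by $(x,y)\mapsto \frac1m z^ty\in\mathbb{Q}_p/\mathbb{Z}_p$ whenever $x=\frac1m Az$ with $z\in\mathbb{Z}_p^n$, $m\in\mathbb{Z}_p$. *)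

(* Defs.v *)
From HB Require Import structures.
From mathcomp Require Import all_boot all_order all_algebra all_fingroup.
From mathcomp Require Import all_solvable.
From mathcomp Require Import all_classical all_reals all_analysis.
From mathcomp Require Import ring.

Set Implicit Arguments.
Unset Strict Implicit.
Unset Printing Implicit Defensive.

Import Order.TTheory GRing.Theory Num.Theory.
Local Open Scope classical_set_scope.
Local Open Scope ring_scope.
Local Open Scope quotient_scope.

(* Z_p as the inverse limit of the Z/p^(k+1). The index is shifted because 'Z_1
   is not the trivial ring. *)
Record padic_int (p : nat) (p_pr : prime p) := PadicInt {
  residue :> forall k : nat, 'Z_(p ^ k.+1);
  residue_coherent : forall k : nat, (residue k.+1 : nat)%:R = residue k }.

Section PadicIntRing.
Variables (p : nat) (p_pr : prime p).
Local Notation Zp := (padic_int p_pr).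
Implicit Types x y z : Zp.

HB.instance Definition _ := gen_eqMixin Zp.
HB.instance Definition _ := gen_choiceMixin Zp.

Lemma padic_int_eqP x y : (forall k, x k = y k) -> x = y.
Proof.
case: x y => [f fP] [g gP] /= fg.
have {}fg : f = g by apply: functional_extensionality_dep.
by case: _ / fg in gP *; congr PadicInt; apply: Prop_irrelevance.
Qed.

Lemma expp_gt1 k : (1 < p ^ k.+1)%N.
Proof. by rewrite -(expn0 p) ltn_exp2l ?prime_gt1. Qed.

Lemma modZ_natr (m k : nat) (x : 'Z_(p ^ k.+1)) : (m = x %[mod p ^ k.+1])%N ->
  m%:R = x.
Proof.
move=> e; apply: val_inj; rewrite /= val_Zp_nat ?expp_gt1// e modn_small//.
by have := ltn_ord x; rewrite [X in (_ < X)%N]Zp_cast ?expp_gt1.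
Qed.

Lemma natr_ZpD k (x y : 'Z_(p ^ k.+2)) :
  (nat_of_ord (x + y)%R)%:R = (x : nat)%:R + (y : nat)%:R :> 'Z_(p ^ k.+1).
Proof.
rewrite -natrD; apply: modZ_natr; rewrite val_Zp_nat ?expp_gt1//= modn_mod.
by rewrite [X in (_ %% X %% _)%N]Zp_cast ?expp_gt1// modn_dvdm// dvdn_exp2l.
Qed.

Lemma natr_ZpM k (x y : 'Z_(p ^ k.+2)) :
  (nat_of_ord (x * y)%R)%:R = (x : nat)%:R * (y : nat)%:R :> 'Z_(p ^ k.+1).
Proof.
rewrite -natrM; apply: modZ_natr; rewrite val_Zp_nat ?expp_gt1//= modn_mod.
by rewrite [X in (_ %% X %% _)%N]Zp_cast ?expp_gt1// modn_dvdm// dvdn_exp2l.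
Qed.

Lemma natr_Zp1 k : (nat_of_ord (1%R : 'Z_(p ^ k.+2)))%:R = 1 :> 'Z_(p ^ k.+1).
Proof. by rewrite /= modn_small. Qed.

Lemma natr_ZpN k (x : 'Z_(p ^ k.+2)) :
  (nat_of_ord (- x)%R)%:R = - (x : nat)%:R :> 'Z_(p ^ k.+1).
Proof. by apply/eqP; rewrite -addr_eq0 -natr_ZpD addNr. Qed.

Definition padic0 : Zp := @PadicInt p p_pr (fun=> 0) (fun=> erefl).
Definition padic1 : Zp := @PadicInt p p_pr (fun=> 1) natr_Zp1.

Lemma padic_opp_subproof x k : (nat_of_ord (- x k.+1)%R)%:R = - x k.
Proof. by rewrite natr_ZpN residue_coherent. Qed.
Definition padic_opp x : Zp := PadicInt p_pr (padic_opp_subproof x).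

Lemma padic_add_subproof x y k :
  (nat_of_ord (x k.+1 + y k.+1)%R)%:R = x k + y k.
Proof. by rewrite natr_ZpD !residue_coherent. Qed.
Definition padic_add x y : Zp := PadicInt p_pr (padic_add_subproof x y).

Lemma padic_mul_subproof x y k :
  (nat_of_ord (x k.+1 * y k.+1)%R)%:R = x k * y k.
Proof. by rewrite natr_ZpM !residue_coherent. Qed.
Definition padic_mul x y : Zp := PadicInt p_pr (padic_mul_subproof x y).

Lemma padic_addA : associative padic_add.
Proof. by move=> x y z; apply: padic_int_eqP => k; apply: addrA. Qed.
Lemma padic_addC : commutative padic_add.
Proof. by move=> x y; apply: padic_int_eqP => k; apply: addrC. Qed.
Lemma padic_add0 : left_id padic0 padic_add.
Proof. by move=> x; apply: padic_int_eqP => k; apply: add0r. Qed.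
Lemma padic_addN : left_inverse padic0 padic_opp padic_add.
Proof. by move=> x; apply: padic_int_eqP => k; apply: addNr. Qed.

HB.instance Definition _ := GRing.isZmodule.Build Zp
  padic_addA padic_addC padic_add0 padic_addN.

Lemma padic_mulA : associative padic_mul.
Proof. by move=> x y z; apply: padic_int_eqP => k; apply: mulrA. Qed.
Lemma padic_mulC : commutative padic_mul.
Proof. by move=> x y; apply: padic_int_eqP => k; apply: mulrC. Qed.
Lemma padic_mul1 : left_id padic1 padic_mul.
Proof. by move=> x; apply: padic_int_eqP => k; apply: mul1r. Qed.
Lemma padic_mulDl : left_distributive padic_mul +%R.
Proof. by move=> x y z; apply: padic_int_eqP => k; apply: mulrDl. Qed.
Lemma padic1_neq0 : padic1 != 0.
Proof. by apply/eqP => /(congr1 (fun x : Zp => val (x 0%N))). Qed.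

HB.instance Definition _ := GRing.Zmodule_isComNzRing.Build Zp
  padic_mulA padic_mulC padic_mul1 padic_mulDl padic1_neq0.

Definition padic_unit : pred Zp := fun x => `[< exists y, y * x = 1 >].
Definition padic_inv x : Zp := if padic_unit x then xget 0 [set y | y * x = 1] else x.

Lemma padic_mulV : {in padic_unit, left_inverse 1 padic_inv *%R}.
Proof.
move=> x ux; have {}ux : padic_unit x := ux.
by rewrite /padic_inv ux; move/asboolP: ux => /(xgetPex 0).
Qed.
Lemma padic_unitP x y : y * x = 1 -> padic_unit x.
Proof. by move=> yx; apply/asboolP; exists y. Qed.
Lemma padic_inv_out : {in [predC padic_unit], padic_inv =1 id}.
Proof. by move=> x /negPf ux; rewrite /padic_inv [padic_unit x]ux. Qed.

HB.instance Definition _ := GRing.ComNzRing_hasMulInverse.Build Zp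
  padic_mulV padic_unitP padic_inv_out.

Lemma residue_mod x (j k : nat) : (j <= k)%N -> (x k %% p ^ j.+1 = x j)%N.
Proof.
have modj i : (x i %% p ^ i.+1 = x i)%N.
  rewrite modn_small//; have := ltn_ord (x i).
  by rewrite [X in (_ < X)%N]Zp_cast ?expp_gt1.
elim: k => [|k IH]; first by rewrite leqn0 => /eqP ->.
rewrite leq_eqVlt ltnS => /predU1P[->//|jk].
rewrite -(IH jk) -(residue_coherent x k) val_Zp_nat ?expp_gt1//.
by rewrite modn_dvdm// dvdn_exp2l.
Qed.

Lemma residueM x y k : (x * y) k = x k * y k. Proof. by []. Qed.
Lemma residueD x y k : (x + y) k = x k + y k. Proof. by []. Qed.
Lemma residue0 k : (0 : Zp) k = 0. Proof. by []. Qed.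
Lemma residue1 k : (1 : Zp) k = 1. Proof. by []. Qed.

Lemma padic_int_domain x y : x * y = 0 -> (x == 0) || (y == 0).
Proof.
have nz (u : Zp) : u != 0 -> exists k, u k != 0.
  move=> u0; apply: contrapT => u0'; move/eqP: u0; apply.
  apply: padic_int_eqP => k; apply/eqP/negPn/negP => uk.
  by apply: u0'; exists k.
move=> xy0; apply/norP => -[/nz[j xj] /nz[k yk]].
set N := (j + k).+1.
have ndvd (u : Zp) i : (i <= N)%N -> u i != 0 -> ((0 < u N) && (logn p (u N) <= i))%N.
  move=> iN ui; have ndv : ~~ (p ^ i.+1 %| u N)%N.
    by rewrite /dvdn residue_mod// -val_eqE in ui *.
  have uN0 : (0 < u N)%N by rewrite lt0n; apply: contraNneq ndv => ->; rewrite dvdn0.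
  by rewrite uN0 leqNgt; apply: contra ndv => h; rewrite pfactor_dvdn.
have /andP[x0 lx] : (0 < x N)%N && (logn p (x N) <= j)%N.
  by apply: ndvd => //; rewrite /N -addnS leq_addr.
have /andP[y0 ly] : (0 < y N)%N && (logn p (y N) <= k)%N.
  by apply: ndvd => //; rewrite /N -addSn leq_addl.
have : (p ^ N.+1 %| x N * y N)%N.
  have /(congr1 (fun u : Zp => val (u N))) := xy0.
  by rewrite residueM residue0 /= [X in (_ %% X)%N]Zp_cast ?expp_gt1// => /eqP.
rewrite pfactor_dvdn ?muln_gt0 ?x0// lognM// /N => h.
by move: (leq_trans h (leq_add lx ly)); rewrite ltnNge leqnSn.
Qed.

HB.instance Definition _ :=
  GRing.ComUnitRing_isIntegral.Build Zp padic_int_domain.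

End PadicIntRing.

Section PadicTopology.
Variables (p : nat) (p_pr : prime p).
Local Notation Zp := (padic_int p_pr).

Definition padic_nbhs (x : Zp) : set_system Zp :=
  filter_from setT (fun k : nat => [set y : Zp | y k = x k]).

HB.instance Definition _ := hasNbhs.Build Zp padic_nbhs.

Lemma residue_eq_le (x y : Zp) (j k : nat) : (j <= k)%N -> x k = y k -> x j = y j.
Proof.
by move=> jk xy; apply: val_inj; rewrite /= -(residue_mod x jk) xy residue_mod.
Qed.

Lemma padic_nbhs_filter (x : Zp) : ProperFilter (nbhs x).
Proof.
apply: filter_from_proper; last by move=> k _; exists x.
apply: filter_from_filter; first by exists 0%N.
move=> i j _ _; exists (maxn i j) => // y /= yx; split => /=.
  by apply: residue_eq_le yx; rewrite leq_maxl.
by apply: residue_eq_le yx; rewrite leq_maxr.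
Qed.

Lemma padic_nbhs_singleton (x : Zp) (U : set Zp) : nbhs x U -> U x.
Proof. by case=> k _; apply. Qed.

Lemma padic_nbhs_nbhs (x : Zp) (U : set Zp) : nbhs x U -> nbhs x (nbhs^~ U).
Proof.
case=> k _ kU; exists k => // y /= yx; exists k => // z /= zy.
by apply: kU; rewrite /= zy.
Qed.

HB.instance Definition _ := Nbhs_isNbhsTopological.Build Zp
  padic_nbhs_filter padic_nbhs_singleton padic_nbhs_nbhs.

End PadicTopology.

Section Sym0.
Variables (p : nat) (p_pr : prime p) (n : nat).
Local Notation Zp := (padic_int p_pr).

Definition sym0_pred : {pred 'M[Zp]_n} := fun A =>
  [&& A^T == A, [forall i, \sum_j A i j == 0] & [forall j, \sum_i A i j == 0]].

Lemma sym0_predP (A : 'M[Zp]_n) :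
  reflect [/\ A^T = A, forall i, \sum_j A i j = 0 & forall j, \sum_i A i j = 0]
    (A \in sym0_pred).
Proof.
apply: (iffP and3P) => [[/eqP tA /forallP rA /forallP cA]|[-> rA cA]].
  by split=> // i; apply/eqP.
by split=> //; apply/forallP => i; apply/eqP.
Qed.

Lemma sym0_zmod_closed : zmod_closed sym0_pred.
Proof.
split=> [|A B /sym0_predP[tA rA cA] /sym0_predP[tB rB cB]]; apply/sym0_predP.
  by split=> [|i|j]; rewrite ?trmx0// big1// => k _; rewrite mxE.
split=> [|i|j]; first by rewrite linearB /= tA tB.
  by under eq_bigr do rewrite !mxE; rewrite sumrB rA rB subr0.
by under eq_bigr do rewrite !mxE; rewrite sumrB cA cB subr0.
Qed.
HB.instance Definition _ :=
  GRing.isZmodClosed.Build 'M[Zp]_n sym0_pred sym0_zmod_closed.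

Record sym0 := Sym0 { sym0_mx :> 'M[Zp]_n; _ : sym0_mx \in sym0_pred }.

HB.instance Definition _ := [isSub for sym0_mx].
HB.instance Definition _ := [Choice of sym0 by <:].
HB.instance Definition _ := [SubChoice_isSubZmodule of sym0 by <:].
HB.instance Definition _ := isPointed.Build sym0 0.
HB.instance Definition _ := Topological.copy sym0 (initial_topology sym0_mx).

Definition borel_sym0 : Type := g_sigma_algebraType (@open sym0).
HB.instance Definition _ := Measurable.on borel_sym0.

(* The group is compact, so the normalised Haar measure is the translation
   invariant probability measure on the Borel sets. *)
Definition is_haar (R : realType) (mu : set borel_sym0 -> \bar R) : Prop :=
  forall (A : sym0) (B : set borel_sym0), measurable B ->
    mu [set A + X | X in (B : set sym0)] = mu B.

End Sym0.

Section QmodZ.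

Definition int_pred : {pred rat} := fun x => x \is a Num.int.
Lemma int_pred_zmod_closed : zmod_closed int_pred.
Proof. by split=> [|x y]; rewrite !unfold_in; [apply: rpred0|apply: rpredB]. Qed.
HB.instance Definition _ :=
  GRing.isZmodClosed.Build rat int_pred int_pred_zmod_closed.

Definition QmodZ : Type := {ideal_quot int_pred}.
HB.instance Definition _ := GRing.Zmodule.on QmodZ.
Definition QmodZ_pi (x : rat) : QmodZ := \pi_{ideal_quot int_pred} x.

End QmodZ.

Lemma frac_sub_aux (F : fieldType) (a b x y : F) : y != 0 -> x != 0 ->
  b * x - a * y = x * y * - (a / x - b / y).
Proof. by move=> y0 x0; field; rewrite x0 y0. Qed.

Lemma fraction_numden (R : idomainType) (q : {fraction R}) :
  exists a b : R, b != 0 /\ q = (tofrac b)^-1 * tofrac a.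
Proof.
elim/quotW: q => x; exists (frac x).1, (frac x).2.
have d0 : (frac x).2 != 0 by exact: denom_ratioP.
split=> //; apply: (canRL (mulKf _)); first by rewrite tofrac_eq0.
unlock tofrac; rewrite -[LHS]FracField.pi_mul; apply/eqP.
rewrite eqmodE /= FracField.equivfE !numden_Ratio ?oner_eq0 ?mulf_neq0 ?oner_eq0//.
by rewrite mulr1 mul1r mulrC.
Qed.

Section PadicField.
Variables (p : nat) (p_pr : prime p).
Local Notation Zp := (padic_int p_pr).

Definition padic : fieldType := {fraction Zp}.
Definition Zp_to_Qp (x : Zp) : padic := tofrac x.
HB.instance Definition _ := GRing.RMorphism.copy Zp_to_Qp (@tofrac Zp).

Lemma Zp_to_Qp_inj : injective Zp_to_Qp.
Proof. by move=> x y /eqP; rewrite tofrac_eq => /eqP. Qed.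

Definition Zp_pred : {pred padic} := fun x => `[< exists y, x = Zp_to_Qp y >].
Lemma Zp_pred_zmod_closed : zmod_closed Zp_pred.
Proof.
split=> [|x y /asboolP[a ->] /asboolP[b ->]]; apply/asboolP.
  by exists 0; rewrite rmorph0.
by exists (a - b); rewrite rmorphB.
Qed.
HB.instance Definition _ :=
  GRing.isZmodClosed.Build padic Zp_pred Zp_pred_zmod_closed.

Definition QpmodZp : Type := {ideal_quot Zp_pred}.
HB.instance Definition _ := GRing.Zmodule.on QpmodZp.
Definition QpmodZp_pi (x : padic) : QpmodZp := \pi_{ideal_quot Zp_pred} x.

(* The embedding Q_p/Z_p -> Q/Z onto the p-primary part, a/p^k |-> a/p^k. *)
Definition QpmodZp_to_QmodZ (t : QpmodZp) : QmodZ :=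
  xget 0 [set q | exists (a : int) (k : nat),
    t = QpmodZp_pi (a%:~R / p%:R ^+ k) /\ q = QmodZ_pi (a%:~R / p%:R ^+ k)].

Lemma QmodZ_pi_eq x y : (QmodZ_pi x = QmodZ_pi y) <-> (x - y \is a Num.int).
Proof.
split=> [/eqP|h]; last apply/eqP; by rewrite /QmodZ_pi eqmodE /= /Quotient.equiv.
Qed.

Lemma QpmodZp_pi_eq x y :
  (QpmodZp_pi x = QpmodZp_pi y) <-> exists z, x - y = Zp_to_Qp z.
Proof.
split=> [/eqP|h]; last apply/eqP; rewrite /QpmodZp_pi eqmodE /= /Quotient.equiv.
  by move/asboolP.
exact/asboolP.
Qed.

Lemma residue_nat (m k : nat) : (m%:R : Zp) k = m%:R.
Proof. by elim: m => [//|m IH]; rewrite !mulrS -IH. Qed.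

Lemma padic_dvd_nat (m k : nat) (z : Zp) : m%:R = p%:R ^+ k * z -> (p ^ k %| m)%N.
Proof.
case: k => [|k]; first by rewrite expn0 dvd1n.
move=> h; have : (m%:R : Zp) k = ((p ^ k.+1)%:R * z : Zp) k by rewrite natrX h.
rewrite residueM !residue_nat (_ : (p ^ k.+1)%:R = 0 :> 'Z_(p ^ k.+1)).
  by rewrite mul0r => /(congr1 val) /=; rewrite val_Zp_nat ?expp_gt1// => /eqP.
by apply: val_inj; rewrite /= val_Zp_nat ?expp_gt1// modnn.
Qed.

Lemma padic_dvd_int (a : int) (k : nat) (z : Zp) :
  a%:~R = p%:R ^+ k * z -> exists b : int, a = b * p%:R ^+ k.
Proof.
have nat_case m z' : m%:R = p%:R ^+ k * z' :> Zp ->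
    exists b : int, m%:Z = b * p%:R ^+ k.
  by move/padic_dvd_nat/dvdnP => [b ->]; exists b%:Z; rewrite PoszM -natrX natz.
case: a => m h; first exact: nat_case h.
have [|b bE] := nat_case m.+1 (- z); last by exists (- b); rewrite NegzE bE mulNr.
by rewrite mulrN -h NegzE mulrNz opprK.
Qed.

Lemma padic_p_neq0 : p%:R != 0 :> Zp.
Proof.
apply/eqP => p0; have /padic_dvd_nat : p%:R = p%:R ^+ 2 * 0 :> Zp by rewrite mulr0.
move/dvdn_leq => /(_ (prime_gt0 p_pr)).
by rewrite leqNgt -[X in (X < _)%N]expn1 ltn_exp2l ?prime_gt1.
Qed.

Lemma Zp_to_Qp_pX_neq0 k : p%:R ^+ k != 0 :> padic.
Proof.
rewrite expf_neq0// -(rmorph_nat Zp_to_Qp) -(rmorph0 Zp_to_Qp).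
by rewrite (inj_eq Zp_to_Qp_inj) padic_p_neq0.
Qed.

Lemma QpmodZp_to_QmodZE (a : int) (k : nat) :
  QpmodZp_to_QmodZ (QpmodZp_pi (a%:~R / p%:R ^+ k)) = QmodZ_pi (a%:~R / p%:R ^+ k).
Proof.
rewrite /QpmodZp_to_QmodZ; set S := (X in xget _ X).
have [b [l [/QpmodZp_pi_eq[z zE] ->]]] : S (xget 0 S).
  by apply: xgetPex; exists (QmodZ_pi (a%:~R / p%:R ^+ k)), a, k.
apply/QmodZ_pi_eq.
have [|c cE] := @padic_dvd_int (b * p%:R ^+ k - a * p%:R ^+ l) (k + l) (- z).
  apply: Zp_to_Qp_inj; rewrite rmorph_int rmorphM rmorphXn rmorph_nat rmorphN /= -zE.
  rewrite rmorphB !rmorphM !rmorphXn !rmorph_nat exprD.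
  have := Zp_to_Qp_pX_neq0 k; have := Zp_to_Qp_pX_neq0 l.
  exact: frac_sub_aux.
have p0 j : p%:R ^+ j != 0 :> rat by rewrite expf_neq0// pnatr_eq0 -lt0n prime_gt0.
apply/intrP; exists c; move/(congr1 (intr : int -> rat)): cE.
rewrite rmorphB !rmorphM !rmorphXn !rmorph_nat exprD.
have := p0 k; have := p0 l.
set pl := p%:R ^+ l; set pk := p%:R ^+ k => pl0 pk0 cE.
have -> : b%:~R / pl - a%:~R / pk = (b%:~R * pk - a%:~R * pl) / (pk * pl) :> rat.
  by field; rewrite pl0 pk0.
by rewrite cE mulfK// mulf_neq0.
Qed.


End PadicField.

Section FiniteCokernel.
Variables (p : nat) (p_pr : prime p) (n : nat).
Local Notation Zp := (padic_int p_pr).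
Local Notation Qp := (padic p_pr).
Local Notation toQp := (map_mx (@Zp_to_Qp p p_pr)).

Section Lattice.
Variable A : 'M[Zp]_n.

Definition lattice_pred : {pred 'cV[Zp]_n} := fun x =>
  `[< exists w : 'cV[Qp]_n, toQp x = toQp A *m w >].
Lemma lattice_zmod_closed : zmod_closed lattice_pred.
Proof.
split=> [|x y /asboolP[v xE] /asboolP[w yE]]; apply/asboolP.
  by exists 0; rewrite mulmx0 map_mx0.
by exists (v - w); rewrite mulmxBr -xE -yE map_mxB.
Qed.
HB.instance Definition _ :=
  GRing.isZmodClosed.Build 'cV[Zp]_n lattice_pred lattice_zmod_closed.

Record lattice := Lattice { lattice_val :> 'cV[Zp]_n; _ : lattice_val \in lattice_pred }.

HB.instance Definition _ := [isSub for lattice_val].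
HB.instance Definition _ := [Choice of lattice by <:].
HB.instance Definition _ := [SubChoice_isSubZmodule of lattice by <:].

Definition image_pred : {pred lattice} := fun x =>
  `[< exists z : 'cV[Zp]_n, lattice_val x = A *m z >].
Lemma image_zmod_closed : zmod_closed image_pred.
Proof.
split=> [|x y /asboolP[v xE] /asboolP[w yE]]; apply/asboolP.
  by exists 0; rewrite mulmx0.
by exists (v - w); rewrite mulmxBr -xE -yE.
Qed.
HB.instance Definition _ :=
  GRing.isZmodClosed.Build lattice image_pred image_zmod_closed.

Definition fin_coker : Type := {ideal_quot image_pred}.
HB.instance Definition _ := GRing.Zmodule.on fin_coker.
Definition fin_coker_pi (x : lattice) : fin_coker := \pi_{ideal_quot image_pred} x.
Definition fin_coker_repr (u : fin_coker) : lattice :=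
  generic_quotient.repr (u : {ideal_quot image_pred}).

Definition lattice_pairing (x y : lattice) : QpmodZp p_pr :=
  xget 0 [set t | exists (m : Zp) (z : 'cV[Zp]_n),
    [/\ m != 0, toQp x = (Zp_to_Qp m)^-1 *: toQp (A *m z)
      & t = QpmodZp_pi ((Zp_to_Qp m)^-1 * Zp_to_Qp ((z^T *m y) 0 0))]].

Definition fin_coker_pairing (u v : fin_coker) : QpmodZp p_pr :=
  lattice_pairing (fin_coker_repr u) (fin_coker_repr v).

Lemma lattice_pairingE (m : Zp) (z : 'cV[Zp]_n) (x y : lattice) : A^T = A ->
  m != 0 -> toQp x = (Zp_to_Qp m)^-1 *: toQp (A *m z) ->
  lattice_pairing x y =
    QpmodZp_pi ((Zp_to_Qp m)^-1 * Zp_to_Qp ((z^T *m y) 0 0)).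
Proof.
move=> symA m0 xE; have [w yE] : exists w : 'cV[Qp]_n, toQp y = toQp A *m w.
  by apply/asboolP; case: y.
suff valE (m' : Zp) (z' : 'cV[Zp]_n) :
    toQp x = (Zp_to_Qp m')^-1 *: toQp (A *m z') ->
    (Zp_to_Qp m')^-1 * Zp_to_Qp ((z'^T *m y) 0 0) = ((toQp x)^T *m w) 0 0.
  rewrite /lattice_pairing; set S := (X in xget _ X).
  have [m' [z' [_ /valE vE ->]]] : S (xget 0 S).
    by apply: xgetPex; eexists; exists m, z.
  by rewrite vE (valE _ _ xE).
move=> ->; rewrite linearZ /= -scalemxAl [RHS]mxE; congr (_ * _).
rewrite matrix.map_trmx trmx_mul symA map_mxM -mulmxA -yE -map_mxM.
by rewrite [RHS]mxE.
Qed.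

Lemma lattice_witness (x : lattice) : exists (m : Zp) (z : 'cV[Zp]_n),
  m != 0 /\ toQp x = (Zp_to_Qp m)^-1 *: toQp (A *m z).
Proof.
have [w xE] : exists w : 'cV[Qp]_n, toQp x = toQp A *m w.
  by apply/asboolP; case: x.
have /choice[a aP] (i : 'I_n) := fraction_numden (w i 0).
have /choice[b bP] (i : 'I_n) := aP i.
pose m := \prod_i b i.
have m0 : m != 0 by apply/prodf_neq0 => i _; have [] := bP i.
have Qm0 : Zp_to_Qp m != 0 by rewrite -(rmorph0 (@Zp_to_Qp p p_pr)) (inj_eq (@Zp_to_Qp_inj _ _)).
exists m, (\col_i (\prod_(j | j != i) b j * a i)); split=> //.
rewrite map_mxM scalemxAr xE; congr (_ *m _); apply/matrixP => i j.
rewrite !mxE ord1; apply: (canRL (mulKf Qm0)).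
have [bi0 ->] := bP i; rewrite -[tofrac (b i)]/(Zp_to_Qp (b i)) {1}/m (bigD1 i)//=.
rewrite !rmorphM /= mulrACA mulfV ?mul1r//.
by rewrite -(rmorph0 (@Zp_to_Qp p p_pr)) (inj_eq (@Zp_to_Qp_inj _ _)).
Qed.

Lemma fin_coker_pairingE (x y : lattice) : A^T = A ->
  fin_coker_pairing (fin_coker_pi x) (fin_coker_pi y) = lattice_pairing x y.
Proof.
have repr_pi (u : lattice) : exists v : 'cV[Zp]_n,
    lattice_val (fin_coker_repr (fin_coker_pi u)) = lattice_val u + A *m v.
  have /eqP : fin_coker_pi (fin_coker_repr (fin_coker_pi u)) = fin_coker_pi u.
    by rewrite /fin_coker_pi /fin_coker_repr reprK.
  rewrite /fin_coker_pi eqmodE => /asboolP[v vE]; exists v; rewrite -vE.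
  by rewrite addrC subrK.
move=> symA; rewrite /fin_coker_pairing.
have [x' x'E] := repr_pi x; have [y' y'E] := repr_pi y.
have [m [z [m0 xE]]] := lattice_witness x.
have Qm0 : Zp_to_Qp m != 0 by rewrite -(rmorph0 (@Zp_to_Qp p p_pr)) (inj_eq (@Zp_to_Qp_inj _ _)).
rewrite (lattice_pairingE y symA m0 xE).
rewrite (@lattice_pairingE m (z + m *: x') _ _ symA m0); last first.
  rewrite x'E map_mxD xE mulmxDr map_mxD scalerDr; congr (_ + _).
  by rewrite -scalemxAr map_mxZ scalerA mulVf// scale1r.
apply/QpmodZp_pi_eq.
have mxE' : m *: lattice_val x = A *m z.
  have /matrixP e : toQp (m *: lattice_val x) = toQp (A *m z).
    by rewrite map_mxZ xE scalerA mulfV// scale1r.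
  apply/matrixP => i j; apply: Zp_to_Qp_inj.
  by have := e i j; rewrite [LHS]mxE [RHS]mxE.
pose S := x'^T *m y + (lattice_val x)^T *m y' + x'^T *m (A *m y').
exists (S 0 0).
have -> : (z + m *: x')^T *m fin_coker_repr (fin_coker_pi y) =
    z^T *m y + m *: S.
  have zT : (z + m *: x')^T = z^T + m *: x'^T.
    by apply/matrixP => i j; rewrite !mxE.
  rewrite y'E zT mulmxDl !mulmxDr -!scalemxAl /S !scalerDr.
  have xT : m *: (lattice_val x)^T = (A *m z)^T by rewrite -mxE' linearZ.
  rewrite [m *: (_^T *m y')]scalemxAl xT.
  rewrite trmx_mul symA !mulmxA -!addrA; congr (_ + _); rewrite addrCA.
  by rewrite addrA.
have -> : (z^T *m y + m *: S) 0 0 = (z^T *m y) 0 0 + m * S 0 0.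
  by rewrite mxE; congr (_ + _); rewrite mxE.
by rewrite rmorphD rmorphM /= mulrDr mulKf// addrC addKr.
Qed.

End Lattice.
End FiniteCokernel.

Definition duality_pairing (G : zmodType) (delta : G -> G -> QmodZ) : Prop :=
  [/\ forall x y, delta x y = delta y x,
      forall x, {morph delta x : y z / y + z}
    & forall f : G -> QmodZ, {morph f : y z / y + z} ->
        exists! g, forall y, delta g y = f y].

Definition aut_pairing (G : finZmodType) (delta : G -> G -> QmodZ) :
    {set {perm G}} :=
  [set f in Aut [set: G]%G |
    [forall x, forall y, delta (f x) (f y) == delta x y]]%SET.

Definition pairing_isom (G H : zmodType) (dG : G -> G -> QmodZ)
    (dH : H -> H -> QmodZ) : Prop :=
  exists f : G -> H, [/\ bijective f, {morph f : x y / x + y}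
    & forall x y, dH (f x) (f y) = dG x y].

Definition fin_coker_isom (p : nat) (p_pr : prime p) (n : nat)
    (A : 'M[padic_int p_pr]_n) (G : zmodType) (delta : G -> G -> QmodZ) : Prop :=
  pairing_isom
    (fun u v : fin_coker A => QpmodZp_to_QmodZ (fin_coker_pairing u v)) delta.

Section ModP.
Variables (p : nat) (p_pr : prime p) (G : finZmodType).

Definition pmul_pred : {pred G} := fun x => [exists y : G, x == y *+ p].
Lemma pmul_zmod_closed : zmod_closed pmul_pred.
Proof.
split=> [|x y /existsP[a /eqP->] /existsP[b /eqP->]]; apply/existsP.
  by exists 0; rewrite mul0rn.
by exists (a - b); rewrite mulrnBl.
Qed.
HB.instance Definition _ :=
  GRing.isZmodClosed.Build G pmul_pred pmul_zmod_closed.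

(* The prime p_pr is a dummy argument on which the 'F_p-structure depends. *)
Definition modpG of prime p : Type := {ideal_quot pmul_pred}.
Local Notation V := (modpG p_pr).
HB.instance Definition _ := GRing.Zmodule.on V.
Definition modpG_pi (x : G) : V := \pi_{ideal_quot pmul_pred} x.

Lemma modpG_piP (v : V) : exists x, v = modpG_pi x.
Proof.
by exists (generic_quotient.repr (v : {ideal_quot pmul_pred})); rewrite /modpG_pi reprK.
Qed.

Lemma modpG_piD : {morph modpG_pi : x y / x + y}.
Proof. by move=> x y; rewrite /modpG_pi pi_addr. Qed.

Lemma modpG_mulrp (v : V) : v *+ p = 0.
Proof.
have [x ->] := modpG_piP v.
have piMn m : modpG_pi (x *+ m) = modpG_pi x *+ m.
  elim: m => [|m IH]; first by rewrite !mulr0n /modpG_pi pi_zeror.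
  by rewrite !mulrS modpG_piD IH.
rewrite -piMn -[0](_ : modpG_pi 0 = _); last by rewrite /modpG_pi pi_zeror.
apply/eqP; rewrite /modpG_pi eqmodE /= /Quotient.equiv subr0.
by apply/existsP; exists x.
Qed.

Lemma modpG_mulr_mod (v : V) m : v *+ (m %% p) = v *+ m.
Proof. by rewrite [in RHS](divn_eq m p) mulrnDr mulnC mulrnA modpG_mulrp mul0rn add0r. Qed.

Definition modpG_scale (a : 'F_p) (v : V) : V := v *+ a.

Lemma modpG_scaleA a b v : modpG_scale a (modpG_scale b v) = modpG_scale (a * b) v.
Proof.
by rewrite /modpG_scale -mulrnA mulnC /= [X in (_ %% X)%N]Fp_cast// modpG_mulr_mod.
Qed.
Lemma modpG_scale1 : left_id 1 modpG_scale.
Proof. by move=> v; rewrite /modpG_scale /= modn_small. Qed.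
Lemma modpG_scaleDr : right_distributive modpG_scale +%R.
Proof. by move=> a u v; rewrite /modpG_scale mulrnDl. Qed.
Lemma modpG_scaleDl v : {morph modpG_scale^~ v : a b / a + b}.
Proof.
move=> a b; rewrite /modpG_scale -mulrnDr /= [X in (_ %% X)%N]Fp_cast//.
by rewrite modpG_mulr_mod.
Qed.
HB.instance Definition _ := GRing.Zmodule_isLmodule.Build 'F_p V
  modpG_scaleA modpG_scale1 modpG_scaleDr modpG_scaleDl.

Let span_fun (u : 'rV['F_p]_#|G|) : V := \sum_i u 0 i *: modpG_pi (enum_val i).

Let span_linear : linear span_fun.
Proof.
move=> a u v; rewrite /span_fun scaler_sumr -big_split; apply: eq_bigr => i _ /=.
by rewrite !mxE scalerDl scalerA.
Qed.
HB.instance Definition _ := GRing.isLinear.Build _ _ _ _ span_fun span_linear.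

Let span_surj (v : V) : exists u, v = span_fun u.
Proof.
have [x ->] := modpG_piP v; exists (delta_mx 0 (enum_rank x)).
rewrite /span_fun (bigD1 (enum_rank x))//= mxE !eqxx scale1r enum_rankK big1 ?addr0//.
by move=> i /negPf ix; rewrite mxE ix scale0r.
Qed.

Let kerV : 'M['F_p]_#|G| := (\sum_(u | span_fun u == 0) <<u>>)%MS.

Let kerVP u : (u <= kerV)%MS -> span_fun u = 0.
Proof.
case/sub_sumsmxP => w ->; rewrite raddf_sum big1// => v /eqP v0.
have /submxP[c ->] : (w v *m <<v>> <= v)%MS.
  by rewrite (submx_trans (submxMl _ _))// genmxE.
by rewrite /= [c]mx11_scalar mul_scalar_mx linearZ_LR /= v0 scaler0.
Qed.

Let dimV := \rank (kerV^C)%MS.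
Let coordV (w : 'rV['F_p]_dimV) : V := span_fun (w *m row_base (kerV^C)%MS).

Let coordV_linear : linear coordV.
Proof. by move=> a u v; rewrite /coordV mulmxDl -scalemxAl linearP. Qed.

Let coordV_inj (w : 'rV_dimV) : coordV w = 0 -> w = 0.
Proof.
move=> w0; have wK : (w *m row_base (kerV^C)%MS <= kerV)%MS.
  by rewrite /kerV (sumsmx_sup (w *m row_base (kerV^C)%MS)) ?genmxE//; apply/eqP.
have wC : (w *m row_base (kerV^C)%MS <= kerV^C)%MS.
  by rewrite (submx_trans (submxMl _ _))// eq_row_base.
have : (w *m row_base (kerV^C)%MS <= kerV :&: kerV^C)%MS by rewrite sub_capmx wK.
rewrite capmx_compl submx0 => /eqP e.
by apply: (row_free_inj (row_base_free (kerV^C)%MS)); rewrite e mul0mx.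
Qed.

Let coordV_surj v : exists w, v = coordV w.
Proof.
have [u ->] := span_surj v.
have : (u <= kerV + kerV^C)%MS by rewrite (submx_full _ (addsmx_compl_full _)).
case/sub_addsmxP => -[a b] /= ->; rewrite linearD /= kerVP ?submxMl// add0r.
have /submxP[w wE] : (b *m kerV^C <= row_base kerV^C)%MS.
  by rewrite eq_row_base submxMl.
by exists w; rewrite /coordV -wE.
Qed.

Let modpG_vect_axiom : Vector.axiom dimV V.
Proof.
pose g v := xget 0 [set w | v = coordV w].
have gK v : coordV (g v) = v by have := xgetPex 0 (coordV_surj v).
have cI : injective coordV.
  move=> a b ab; apply/eqP; rewrite -subr_eq0; apply/eqP/coordV_inj.
  by rewrite -[a - b](addrC (- b)) -scaleN1r coordV_linear scaleN1r ab addNr.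
exists g; last by exists coordV => [v|w]; [exact: gK|apply: cI; exact: gK].
by move=> a u v; apply: cI; rewrite coordV_linear !gK.
Qed.
HB.instance Definition _ := Lmodule_hasFinDim.Build 'F_p V modpG_vect_axiom.

End ModP.

(* Main.v *)
Require Import Defs.
From HB Require Import structures.
From mathcomp Require Import all_boot all_order all_algebra all_fingroup.
From mathcomp Require Import all_solvable.
From mathcomp Require Import all_classical all_reals all_analysis.
From mathcomp Require Import measurable_realfun ring zify.

Set Implicit Arguments.
Unset Strict Implicit.
Unset Printing Implicit Defensive.

Import Order.TTheory GRing.Theory Num.Theory.
Import numFieldNormedType.Exports.
Local Open Scope ring_scope.

(** Put [m = n - 1]. Deleting the first row and column identifies Sym^0_n(Z_p) with
    Sym_m(Z_p), compatibly with Haar measure, and it does not change the finite cokernel,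
    because [A = C^T M C] with [M] the minor and [C] a split surjection. The singular [M] form
    a null set: [M + t] is singular for at most [m] scalars [t].

    For nonsingular [M], an isomorphism from coker [M] to [(G, delta)] is a generating tuple
    [g] in [G^m] with [M^-1 = (delta (g_i) (g_j))] modulo [Z_p]; each [M] in the event has
    #Aut(G, delta) of these. The probability is therefore the sum over generating tuples [g]
    of the measure of the set of [M] whose inverse lifts the Gram matrix of [g], divided by
    #Aut(G, delta).

    If [A] is one such matrix, the others are [A + A T A] with [T] symmetric and [1 + T A]
    invertible. In Smith coordinates for [A] this is a translate of [D Sym_m D], [D] diagonal
    with determinant #G up to a unit, cut out by a condition on the reduction modulo [p] of
    an [(m - r)]-block of [T]. Its measure is thus #G^-(m+1) times the proportion of
    invertible matrices among symmetric [(m - r)]-matrices over F_p. By Nakayama there are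
    #G^m prod_(i < r) (1 - p^(i - m)) generating tuples.

    Measurability of the whole event, singular matrices included, follows from the fact that
    among symmetric matrices of a fixed rank the event is open. *)

(** * Symmetric matrices over a finite field *)

(** [M^-1] has denominators and [delta] takes values in [Q/Z]. Both are handled inside [Z_p]: with
    [p^e] killing [G], the proof uses the integral matrix [Y = p^e M^-1], and the Gram condition
    becomes a congruence modulo [p^e].

    That some [M] belongs to a given generating tuple has to be proved. A lift of the Gram matrix to
    [Z_p] is only determined modulo [p^e] and may be singular, so it must be corrected without
    changing its class; Smith coordinates show where the correction is needed.

    Haar measure enters through translation invariance alone: a set cut out by congruences is a
    disjoint union of translates of one box, and the measure of a box is the reciprocal of the
    number of translates that fill the group.

    The exponent [m + 1] of [#G] arises because entry [(i, j)] of [D T D] carries [p^(f_i + f_j)]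
    and each [f_i] occurs [m + 1] times in the sum over [i <= j]. The [#G^m] in the number of tuples
    then leaves a single factor [#G] in the denominator. *)

Lemma unitmx_kerP (F : fieldType) (m : nat) (A : 'M[F]_m) :
  reflect (forall x : 'rV_m, x *m A = 0 -> x = 0) (A \in unitmx).
Proof.
apply: (iffP idP) => [uA x xA0|kA].
  by rewrite -(mulmxK uA x) xA0 mul0mx.
rewrite -row_free_unit -kermx_eq0; apply/eqP/row_matrixP => i.
by rewrite row0; apply: kA; rewrite -row_mul mulmx_ker row0.
Qed.

Section SymmetricCount.
Variable F : finFieldType.
Local Notation q := #|F|.

Definition sym_set m := [set T : 'M[F]_m | T^T == T].
Definition sym_unit_set m := [set T in sym_set m | T \in unitmx].

Definition bord_mx m (a : F) (v : 'rV[F]_m) (B : 'M[F]_m) : 'M[F]_(1 + m) :=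
  block_mx a%:M v v^T B.

Lemma bord_mx_sym m a (v : 'rV[F]_m) B :
  (bord_mx a v B \in sym_set (1 + m)) = (B \in sym_set m).
Proof.
rewrite !inE /bord_mx tr_block_mx tr_scalar_mx trmxK; apply/eqP/eqP => [|->//].
by move/eq_block_mx => -[].
Qed.

Lemma sym_bord_mx m (T : 'M[F]_(1 + m)) : T \in sym_set (1 + m) ->
  T = bord_mx (T 0 0) (ursubmx T) (drsubmx T).
Proof.
rewrite inE => /eqP sT; rewrite /bord_mx -[LHS]submxK; congr block_mx.
  apply/matrixP => i j; rewrite !ord1 !mxE eqxx mulr1n /=.
  by congr (T _ _); apply: val_inj.
by rewrite trmx_ursub sT.
Qed.

Lemma card_sym_bord m (P : pred 'M[F]_(1 + m)) :
  #|[set T in sym_set (1 + m) | P T]| =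
  (\sum_(a : F) \sum_(v : 'rV[F]_m) #|[set B in sym_set m | P (bord_mx a v B)]|)%N.
Proof.
pose h (x : F * 'rV[F]_m * 'M[F]_m) := bord_mx x.1.1 x.1.2 x.2.
have h_inj : injective h.
  move=> [[a v] B] [[a' v'] B'] /eq_block_mx /= [aE -> _ ->].
  by move/matrixP: aE => /(_ 0 0); rewrite !mxE eqxx !mulr1n => ->.
have -> : [set T in sym_set (1 + m) | P T] =
    h @: [set x | (x.2 \in sym_set m) && P (h x)].
  apply/setP => T; rewrite !inE; apply/andP/imsetP => [[sT PT]|[x]]; last first.
    by rewrite inE => /andP[sx Px] ->; split=> //; have := bord_mx_sym x.1.1 x.1.2 x.2;
      rewrite sx inE.
  have sT' : T \in sym_set (1 + m) by rewrite inE.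
  exists (T 0 0, ursubmx T, drsubmx T); last by rewrite /h /= -sym_bord_mx.
  rewrite inE /= -(bord_mx_sym (T 0 0) (ursubmx T)).
  by rewrite /h /= -sym_bord_mx// sT' PT.
rewrite card_imset// -sum1_card (eq_bigl (fun x => (x.2 \in sym_set m) && P (h x))); last first.
  by move=> x; rewrite inE.
rewrite -(pair_big_dep xpredT (fun av B => (B \in sym_set m) && P (h (av, B)))
  (fun _ _ => 1%N)) /=.
rewrite -(pair_big_dep xpredT (fun a v => true)
  (fun a v => \sum_(B | (B \in sym_set m) && P (h (a, v, B))) 1)%N) /=.
apply: eq_bigr => a _; apply: eq_bigr => v _.
by rewrite -sum1_card; apply: eq_bigl => B; rewrite !inE.
Qed.

Lemma card_symS m : #|sym_set m.+1| = (q ^ m.+1 * #|sym_set m|)%N.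
Proof.
have := @card_sym_bord m predT.
rewrite (_ : [set T in _ | _] = sym_set m.+1); last by apply/setP => T; rewrite !inE andbT.
move=> ->; transitivity (\sum_(a : F) \sum_(v : 'rV[F]_m) #|sym_set m|)%N.
  apply: eq_bigr => a _; apply: eq_bigr => v _; apply: eq_card => T.
  by rewrite !inE andbT.
by rewrite !sum_nat_const card_mx mul1n mulnA -expnS.
Qed.

Lemma card_sym_gt0 m : (0 < #|sym_set m|)%N.
Proof. by apply/card_gt0P; exists 0; rewrite inE trmx0. Qed.

(** Clearing the first column with the pivot [a] leaves the Schur complement of the corner. *)
Lemma bord_unit m a (v : 'rV[F]_m) B : a != 0 ->
  (bord_mx a v B \in unitmx) = (B - a^-1 *: (v^T *m v) \in unitmx).
Proof.
move=> a0; pose L : 'M[F]_(1 + m) := block_mx 1%:M 0 (- a^-1 *: v^T) 1%:M.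
have uL : L \in unitmx by rewrite unitmxE det_lblock !det1 mulr1 unitr1.
have : L *m bord_mx a v B = block_mx a%:M v 0 (B - a^-1 *: (v^T *m v)).
  rewrite mulmx_block !mul1mx !mul0mx !addr0; congr block_mx.
    by rewrite mul_mx_scalar scalerA mulrN mulfV// scaleN1r addNr.
  by rewrite -scalemxAl scaleNr addrC.
move=> /(congr1 (fun M => M \in unitmx)); rewrite unitmx_mul uL /= => ->.
by rewrite !unitmxE det_ublock det_scalar unitrM expr1 unitfE a0.
Qed.

Lemma card_sym_unit_shift m (C : 'M[F]_m) : C^T = C ->
  #|[set B in sym_set m | B - C \in unitmx]| = #|sym_unit_set m|.
Proof.
move=> sC; rewrite -[RHS](card_imset _ (addIr C)); apply: eq_card => B.
apply/idP/imsetP => [|[B']].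
  rewrite !inE => /andP[/eqP sB uB]; exists (B - C); last by rewrite subrK.
  by rewrite !inE linearB /= sB sC eqxx.
by rewrite !inE => /andP[/eqP sB uB] ->; rewrite linearD /= sB sC eqxx addrK.
Qed.

Lemma row_to_delta m (v : 'rV[F]_m.+1) : v != 0 ->
  exists2 Q : 'M[F]_m.+1, Q \in unitmx & v *m Q = delta_mx 0 0.
Proof.
move=> v0; have rv : \rank v = 1%N.
  apply/eqP; rewrite eqn_leq rank_leq_row lt0n mxrank_eq0 v0 //.
pose c := col_ebase v 0 0.
have cu : c \is a GRing.unit.
  by have := col_ebase_unit v; rewrite unitmxE (mx11_scalar (col_ebase v)) det_scalar expr1.
exists (c^-1 *: invmx (row_ebase v)).
  by rewrite unitmxZ ?unitrV ?unitmx_inv ?row_ebase_unit.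
rewrite -{1}(mulmx_ebase v) -scalemxAr mulmxK ?row_ebase_unit//.
rewrite (mx11_scalar (col_ebase v)) mul_scalar_mx scalerA mulVr// scale1r rv.
by apply/matrixP => i j; rewrite !mxE ord1 /= andbT; case: j => -[].
Qed.

(** For a kernel vector [(x0, x1, y)] the first column gives [x1 = 0], the last block gives
    [y C = 0], and the second column recovers [x0 = - y w^T]. Invertibility thus depends on [C]
    alone. *)
Lemma bord0_unit m b (w : 'rV[F]_m) C :
  (bord_mx 0 (row_mx 1%:M 0 : 'rV_(1 + m)) (bord_mx b w C) \in unitmx) = (C \in unitmx).
Proof.
apply/unitmx_kerP/unitmx_kerP => kM.
  move=> y yC; have := kM (row_mx (- (y *m w^T)) (row_mx 0 y)).
  rewrite mul_row_block tr_row_mx trmx1 trmx0 mul_row_col !mul0mx mulmx0 addr0.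
  rewrite mul_mx_scalar scale0r add0r mul_mx_row mulmx1 mulmx0.
  rewrite [row_mx 0 y *m bord_mx _ _ _]mul_row_block yC !mul0mx !add0r.
  by rewrite add_row_mx addNr addr0 !row_mx0 => /(_ erefl)/eqP;
    rewrite -!row_mx0 => /eqP/eq_row_mx[_ /eq_row_mx[_ ->]].
move=> x; rewrite -[x]hsubmxK -[rsubmx x]hsubmxK.
set x0 := lsubmx x; set x1 := lsubmx (rsubmx x); set y := rsubmx (rsubmx x).
rewrite mul_row_block tr_row_mx trmx1 trmx0 mul_row_col mulmx0 addr0.
rewrite mul_mx_scalar scale0r add0r mul_mx_row mulmx1 mulmx0.
rewrite [row_mx x1 y *m bord_mx _ _ _]mul_row_block add_row_mx add0r => h.
have [x10 hr] : x1 = 0 /\ row_mx (x0 + (x1 *m b%:M + y *m w^T)) (x1 *m w + y *m C) = 0.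
  by move/eqP: h; rewrite mulmx1 row_mx_eq0 => /andP[/eqP-> /eqP].
move: hr; rewrite x10 !mul0mx !add0r -(@row_mx0 _ _ 1 m) => /eq_row_mx[hx /kM y0].
by move: hx; rewrite y0 mul0mx addr0 => ->; rewrite !row_mx0.
Qed.

(** A congruence by [Q] carries [v] to the first basis vector and permutes the symmetric matrices
    [B]. The first row of the new [B] is then free, which accounts for [q ^ m.+1]. *)
Lemma card_bord0_unit m (v : 'rV[F]_m.+1) : v != 0 ->
  #|[set B in sym_set m.+1 | bord_mx 0 v B \in unitmx]| =
  (q ^ m.+1 * #|sym_unit_set m|)%N.
Proof.
move=> v0; have [Q uQ vQ] := row_to_delta v0.
pose e : 'rV[F]_m.+1 := delta_mx 0 0.
transitivity #|[set B in sym_set m.+1 | bord_mx 0 e B \in unitmx]|.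
  have cj_inj : injective (fun B : 'M[F]_m.+1 => Q^T *m B *m Q).
    move=> B B' /(congr1 (fun M => invmx Q^T *m M *m invmx Q)).
    by rewrite /= !mulmxA !mulVmx ?unitmx_tr// !mul1mx !mulmxK.
  have conjE B : bord_mx 0 e (Q^T *m B *m Q) =
      (block_mx 1%:M 0 0 Q)^T *m bord_mx 0 v B *m block_mx 1%:M 0 0 Q.
    rewrite tr_block_mx !trmx1 !trmx0 !mulmx_block !mul1mx !mul0mx !mulmx1 !mulmx0.
    by rewrite !addr0 !add0r vQ -trmx_mul vQ.
  have uP : (block_mx 1%:M 0 0 Q : 'M[F]_(1 + m.+1)) \in unitmx.
    by rewrite unitmxE det_ublock det1 mul1r -unitmxE.
  rewrite -(card_imset _ cj_inj); apply: eq_card => B; apply/imsetP/idP => [[B']|].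
    rewrite !inE => /andP[/eqP sB uB] ->; rewrite !trmx_mul trmxK sB mulmxA eqxx /=.
    by rewrite conjE !unitmx_mul unitmx_tr uP uB.
  rewrite !inE => /andP[/eqP sB uB].
  have BE : B = Q^T *m (invmx Q^T *m B *m invmx Q) *m Q.
    by rewrite !mulmxA mulmxV ?unitmx_tr// mul1mx mulmxKV.
  exists (invmx Q^T *m B *m invmx Q) => //.
  rewrite !inE !trmx_mul !trmx_inv sB trmxK mulmxA eqxx /=.
  by move: uB; rewrite {1}BE conjE !unitmx_mul uP andbT => /andP[].
have := @card_sym_bord m (fun B => bord_mx 0 e B \in unitmx).
move=> ->; transitivity (\sum_(a : F) \sum_(v : 'rV[F]_m) #|sym_unit_set m|)%N.
  apply: eq_bigr => b _; apply: eq_bigr => w _; apply: eq_card => C.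
  rewrite !inE; congr (_ && _).
  have eE : e = row_mx 1%:M 0 :> 'rV_(1 + m).
    apply/matrixP => i j; rewrite !mxE ord1 eqxx /=; case: splitP => k jk.
      by rewrite [k]ord1 !mxE /= -val_eqE /= jk ord1.
    by rewrite !mxE -val_eqE /= jk.
  by rewrite eE bord0_unit.
by rewrite !sum_nat_const card_mx mul1n mulnA -expnS.
Qed.

(** Split by the corner [a] and the border [v]. For [a] nonzero the Schur complement is a translate
    of [B]; for [a = 0] the matrix is singular when [v = 0], and [card_bord0_unit] applies
    otherwise. *)
Lemma card_sym_unitSS m :
  (#|sym_unit_set m.+2| = q.-1 * q ^ m.+1 * #|sym_unit_set m.+1| +
     (q ^ m.+1).-1 * q ^ m.+1 * #|sym_unit_set m|)%N.
Proof.
have := @card_sym_bord m.+1 (fun B => B \in unitmx); rewrite -/(sym_unit_set _) => ->.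
rewrite (bigD1 0)//= addnC; congr (_ + _)%N.
  transitivity (\sum_(a : F | a != 0%R) (q ^ m.+1 * #|sym_unit_set m.+1|))%N.
    apply: eq_bigr => a a0; transitivity (\sum_(v : 'rV[F]_m.+1) #|sym_unit_set m.+1|)%N.
      apply: eq_bigr => v _; under eq_finset => B do rewrite bord_unit//.
      by rewrite card_sym_unit_shift// linearZ /= trmx_mul trmxK.
    by rewrite sum_nat_const card_mx mul1n.
  rewrite sum_nat_const mulnA; congr (_ * _ * _)%N.
  have := cardC1 (0 : F); rewrite -[RHS]/(#|F|.-1) => <-; by apply: eq_card.
rewrite (bigD1 0)//= -[RHS]add0n; congr (_ + _)%N.
  apply/eqP; rewrite cards_eq0; apply/eqP/setP => B; rewrite !inE.
  apply/negbTE/negP => /andP[_ /unitmx_kerP/(_ (row_mx 1%:M 0))].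
  rewrite mul_row_block !mul0mx mul1mx mulmx0 !addr0.
  rewrite (raddf0 (@scalar_mx F 1)) row_mx0 => /(_ erefl)/eqP.
  by rewrite row_mx_eq0 oner_eq0.
transitivity (\sum_(v : 'rV[F]_m.+1 | v != 0%R) (q ^ m.+1 * #|sym_unit_set m|))%N.
  by apply: eq_bigr => v v0; rewrite card_bord0_unit.
rewrite sum_nat_const mulnA; congr (_ * _ * _)%N.
have := cardC1 (0 : 'rV[F]_m.+1); rewrite card_mx mul1n => <-; by apply: eq_card.
Qed.

(** This will be the reduction modulo [p] of the reference matrix [A] in Smith coordinates, with
    [j = r]: its invariant factors are units exactly from index [r] on. *)
Definition diag_from m (j : nat) : 'M[F]_m := \matrix_(i, k) ((i == k) && (j <= i)%N)%:R.

Definition sym_shift_set m j :=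
  [set T in sym_set m | 1%:M + T *m diag_from m j \in unitmx].

Lemma card_sym_shift0 m : #|sym_shift_set m 0| = #|sym_unit_set m|.
Proof.
rewrite -(@card_sym_unit_shift m (- 1%:M)) ?linearN /= ?trmx1//.
apply: eq_card => T; rewrite !inE opprK addrC.
by rewrite (_ : diag_from m 0 = 1%:M) ?mulmx1//; apply/matrixP => i j; rewrite !mxE andbT.
Qed.

(** [1 + T J] is block triangular with corner 1, so the first row of [T] is free. *)
Lemma card_sym_shiftS m j :
  #|sym_shift_set m.+1 j.+1| = (q ^ m.+1 * #|sym_shift_set m j|)%N.
Proof.
have -> := @card_sym_bord m (fun T => 1%:M + T *m diag_from m.+1 j.+1 \in unitmx).
transitivity (\sum_(a : F) \sum_(v : 'rV[F]_m) #|sym_shift_set m j|)%N.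
  apply: eq_bigr => a _; apply: eq_bigr => v _; apply: eq_card => B.
  rewrite !inE; congr (_ && _).
  have -> : diag_from m.+1 j.+1 = block_mx 0 0 0 (diag_from m j) :> 'M[F]_(1 + m).
    apply/matrixP => i k; rewrite !mxE; case: splitP => i' iE; rewrite !mxE.
      case: splitP => k' kE; rewrite !mxE iE ord1 ?ltn0 ?andbF//.
    case: splitP => k' kE; rewrite !mxE -!val_eqE /= iE kE /= ?ord1//.
  have -> : bord_mx a v B *m (block_mx 0 0 0 (diag_from m j) : 'M[F]_(1 + m)) =
      block_mx 0 (v *m diag_from m j) 0 (B *m diag_from m j).
    by rewrite mulmx_block !mulmx0 !add0r.
  by rewrite [1%:M in LHS](@scalar_mx_block _ 1 m) add_block_mx !add0r !addr0 !unitmxE det_ublock det1 mul1r.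
by rewrite !sum_nat_const card_mx mul1n mulnA -expnS.
Qed.

Lemma sym_unit_ratio (K : numFieldType) m :
  #|sym_unit_set m|%:R / #|sym_set m|%:R =
  \prod_(1 <= i < (uphalf m).+1) (1 - (q%:R : K) ^ (1 - 2 * i%:Z)).
Proof.
have q0 : q%:R != 0 :> K by rewrite pnatr_eq0 -lt0n; apply/card_gt0P; exists 0.
have qX k : ((q ^ k)%:R : K) != 0 by rewrite natrX expf_neq0.
have s0 k : #|sym_set k|%:R != 0 :> K by rewrite pnatr_eq0 -lt0n card_sym_gt0.
pose al k : K := #|sym_unit_set k|%:R / #|sym_set k|%:R.
have al0 : al 0%N = 1.
  rewrite /al (_ : sym_unit_set 0 = sym_set 0) ?mulfV//.
  by apply/setP => T; rewrite !inE unitmxE det_mx00 unitr1 andbT.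
have al1 : al 1%N = 1 - q%:R^-1.
  rewrite /al card_symS (_ : sym_set 0 = [set: 'M[F]_0]); last first.
    by apply/setP => T; rewrite !inE; apply/eqP/matrixP => -[].
  have -> : sym_unit_set 1 = [set x%:M | x in [set~ (0 : F)]].
    apply/setP => T; rewrite !inE unitmxE (mx11_scalar T) tr_scalar_mx eqxx /=.
    rewrite det_scalar expr1 unitfE; apply/idP/imsetP => [t0|[x]].
      by exists (T 0 0); rewrite ?inE.
    by rewrite !inE => x0 /(congr1 (fun M : 'M[F]_1 => M 0 0)); rewrite !mxE eqxx !mulr1n => ->.
  rewrite card_imset; last first.
    by move=> x y /(congr1 (fun M : 'M[F]_1 => M 0 0)); rewrite !mxE eqxx !mulr1n.
  rewrite cardsC1 cardsT card_mx mul0n expn0 muln1 expn1 -subn1 natrB.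
    by rewrite mulrBl mulfV// mul1r.
  by apply/card_gt0P; exists 0.
have alSS k : al k.+2 = (1 - q%:R^-1) * al k.+1 + q%:R^-1 * (1 - q%:R ^- k.+1) * al k.
  rewrite /al card_sym_unitSS !card_symS -!subn1 natrD !natrM !natrB ?expn_gt0; first last.
  - by apply/card_gt0P; exists 0.
  - by apply/orP; left; apply/card_gt0P; exists 0.
  move: (expf_neq0 k q0) (s0 k); rewrite !natrX !exprS.
  set Q := q%:R ^+ k; set u := #|sym_unit_set _|%:R; set w := #|sym_unit_set _|%:R.
  set s := #|_|%:R => Q0 sn0.
  by field; rewrite Q0 q0 sn0.
(* The recursion is solved two steps at a time: from [2k] to [2k+1] the proportion gains the factor
   [1 - q^-(2k+1)], and from [2k+1] to [2k+2] it is unchanged. *)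
suff H k : al k.*2 = \prod_(1 <= i < k.+1) (1 - (q%:R : K) ^ (1 - 2 * i%:Z)) /\
  al k.*2.+1 = \prod_(1 <= i < k.+2) (1 - (q%:R : K) ^ (1 - 2 * i%:Z)).
  rewrite -/(al m) -[m in LHS]odd_double_half uphalf_half.
  by case: (odd m); rewrite ?add1n ?add0n; have [? ?] := H m./2.
have powE i : (q%:R : K) ^ (1 - 2 * (i.+1)%:Z) = q%:R ^- i.*2.+1.
  have -> : q%:R ^- i.*2.+1 = (q%:R : K) ^ (- (i.*2.+1)%:Z) by rewrite -exprnN.
  congr (_ ^ _); rewrite -[i.+1]addn1 PoszD mulrDr opprD mulr1.
  have -> : (i.*2.+1)%:Z = 2 * i%:Z + 1 by rewrite -muln2 -addn1 PoszD PoszM mulrC.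
  by ring.
elim: k => [|k [IH0 IH1]].
  by rewrite big_geq// big_nat1 (powE 0%N) expr1.
rewrite doubleS alSS IH1 IH0 big_nat_recr//= powE.
have alE : al k.*2.+2 = \prod_(1 <= i < k.+2) (1 - (q%:R : K) ^ (1 - 2 * i%:Z)).
  by rewrite alSS IH1 IH0 big_nat_recr//= powE; ring.
split; first by ring.
rewrite alSS alE IH1 [in RHS]big_nat_recr//= powE doubleS.
have -> : (q%:R : K) ^- k.*2.+3 = q%:R^-1 * q%:R ^- k.*2.+2 by rewrite exprS invfM.
by move: (q%:R ^- k.*2.+2) (\prod_(1 <= i < k.+2) _) => x y; ring.
Qed.

Lemma card_sym_shift_ratio (K : numFieldType) m j : (j <= m)%N ->
  #|sym_shift_set m j|%:R / #|sym_set m|%:R =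
  #|sym_unit_set (m - j)|%:R / #|sym_set (m - j)|%:R :> K.
Proof.
elim: j m => [|j IH] m; first by rewrite subn0 card_sym_shift0.
case: m => // m jm; rewrite subSS -IH// card_sym_shiftS card_symS !natrM -mulf_div.
rewrite mulfV ?mul1r// pnatr_eq0 -lt0n expn_gt0; apply/orP; left.
by apply/card_gt0P; exists 0.
Qed.

(** A new row keeps the rows independent exactly when it avoids the span of the [r] others, which
    has [q ^ r] elements. *)
Lemma card_row_free r m :
  #|[set A : 'M[F]_(r, m) | row_free A]| = (\prod_(i < r) (q ^ m - q ^ i))%N.
Proof.
elim: r => [|r IH].
  rewrite big_ord0 (_ : [set A | _] = [set: 'M[F]_(0, m)]); first by rewrite cardsT card_mx mul0n.
  by apply/setP => A; rewrite !inE /row_free -leqn0 rank_leq_row.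
rewrite big_ord_recr /= -IH.
pose h (x : 'M[F]_(r, m) * 'rV[F]_m) : 'M[F]_(1 + r, m) := col_mx x.2 x.1.
have h_inj : injective h by move=> [A a] [B b] /eq_col_mx[/= -> ->].
have freeE v (A : 'M[F]_(r, m)) :
    row_free (col_mx v A : 'M[F]_(1 + r, m)) = (row_free A && ~~ (v <= A)%MS).
  apply/idP/andP => [fA|[fA vA]].
    split.
      apply/inj_row_free => y yA0.
      have /(row_free_inj fA)/eqP : row_mx 0 y *m col_mx v A = 0 *m col_mx v A.
        by rewrite mul_row_col mul0mx yA0 mul0mx addr0.
      by rewrite row_mx_eq0 => /andP[_ /eqP].
    apply/negP => /submxP[D vE].
    have /(row_free_inj fA)/eqP : (row_mx 1%:M (- D)) *m col_mx v A = 0 *m col_mx v A.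
      by rewrite mul_row_col mul1mx mulNmx -vE subrr mul0mx.
    by rewrite row_mx_eq0 oner_eq0.
  apply/inj_row_free => x; rewrite -[x]hsubmxK mul_row_col.
  set a := lsubmx x; set y := rsubmx x => h0.
  have a0 : a = 0.
    apply/eqP; apply: contraNT vA => a0.
    have a00 : a 0 0 != 0.
      by apply: contraNneq a0 => a00; rewrite (mx11_scalar a) a00 raddf0.
    apply/submxP; exists (- (a 0 0)^-1 *: y); rewrite -scalemxAl.
    have -> : y *m A = - (a 0 0 *: v).
      by apply/eqP; rewrite -addr_eq0 addrC -mul_scalar_mx -mx11_scalar h0.
    by rewrite scalerN scaleNr opprK scalerA mulVf// scale1r.
  have y0 : y = 0 by apply: (row_free_inj fA); rewrite mul0mx -h0 a0 mul0mx add0r.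
  by rewrite a0 y0 row_mx0.
have -> : [set A : 'M[F]_(r.+1, m) | row_free A] =
    h @: [set x | row_free x.1 && ~~ (x.2 <= x.1)%MS].
  apply/setP => A; move: (A : 'M[F]_(1 + r, m)) => {}A.
  rewrite inE -[A]vsubmxK; apply/idP/imsetP => [|[x]].
    by rewrite freeE => fA; exists (dsubmx A, usubmx A); rewrite ?inE.
  by rewrite inE => fx ->; rewrite freeE.
rewrite card_imset// -sum1_card (eq_bigl (fun x => row_free x.1 && ~~ (x.2 <= x.1)%MS)); last first.
  by move=> x; rewrite inE.
rewrite -(pair_big_dep (fun A : 'M[F]_(r, m) => row_free A) (fun A v => ~~ (v <= A)%MS)
  (fun _ _ => 1%N)) /=.
rewrite -sum_nat_const; apply: eq_big => [A|A fA]; first by rewrite inE.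
rewrite sum1_card; have <- : #|{: 'rV[F]_m}| = (q ^ m)%N by rewrite card_mx mul1n.
have <- : #|[set v : 'rV[F]_m | (v <= A)%MS]| = (q ^ r)%N.
  have <- : #|{: 'rV[F]_r}| = (q ^ r)%N by rewrite card_mx mul1n.
  rewrite -cardsT.
  rewrite -(card_imset _ (row_free_inj fA : injective ((@mulmx F 1 r m)^~ A))).
  apply: eq_card => v; rewrite inE; apply/submxP/imsetP => [[D ->]|[D _ ->]].
    by exists D; rewrite ?inE.
  by exists D.
rewrite -(cardsC [set v : 'rV[F]_m | (v <= A)%MS]) addKn.
by apply: eq_card => v; rewrite !inE.
Qed.

End SymmetricCount.

(** * Arithmetic of the p-adic integers *)

Section PadicArithmetic.
Variables (p : nat) (p_pr : prime p).
Local Notation Zp := (padic_int p_pr).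
Implicit Types x y z : Zp.

Lemma residue_lt x k : (x k < p ^ k.+1)%N.
Proof. by have := ltn_ord (x k); rewrite [X in (_ < X)%N]Zp_cast ?expp_gt1. Qed.

Lemma residue_sub x y k : (x - y) k = x k - y k. Proof. by []. Qed.

Lemma residue_pX k j : (k < j)%N -> (p%:R ^+ j : Zp) k = 0.
Proof.
move=> kj; rewrite -natrX residue_nat; apply: val_inj.
by rewrite /= val_Zp_nat ?expp_gt1//; apply/eqP/dvdn_exp2l.
Qed.

Lemma residue_eq0P x k : (x k = 0) <-> exists y, x = p%:R ^+ k.+1 * y.
Proof.
split=> [xk0|[y ->]]; last by rewrite residueM residue_pX// mul0r.
have dv j : (p ^ k.+1 %| x (j + k.+1))%N.
  by rewrite /dvdn residue_mod ?xk0// addnS leqW// leq_addl.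
(* Dividing by [p ^ k.+1] costs [k.+1] digits, so the quotient at level [j] is read off [x] at level
   [j + k.+1]. *)
pose f j : 'Z_(p ^ j.+1) := (x (j + k.+1) %/ p ^ k.+1)%:R.
have fE j : f j = (x (j + k.+1) %/ p ^ k.+1 %% p ^ j.+1)%N :> nat.
  by rewrite /f val_Zp_nat ?expp_gt1.
have fP j : (f j.+1 : nat)%:R = f j.
  apply: modZ_natr => //; rewrite !fE modn_mod modn_dvdm ?dvdn_exp2l//.
  have <- : (x (j.+1 + k.+1) %% p ^ (j + k.+1).+1 = x (j + k.+1))%N.
    by rewrite residue_mod.
  rewrite -[(j + k.+1).+1]addSn expnD.
  have [q qE] := dvdnP (dv j.+1); rewrite qE mulnK ?expn_gt0 ?prime_gt0//.
  by rewrite -muln_modl mulnK ?expn_gt0 ?prime_gt0// modn_mod.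
exists (PadicInt p_pr fP); apply: padic_int_eqP => j.
rewrite residueM -natrX residue_nat /= /f -natrM mulnC divnK//.
apply/esym/modZ_natr => //; rewrite -[in RHS](residue_mod x (leq_addr k.+1 j)) modn_mod //.
Qed.

Lemma residue_eqP x y k : (x k = y k) <-> exists z, x - y = p%:R ^+ k.+1 * z.
Proof. by rewrite -residue_eq0P residue_sub; split=> [->|/eqP]; rewrite ?subrr// subr_eq0 => /eqP. Qed.

Lemma residue_expand x k : exists y, x = (x k : nat)%:R + p%:R ^+ k.+1 * y.
Proof.
have /residue_eqP[z zE] : x k = ((x k : nat)%:R : Zp) k.
  by rewrite residue_nat; apply/esym/modZ_natr.
by exists z; rewrite -zE addrC subrK.
Qed.

Lemma pX_neq0 k : p%:R ^+ k != 0 :> Zp.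
Proof. by rewrite expf_neq0// padic_p_neq0. Qed.

Lemma mulpXI k : injective (fun x => p%:R ^+ k * x).
Proof. by move=> x y /(mulfI (pX_neq0 k)). Qed.

Definition pdvd k x := `[< exists y, x = p%:R ^+ k * y >].

Lemma pdvdP k x : reflect (exists y, x = p%:R ^+ k * y) (pdvd k x).
Proof. exact: asboolP. Qed.

Lemma pdvdS_residue k x : pdvd k.+1 x = (x k == 0).
Proof. by apply/pdvdP/eqP => /residue_eq0P. Qed.

Lemma pdvd0 x : pdvd 0 x.
Proof. by apply/pdvdP; exists x; rewrite mul1r. Qed.

Lemma pdvd_0 k : pdvd k 0.
Proof. by apply/pdvdP; exists 0; rewrite mulr0. Qed.

Lemma pdvdD k x y : pdvd k x -> pdvd k y -> pdvd k (x + y).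
Proof. by move=> /pdvdP[a ->] /pdvdP[b ->]; apply/pdvdP; exists (a + b); rewrite mulrDr. Qed.

Lemma pdvdN k x : pdvd k (- x) = pdvd k x.
Proof.
suff H y : pdvd k y -> pdvd k (- y) by apply/idP/idP => /H; rewrite ?opprK.
by move=> /pdvdP[a ->]; apply/pdvdP; exists (- a); rewrite mulrN.
Qed.

Lemma pdvdB k x y : pdvd k x -> pdvd k y -> pdvd k (x - y).
Proof. by move=> kx ky; rewrite pdvdD ?pdvdN. Qed.

Lemma pdvdMl k x y : pdvd k x -> pdvd k (y * x).
Proof. by move=> /pdvdP[a ->]; apply/pdvdP; exists (y * a); rewrite mulrCA. Qed.

Lemma pdvdMr k x y : pdvd k x -> pdvd k (x * y).
Proof. by rewrite mulrC; apply: pdvdMl. Qed.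

Lemma pdvd_sum k (I : finType) (P : pred I) (f : I -> Zp) :
  (forall i, P i -> pdvd k (f i)) -> pdvd k (\sum_(i | P i) f i).
Proof. by move=> h; elim/big_ind: _ => //; [exact: pdvd_0|exact: pdvdD]. Qed.

Lemma pdvd_pX k j : (k <= j)%N -> pdvd k (p%:R ^+ j).
Proof. by move=> kj; apply/pdvdP; exists (p%:R ^+ (j - k)); rewrite -exprD subnKC. Qed.

Lemma pdvd_le j k x : (j <= k)%N -> pdvd k x -> pdvd j x.
Proof. by move=> jk /pdvdP[a ->]; rewrite pdvdMr ?pdvd_pX. Qed.

Lemma pdvdM2l j k x : pdvd (j + k) (p%:R ^+ j * x) = pdvd k x.
Proof.
apply/pdvdP/pdvdP => -[y yE]; exists y; last by rewrite yE mulrA exprD.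
by apply: (@mulpXI j); rewrite yE exprD mulrA.
Qed.

Lemma pdvd_residue_eq k x y : pdvd k.+1 (x - y) = (x k == y k).
Proof. by apply/pdvdP/eqP => /residue_eqP. Qed.

(** [x 0] is already the residue, but in ['Z_(p ^ 1)]; its copy in ['F_p] has the field structure
    used for ranks and kernels. *)
Definition red x : 'F_p := (x 0%N : nat)%:R.

Lemma red_nat_mod (m : nat) : (m %% p ^ 1)%:R = m%:R :> 'F_p.
Proof.
by apply: val_inj; rewrite /= !val_Fp_nat// expn1 modn_mod.
Qed.

Lemma red_is_zmod : zmod_morphism red.
Proof.
move=> x y; rewrite /red residue_sub; apply: (addIr (y 0%N : nat)%:R); rewrite subrK.
rewrite -natrD -[LHS]red_nat_mod; have -> : ((x 0%N - y 0%N)%R + y 0%N = ((x 0%N - y 0%N)%R + y 0%N)%R %[mod p ^ 1])%N.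
  by rewrite /= [X in (_ %% X %% _)%N]Zp_cast ?expp_gt1// modn_mod.
by rewrite subrK red_nat_mod.
Qed.

Lemma red_is_monoid : monoid_morphism red.
Proof.
split; first by rewrite /red /= modn_small// Zp_cast// expn1 prime_gt1.
move=> x y; rewrite /red residueM -natrM -[RHS]red_nat_mod; congr _%:R.
by rewrite /= [X in (_ %% X)%N]Zp_cast ?expp_gt1.
Qed.
HB.instance Definition _ := GRing.isZmodMorphism.Build Zp 'F_p red red_is_zmod.
HB.instance Definition _ := GRing.isMonoidMorphism.Build Zp 'F_p red red_is_monoid.

Lemma red_eq0 x : (red x == 0) = pdvd 1 x.
Proof.
rewrite pdvdS_residue /red -val_eqE /= val_Fp_nat// modn_small//.
by have := residue_lt x 0; rewrite [X in (_ < X)%N]expn1.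
Qed.

Lemma red_nat_of (a : 'F_p) : red ((a : nat)%:R) = a.
Proof. by rewrite rmorph_nat natr_Zp. Qed.

Lemma padic_unitE x : (x \is a GRing.unit) = (red x != 0).
Proof.
apply/idP/idP => [ux|x0].
  by have := rmorph_unit red ux; rewrite unitfE.
have cop k : coprime (p ^ k.+1) (x k).
  rewrite coprime_pexpl// prime_coprime//; apply: contraNN x0 => dv.
  rewrite red_eq0 pdvdS_residue -val_eqE /= -(residue_mod x (leq0n k)).
  by rewrite expn1; move: dv; rewrite /dvdn.
have uk k : x k \is a GRing.unit.
  by rewrite -[x k]natr_Zp unitZpE ?expp_gt1.
(* The inverses of the residues are compatible because inverses are unique. *)
pose f k : 'Z_(p ^ k.+1) := (x k)^-1.
have fP k : (f k.+1 : nat)%:R = f k.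
  apply: (mulrI (uk k)); rewrite -{1}(residue_coherent x k).
  apply: (etrans (esym (natr_ZpM p_pr _ _))).
  by rewrite (mulrV (uk k.+1)) (mulrV (uk k)); apply: natr_Zp1.
apply/unitrP; exists (PadicInt p_pr fP); split; apply: padic_int_eqP => k.
  by rewrite residueM; exact: (mulVr (uk k)).
by rewrite residueM; exact: (mulrV (uk k)).
Qed.

Lemma padic_valuation x : x != 0 -> exists k u, u \is a GRing.unit /\ x = p%:R ^+ k * u.
Proof.
move=> x0; have exk : exists k, ~~ pdvd k.+1 x.
  apply: contrapT => h; move/eqP: x0; apply; apply: padic_int_eqP => k.
  apply/eqP; rewrite -pdvdS_residue; apply/negPn/negP => hk; apply: h; by exists k.
case: (ex_minnP exk) => k nk kmin.
have /pdvdP[u uE] : pdvd k x.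
  case: k nk kmin => [|k] nk kmin; first exact: pdvd0.
  by apply/negPn/negP => /kmin; rewrite ltnn.
exists k, u; split=> //; rewrite padic_unitE red_eq0.
by apply: contra nk => u1; rewrite uE -addn1 pdvdM2l.
Qed.

Lemma pdvd_all_eq0 x : (forall k, pdvd k x) -> x = 0.
Proof.
by move=> h; apply: padic_int_eqP => k; apply/eqP; rewrite -pdvdS_residue.
Qed.

Lemma unitmx_red m (A : 'M[Zp]_m) : (A \in unitmx) = (map_mx red A \in unitmx).
Proof. by rewrite !unitmxE det_map_mx padic_unitE unitfE. Qed.

Lemma natr_padic_inj : injective (fun k : nat => k%:R : Zp).
Proof.
move=> i j ij; wlog le : i j ij / (i <= j)%N.
  by move=> h; have [/h->//|/ltnW/h->] := leqP i j.
apply/eqP; rewrite eqn_leq le /= -subn_eq0 -leqn0 leqNgt; apply/negP => gt0.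
(* The exponent [j - i] is chosen because [n < p ^ n] rules out the divisibility. *)
have e0 : ((j - i)%:R : Zp) = p%:R ^+ (j - i) * 0 by rewrite natrB// ij subrr mulr0.
have := dvdn_leq gt0 (padic_dvd_nat e0).
by rewrite leqNgt ltn_expl// prime_gt1.
Qed.

End PadicArithmetic.

(** * Smith normal form over the p-adic integers *)

Section Smith.
Variables (p : nat) (p_pr : prime p).
Local Notation Zp := (padic_int p_pr).

Lemma matrix_content m (A : 'M[Zp]_m) : A != 0 ->
  exists (k : nat) (B : 'M[Zp]_m), A = p%:R ^+ k *: B /\
    exists i j, B i j \is a GRing.unit.
Proof.
move=> A0; have exk : exists k, ~~ [forall i, forall j, pdvd k.+1 (A i j)].
  apply: contrapT => h; move/eqP: A0; apply; apply/matrixP => i j; rewrite mxE.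
  apply: pdvd_all_eq0 => -[|k]; first exact: pdvd0.
  apply/negPn/negP => hk; apply: h; exists k; apply/forallPn; exists i.
  by apply/forallPn; exists j.
case: (ex_minnP exk) => k nk kmin.
have dvA i j : pdvd k (A i j).
  case: k nk kmin => [|k] nk kmin; first exact: pdvd0.
  have /negPn/forallP/(_ i)/forallP/(_ j)// : ~~ ~~ [forall i, forall j, pdvd k.+1 (A i j)].
  by apply/negP => /kmin; rewrite ltnn.
have /choice[b bP] (ij : 'I_m * 'I_m) : exists y, A ij.1 ij.2 = p%:R ^+ k * y.
  exact/pdvdP.
exists k, (\matrix_(i, j) b (i, j)); split.
  by apply/matrixP => i j; rewrite !mxE (bP (i, j)).
have /forallPn[i /forallPn[j nij]] := nk; exists i, j.
rewrite mxE padic_unitE red_eq0; apply: contra nij => h.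
by rewrite (bP (i, j)) -addn1 pdvdM2l.
Qed.

(** After division by its content a nonzero matrix has a unit entry. Moved to the corner, this pivot
    divides everything, and induction treats the Schur complement. Divisibility of [d j] by [d i] is
    expressed through all powers of [p], which covers zero invariant factors. *)
Lemma smith_form m (A : 'M[Zp]_m) :
  exists (U V : 'M[Zp]_m) (d : 'I_m -> Zp),
    [/\ U \in unitmx, V \in unitmx, A = U *m (\matrix_(i, j) ((i == j)%:R * d i)) *m V
      & forall (i j : 'I_m) k, (i <= j)%N -> pdvd k (d i) -> pdvd k (d j)].
Proof.
elim: m A => [|m IH] A.
  exists 1%:M, 1%:M, (fun=> 0); split; rewrite ?unitmx1//; first by apply/matrixP => -[].
have [->|A0] := eqVneq A 0.
  exists 1%:M, 1%:M, (fun=> 0); split; rewrite ?unitmx1//.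
  by apply/matrixP => i j; rewrite mulmx1 mul1mx !mxE mulr0.
have [k [B [-> [i0 [j0 uB]]]]] := matrix_content A0.
suff [U [V [d [uU uV BE dP]]]] : exists (U V : 'M[Zp]_(1 + m)) (d : 'I_(1 + m) -> Zp),
    [/\ U \in unitmx, V \in unitmx, B = U *m (\matrix_(i, j) ((i == j)%:R * d i)) *m V
      & forall (i j : 'I_(1 + m)) k, (i <= j)%N -> pdvd k (d i) -> pdvd k (d j)].
  exists U, V, (fun i => p%:R ^+ k * d i); split=> //.
    rewrite BE scalemxAl scalemxAr; congr (_ *m _ *m _).
    by apply/matrixP => i j; rewrite !mxE mulrCA.
  move=> i j l ij; have [kl|lk] := leqP k l.
    by rewrite -(subnKC kl) !pdvdM2l; apply: dP.
  by move=> _; rewrite pdvdMr// pdvd_pX// ltnW.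
pose C : 'M[Zp]_(1 + m) := xrow i0 0 (xcol j0 0 B).
have CE : C 0 0 = B i0 j0.
  by rewrite !mxE !tpermR.
pose u := C 0 0; have uu : u \is a GRing.unit by rewrite /u CE.
pose c := ursubmx C; pose r := dlsubmx C.
have [U [V [d [uU uV DE dP]]]] := IH (drsubmx C - u^-1 *: (r *m c)).
pose d' (i : 'I_(1 + m)) := if fintype.split i is inr j then d j else u.
pose L : 'M[Zp]_(1 + m) := block_mx 1%:M 0 (u^-1 *: r) U.
pose R : 'M[Zp]_(1 + m) := block_mx 1%:M (u^-1 *: c) 0 V.
have CLR : C = L *m (block_mx u%:M 0 0 (\matrix_(i, j) ((i == j)%:R * d i))) *m R.
  rewrite !mulmx_block !mulmx0 !mul0mx !mulmx1 !mul1mx !addr0 !add0r.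
  rewrite mul_scalar_mx scalerA mulrV// scale1r mul_mx_scalar scalerA mulrV// scale1r.
  rewrite mul0mx addr0 -DE -scalemxAr [X in block_mx _ _ _ X]addrC subrK.
  rewrite -[LHS]submxK; congr block_mx.
  apply/matrixP => i j; rewrite !ord1 !mxE eqxx mulr1n /u.
  have -> : lshift m 0 = 0 :> 'I_(1 + m) by apply: val_inj.
  by rewrite CE !tpermR.
have uL : L \in unitmx by rewrite unitmxE det_lblock det1 mul1r -unitmxE.
have uR : R \in unitmx by rewrite unitmxE det_ublock det1 mul1r -unitmxE.
exists (tperm_mx i0 0 *m L), (R *m tperm_mx j0 0), d'; split.
- by rewrite unitmx_mul unitmx_perm.
- by rewrite unitmx_mul unitmx_perm andbT.
- have -> : \matrix_(i, j) ((i == j)%:R * d' i) =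
      (block_mx u%:M 0 0 (\matrix_(i, j) ((i == j)%:R * d i)) : 'M[Zp]_(1 + m)).
    apply/matrixP => i j; rewrite !mxE /d'; case: (splitP i) => i' iE; rewrite !mxE.
      case: (splitP j) => j' jE; rewrite !mxE -!val_eqE /= iE jE !ord1 /=.
        by rewrite mul1r.
      by rewrite mul0r.
    case: (splitP j) => j' jE; rewrite !mxE -!val_eqE /= iE jE ?ord1 ?mul0r//.
  have -> : B = tperm_mx i0 0 *m C *m tperm_mx j0 0.
    rewrite /C xrowE xcolE !mulmxA -mulmxA -!perm_mxM !tperm2.
    by rewrite !perm_mx1 mul1mx mulmx1.
  by rewrite CLR !mulmxA.
- move=> i j l; rewrite /d'; case: (splitP i) => i' iE.
    move=> _ lu; have -> : l = 0%N; last by move=> *; exact: pdvd0.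
    case: l lu => // l /(pdvd_le (ltn0Sn l)) lu.
    by move: uu; rewrite padic_unitE red_eq0 lu.
  case: (splitP j) => j' jE; first by rewrite iE jE ord1.
  by rewrite iE jE leq_add2l; apply: dP.
Qed.

End Smith.

(** * The p-primary part of [Q/Z] *)

Section Torsion.
Variables (p : nat) (p_pr : prime p).
Local Notation Zp := (padic_int p_pr).
Implicit Types a b : Zp.

(* [a k] is the residue of [a] modulo [p ^ k.+1], so it determines [a / p^k] modulo [Z_p]. *)
Definition ptors k a : QmodZ := QmodZ_pi ((a k : nat)%:R / p%:R ^+ k).

Lemma QmodZ_piD : {morph QmodZ_pi : x y / x + y}.
Proof. by move=> x y; rewrite /QmodZ_pi pi_addr. Qed.

Lemma QmodZ_piP (t : QmodZ) : exists x, t = QmodZ_pi x.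
Proof.
exists (generic_quotient.repr (t : {ideal_quot int_pred})).
by rewrite /QmodZ_pi generic_quotient.reprK.
Qed.

Lemma QmodZ_pi0 : QmodZ_pi 0 = 0.
Proof. by rewrite /QmodZ_pi pi_zeror. Qed.

Lemma QmodZ_piMn x m : QmodZ_pi (x *+ m) = QmodZ_pi x *+ m.
Proof.
elim: m => [|m IH]; first by rewrite !mulr0n QmodZ_pi0.
by rewrite !mulrS QmodZ_piD IH.
Qed.

Lemma pX_rat_neq0 k : p%:R ^+ k != 0 :> rat.
Proof. by rewrite expf_neq0// pnatr_eq0 -lt0n prime_gt0. Qed.

Lemma ptors_nat k (m : nat) a : pdvd k (a - m%:R) -> ptors k a = QmodZ_pi (m%:R / p%:R ^+ k).
Proof.
move=> am; apply/QmodZ_pi_eq; rewrite -mulrBl.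
have [y aE] := residue_expand a k.
have /pdvdP[z zE] : pdvd k ((a k : nat)%:Z%:~R - m%:Z%:~R : Zp).
  have -> : (a k : nat)%:Z%:~R - m%:Z%:~R = (a - m%:R) - p%:R ^+ k.+1 * y :> Zp.
    by rewrite {2}aE; ring.
  by rewrite pdvdB// pdvdMr// pdvd_pX.
have [|b bE] := @padic_dvd_int p p_pr ((a k : nat)%:Z - m%:Z) k z.
  by rewrite rmorphB /= zE.
apply/intrP; exists b; apply: (canLR (mulfK (pX_rat_neq0 k))).
have := congr1 (intr : int -> rat) bE.
by rewrite rmorphB rmorphM rmorphXn /= rmorph_nat.
Qed.

Lemma ptors_natE k (m : nat) : ptors k m%:R = QmodZ_pi (m%:R / p%:R ^+ k).
Proof. by apply: ptors_nat; rewrite subrr pdvd_0. Qed.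

Lemma ptorsD k : {morph ptors k : a b / a + b}.
Proof.
move=> a b; have [y aE] := residue_expand a k; have [z bE] := residue_expand b k.
rewrite (@ptors_nat k (a k + b k)) ?natrD ?mulrDl ?QmodZ_piD//.
have -> : a + b - ((a k : nat)%:R + (b k : nat)%:R) = p%:R ^+ k.+1 * (y + z) :> Zp.
  have := congr1 (fun t => t - (a k : nat)%:R) aE; have := congr1 (fun t => t - (b k : nat)%:R) bE.
  by rewrite /= ![_%:R + _ - _]addrAC !subrr !add0r mulrDr => <- <-; ring.
by rewrite pdvdMr// pdvd_pX.
Qed.

Lemma ptors0 k : ptors k 0 = 0.
Proof. by rewrite -[0 in LHS]/(0%:R : Zp) ptors_natE mul0r QmodZ_pi0. Qed.

Lemma ptorsN k a : ptors k (- a) = - ptors k a.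
Proof. by apply/eqP; rewrite -addr_eq0 -ptorsD addNr ptors0. Qed.

Lemma ptorsMn k a m : ptors k (a *+ m) = ptors k a *+ m.
Proof. by elim: m => [|m IH]; rewrite ?mulr0n ?ptors0// !mulrS ptorsD IH. Qed.

Lemma ptors_eq0 k a : (ptors k a = 0) <-> pdvd k a.
Proof.
split=> [a0|ka]; last by rewrite (@ptors_nat k 0) ?subr0// mul0r QmodZ_pi0.
have /QmodZ_pi_eq : QmodZ_pi ((a k : nat)%:R / p%:R ^+ k) = QmodZ_pi 0.
  by rewrite QmodZ_pi0.
rewrite subr0 => /intrP[b bE].
have kE : (a k : nat)%:Z = b * p%:R ^+ k.
  apply: (@intr_inj rat); rewrite rmorphM rmorphXn /= rmorph_nat -bE divfK//.
  exact: pX_rat_neq0.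
have [y ->] := residue_expand a k; rewrite pdvdD ?pdvdMr ?pdvd_pX//.
apply/pdvdP; exists b%:~R.
have := congr1 (intr : int -> Zp) kE; rewrite rmorphM rmorphXn /= rmorph_nat mulrC => <-.
by rewrite pmulrn.
Qed.

Lemma ptors_eq k a b : (ptors k a = ptors k b) <-> pdvd k (a - b).
Proof.
rewrite -ptors_eq0 ptorsD ptorsN; split=> [->|/eqP]; first by rewrite subrr.
by rewrite subr_eq0 => /eqP.
Qed.

Lemma ptors_sum k (I : finType) (f : I -> Zp) :
  ptors k (\sum_i f i) = \sum_i ptors k (f i).
Proof. by rewrite (big_morph _ (@ptorsD k) (ptors0 k)). Qed.

Lemma ptors_scale j k a : ptors (j + k) (p%:R ^+ j * a) = ptors k a.
Proof.
have [y aE] := residue_expand a k.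
rewrite (@ptors_nat (j + k) (p ^ j * a k)%N).
  apply/QmodZ_pi_eq; rewrite natrM natrX exprD -mulf_div mulfV ?pX_rat_neq0// mul1r.
  by rewrite subrr rpred0.
rewrite natrM natrX -mulrBr pdvdM2l {1}aE addrC addKr pdvdMr ?pdvd_pX//.
Qed.

(** Both sides are the class of one fraction, [a / p^k = b / p^j]. *)
Lemma ptors_change j k a b : p%:R ^+ j * a = p%:R ^+ k * b -> ptors k a = ptors j b.
Proof. by move=> ab; rewrite -(ptors_scale j) ab addnC ptors_scale. Qed.

Lemma ptors_surj k (t : QmodZ) : t *+ (p ^ k) = 0 -> exists m : nat, t = ptors k m%:R.
Proof.
have [x ->] := QmodZ_piP t; rewrite -QmodZ_piMn -QmodZ_pi0 => /QmodZ_pi_eq.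
rewrite subr0 => /intrP[b bE].
have xE : x = b%:~R / p%:R ^+ k.
  by rewrite -bE -[x *+ _]mulr_natr natrX mulfK ?pX_rat_neq0.
exists `|(b %% (p ^ k)%N%:Z)%Z|%N; rewrite ptors_natE; apply/QmodZ_pi_eq.
have pk0 : (p ^ k)%N%:Z != 0 by rewrite -lt0n expn_gt0 prime_gt0.
rewrite xE -mulrBl {1}(divz_eq b (p ^ k)%N%:Z).
have -> : `|(b %% (p ^ k)%N%:Z)%Z|%N%:R = ((b %% (p ^ k)%N%:Z)%Z)%:~R :> rat.
  by rewrite -[X in _ = X%:~R]gez0_abs ?modz_ge0.
rewrite rmorphD rmorphM /= addrK -[(p ^ k)%N%:~R]/((p ^ k)%N%:R) natrX mulfK ?pX_rat_neq0//.
Qed.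

Lemma QpmodZp_to_QmodZ_frac k a :
  QpmodZp_to_QmodZ (QpmodZp_pi ((Zp_to_Qp (p%:R ^+ k))^-1 * Zp_to_Qp a)) = ptors k a.
Proof.
have [y aE] := residue_expand a k.
have -> : QpmodZp_pi ((Zp_to_Qp (p%:R ^+ k : Zp))^-1 * Zp_to_Qp a) =
    QpmodZp_pi ((a k : nat)%:Z%:~R / p%:R ^+ k).
  apply/QpmodZp_pi_eq; exists (p%:R * y).
  have e : Zp_to_Qp a = (a k : nat)%:Z%:~R + p%:R ^+ k * Zp_to_Qp (p%:R * y).
    by rewrite {1}aE rmorphD rmorph_nat exprSr -mulrA rmorphM rmorphXn rmorph_nat.
  rewrite e rmorphXn rmorph_nat mulrDr mulKf ?Zp_to_Qp_pX_neq0//.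
  by rewrite [_^-1 * _]mulrC addrC addKr.
by rewrite QpmodZp_to_QmodZE.
Qed.

End Torsion.

(** * Finite cokernels and generating tuples *)

Section CokerMap.
Variables (p : nat) (p_pr : prime p).
Local Notation Zp := (padic_int p_pr).

Lemma scalepXI k m n : injective (fun A : 'M[Zp]_(m, n) => p%:R ^+ k *: A).
Proof.
move=> A B /matrixP AB; apply/matrixP => i j; apply: (@mulpXI _ p_pr k).
by have := AB i j; rewrite !mxE.
Qed.

(** Denominators may be taken to be powers of [p], because a nonzero element of [Z_p] is a unit
    times such a power. This keeps the arguments inside [Z_p]. *)
Definition in_lattice n (A : 'M[Zp]_n) (x : 'cV[Zp]_n) : Prop :=
  exists (k : nat) (z : 'cV[Zp]_n), p%:R ^+ k *: x = A *m z.

Lemma lattice_predE n (A : 'M[Zp]_n) x : x \in lattice_pred A <-> in_lattice A x.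
Proof.
have toQp_inj : injective (map_mx (@Zp_to_Qp p p_pr) : 'cV[Zp]_n -> _).
  by move=> u v /matrixP uv; apply/matrixP => i j; apply: Zp_to_Qp_inj;
    have := uv i j; rewrite !mxE.
split=> [xA|[k [z xz]]].
  have [m [z [m0 /= xE]]] := lattice_witness (Lattice xA).
  have Qm0 : Zp_to_Qp m != 0.
    by rewrite -(rmorph0 (@Zp_to_Qp p p_pr)) (inj_eq (@Zp_to_Qp_inj _ _)).
  have mE : m *: x = A *m z.
    by apply: toQp_inj; rewrite map_mxZ xE scalerA mulfV// scale1r.
  have [k [u [uu uE]]] := padic_valuation m0.
  exists k, (u^-1 *: z); rewrite -scalemxAr -mE uE scalerA [_ * u]mulrC mulrA mulVr//.
  by rewrite mul1r.
have Qp0 : Zp_to_Qp (p%:R ^+ k : Zp) != 0.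
  by rewrite -(rmorph0 (@Zp_to_Qp p p_pr)) (inj_eq (@Zp_to_Qp_inj _ _)) pX_neq0.
apply/asboolP; exists ((Zp_to_Qp (p%:R ^+ k))^-1 *: map_mx (@Zp_to_Qp p p_pr) z).
by rewrite -scalemxAr -map_mxM -xz map_mxZ scalerA mulVf// scale1r.
Qed.

(** An isometry from the finite cokernel onto [G], encoded as a map on vectors whose kernel on the
    lattice is the image of [A]; its values off the lattice are unconstrained. It replaces the
    quotient type in later arguments. *)
Definition coker_map n (A : 'M[Zp]_n) (G : zmodType) (delta : G -> G -> QmodZ)
    (phi : 'cV[Zp]_n -> G) : Prop :=
  [/\ forall x y, in_lattice A x -> in_lattice A y -> phi (x + y) = phi x + phi y,
      forall u, exists2 x, in_lattice A x & phi x = u,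
      forall x, in_lattice A x -> (phi x = 0 <-> exists z, x = A *m z)
    & forall k x y z, p%:R ^+ k *: x = A *m z -> in_lattice A y ->
        delta (phi x) (phi y) = ptors k ((z^T *m y) 0 0)].

Lemma fin_coker_piP n (A : 'M[Zp]_n) (u : fin_coker A) : exists l, u = fin_coker_pi l.
Proof. by exists (fin_coker_repr u); rewrite /fin_coker_pi /fin_coker_repr generic_quotient.reprK. Qed.

Lemma fin_coker_piD n (A : 'M[Zp]_n) (x y : lattice A) :
  fin_coker_pi (x + y) = fin_coker_pi x + fin_coker_pi y.
Proof. by rewrite /fin_coker_pi pi_addr. Qed.

Lemma fin_coker_pi_eq n (A : 'M[Zp]_n) (x y : lattice A) :
  fin_coker_pi x = fin_coker_pi y <-> exists z, lattice_val x - lattice_val y = A *m z.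
Proof.
split=> [/eqP|h]; last apply/eqP; rewrite /fin_coker_pi generic_quotient.eqmodE /= /Quotient.equiv.
  by move/asboolP.
exact/asboolP.
Qed.

Lemma fin_coker_isomP n (A : 'M[Zp]_n) (G : zmodType) (delta : G -> G -> QmodZ) :
  A^T = A -> fin_coker_isom A delta <-> exists phi, coker_map A delta phi.
Proof.
move=> sA; have latE x : in_lattice A x -> exists l : lattice A, lattice_val l = x.
  by move=> /lattice_predE xA; exists (Lattice xA).
have pairE k (x y : lattice A) z : p%:R ^+ k *: lattice_val x = A *m z ->
    QpmodZp_to_QmodZ (fin_coker_pairing (fin_coker_pi x) (fin_coker_pi y)) =
    ptors k ((z^T *m lattice_val y) 0 0).
  move=> xz; rewrite fin_coker_pairingE// (@lattice_pairingE _ _ _ A (p%:R ^+ k) z)//.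
  - exact: QpmodZp_to_QmodZ_frac.
  - exact: pX_neq0.
  rewrite -xz map_mxZ scalerA mulVf ?scale1r//.
  by rewrite -(rmorph0 (@Zp_to_Qp p p_pr)) (inj_eq (@Zp_to_Qp_inj _ _)) pX_neq0.
split=> [[f [bf fD fP]]|[phi [phiD phi_surj phi_ker phi_pair]]].
  have f0 : f 0 = 0 by apply: (addrI (f 0)); rewrite -fD !addr0.
  exists (fun x => if insub x is Some l then f (fin_coker_pi l) else 0).
  have valE (l : lattice A) :
    (if insub (lattice_val l) is Some l then f (fin_coker_pi l) else 0) = f (fin_coker_pi l).
    by rewrite (valK l : insub (lattice_val l) = Some l).
  split.
  - move=> x y /latE[lx <-] /latE[ly <-]; rewrite !valE -fD -fin_coker_piD -valE.
    by congr (if insub _ is Some l then _ else _).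
  - have [g fg gf] := bf; move=> u; have [l lE] := fin_coker_piP (g u).
    exists (lattice_val l); last by rewrite valE -lE gf.
    by apply/lattice_predE; case: l {lE}.
  - move=> x /latE[lx <-]; rewrite valE; split=> [fx0|[z xE]].
      have /fin_coker_pi_eq[z] : fin_coker_pi lx = fin_coker_pi 0.
        apply: (bij_inj bf); rewrite fx0 -[LHS]f0; congr f.
        by apply/esym; rewrite /fin_coker_pi pi_zeror.
      by rewrite subr0; exists z.
    rewrite -f0; congr f; rewrite -[RHS](_ : fin_coker_pi (0 : lattice A) = _).
      by apply/fin_coker_pi_eq; exists z; rewrite subr0.
    by rewrite /fin_coker_pi pi_zeror.
  - move=> k x y z xz /latE[ly <-].
    have /latE[lx lxE] : in_lattice A x by exists k, z.
    by rewrite -lxE in xz *; rewrite !valE fP (pairE k _ _ z).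
have lat_val (l : lattice A) : in_lattice A (lattice_val l).
  by apply/lattice_predE; case: l.
pose f (u : fin_coker A) := phi (lattice_val (fin_coker_repr u)).
have phi_eq (x y : lattice A) : phi (lattice_val x) = phi (lattice_val y) <->
    fin_coker_pi x = fin_coker_pi y.
  rewrite fin_coker_pi_eq -(phi_ker (lattice_val x - lattice_val y)) => [|]; last first.
    exact: (lat_val (x - y)).
  have -> : phi (lattice_val x) = phi (lattice_val x - lattice_val y) + phi (lattice_val y).
    by rewrite -phiD ?subrK//; exact: (lat_val (x - y)).
  split=> [/eqP|->]; last by rewrite add0r.
  by rewrite addrC -subr_eq0 addrAC subrr add0r => /eqP.
have fE l : f (fin_coker_pi l) = phi (lattice_val l).
  apply/phi_eq; rewrite /fin_coker_pi /fin_coker_repr generic_quotient.reprK //.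
exists f; split.
- have /choice[s sP] u : exists l : lattice A, phi (lattice_val l) = u.
    by have [x /latE[l <-] <-] := phi_surj u; exists l.
  exists (fun u => fin_coker_pi (s u)) => u; last by rewrite fE sP.
  by have [l ->] := fin_coker_piP u; rewrite fE; apply/phi_eq; rewrite sP.
- move=> u v; have [x ->] := fin_coker_piP u; have [y ->] := fin_coker_piP v.
  by rewrite -fin_coker_piD !fE -phiD.
- move=> u v; have [x ->] := fin_coker_piP u; have [y ->] := fin_coker_piP v.
  have [k [z xz]] := lat_val x.
  by rewrite !fE (pairE _ _ _ _ xz) (phi_pair _ _ _ _ xz).
Qed.

(** [C^T] and [C'^T] restrict to inverse bijections between the two lattices. If [p^k y = M z], then
    [p^k (C^T y) = A (C' z)], and [C C' = 1] makes the two pairings agree. *)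
Lemma coker_map_congr m n (M : 'M[Zp]_m) (C : 'M[Zp]_(m, n)) (C' : 'M[Zp]_(n, m))
    (G : zmodType) (delta : G -> G -> QmodZ) : C *m C' = 1%:M ->
  (exists phi, coker_map (C^T *m M *m C) delta phi) <->
  (exists phi, coker_map M delta phi).
Proof.
move=> CC'; have CC't : C'^T *m C^T = 1%:M by rewrite -trmx_mul CC' trmx1.
set A := C^T *m M *m C.
have A2M k x z : p%:R ^+ k *: x = A *m z -> p%:R ^+ k *: (C'^T *m x) = M *m (C *m z).
  by move=> xz; rewrite scalemxAr xz /A !mulmxA CC't mul1mx.
have M2A k y z : p%:R ^+ k *: y = M *m z -> p%:R ^+ k *: (C^T *m y) = A *m (C' *m z).
  by move=> yz; rewrite scalemxAr yz /A !mulmxA -[_ *m C *m C']mulmxA CC' mulmx1.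
have latA x : in_lattice A x -> in_lattice M (C'^T *m x).
  by move=> [k [z /A2M xz]]; exists k, (C *m z).
have latM y : in_lattice M y -> in_lattice A (C^T *m y).
  by move=> [k [z /M2A yz]]; exists k, (C' *m z).
(* [p^k x] lies in the image of [C^T], on which [C^T C'^T] is the identity; then [p^k] is
   cancelled. *)
have latK x : in_lattice A x -> C^T *m (C'^T *m x) = x.
  move=> [k [z xz]]; apply: (@scalepXI k); rewrite !scalemxAr xz /A !mulmxA.
  by rewrite -[C^T *m C'^T *m C^T]mulmxA CC't mulmx1.
split=> -[phi [phiD phi_surj phi_ker phi_pair]].
  exists (fun y => phi (C^T *m y)); split.
  - by move=> x y /latM lx /latM ly; rewrite mulmxDr phiD.
  - move=> u; have [x lx <-] := phi_surj u; exists (C'^T *m x); first exact: latA.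
    by rewrite latK.
  - move=> y ly; rewrite phi_ker; last exact: latM.
    split=> -[z zE]; last by exists (C' *m z); rewrite zE /A !mulmxA -[_ *m C *m C']mulmxA CC' mulmx1.
    by exists (C *m z); rewrite -[LHS]mul1mx -CC't -mulmxA zE /A !mulmxA CC't mul1mx.
  - move=> k x y z /M2A xz /latM ly; rewrite (phi_pair _ _ _ _ xz)//.
    by rewrite trmx_mul !mulmxA -[z^T *m _ *m _]mulmxA CC't mulmx1.
exists (fun x => phi (C'^T *m x)); split.
- by move=> x y /latA lx /latA ly; rewrite mulmxDr phiD.
- move=> u; have [x lx <-] := phi_surj u; exists (C^T *m x); first exact: latM.
  by rewrite mulmxA CC't mul1mx.
- move=> x lx; rewrite phi_ker; last exact: latA.
  split=> -[z zE]; last by exists (C *m z); rewrite zE /A !mulmxA CC't mul1mx.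
  exists (C' *m z); rewrite -[LHS]latK// zE /A !mulmxA -[_ *m C *m C']mulmxA CC' mulmx1//.
- move=> k x y z xz ly; rewrite (phi_pair _ _ _ _ (A2M _ _ _ _ xz)); last exact: latA.
  by rewrite trmx_mul -!mulmxA latK.
Qed.

End CokerMap.

Lemma mulrn_card (G : finZmodType) (x : G) : x *+ #|G| = 0.
Proof. by rewrite -FinRing.zmodXgE -cardsT expg_cardG ?inE. Qed.

Section Generators.
Variables (p : nat) (p_pr : prime p) (G : finZmodType) (delta : G -> G -> QmodZ).
Variable e : nat.
Hypothesis expG : forall x : G, x *+ (p ^ e) = 0.
Hypothesis deltaC : forall x y, delta x y = delta y x.
Hypothesis deltaD : forall x, {morph delta x : y z / y + z}.
Hypothesis delta_inj : forall x, (forall y, delta x y = 0) -> x = 0.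
Local Notation Zp := (padic_int p_pr).

(** [a e] is the residue modulo [p ^ e.+1], which determines the action because [p ^ e] kills
    [G]. *)
Definition zact (a : Zp) (x : G) : G := x *+ (a e).

Lemma pdvd_nat_mod k (i j : nat) : pdvd k (i%:R - j%:R : Zp) -> (i = j %[mod p ^ k])%N.
Proof.
case: k => [|k]; first by rewrite expn0 !modn1.
rewrite pdvd_residue_eq !residue_nat => /eqP/(congr1 val) /=.
by rewrite !val_Zp_nat ?expp_gt1.
Qed.

Lemma zact_nat (a : Zp) (k : nat) x : pdvd e (a - k%:R) -> zact a x = x *+ k.
Proof.
move=> ak; have mulr_mod i : x *+ i = x *+ (i %% p ^ e).
  by rewrite {1}(divn_eq i (p ^ e)) mulrnDr mulnC mulrnA expG mul0rn add0r.
rewrite /zact mulr_mod [RHS]mulr_mod; congr (_ *+ _); apply: pdvd_nat_mod.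
have [y aE] := residue_expand a e.
have -> : (a e : nat)%:R - k%:R = (a - k%:R) - p%:R ^+ e.+1 * y.
  by rewrite {2}aE; ring.
by rewrite pdvdB// pdvdMr// pdvd_pX.
Qed.

Lemma residue_nat_pdvd (a : Zp) : pdvd e (a - (a e : nat)%:R).
Proof.
have [y aE] := residue_expand a e; rewrite {1}aE addrC addKr.
by rewrite pdvdMr// pdvd_pX.
Qed.

Lemma zactDl a b x : zact (a + b) x = zact a x + zact b x.
Proof.
apply: (etrans _ (mulrnDr x (a e) (b e))); apply: zact_nat; rewrite natrD.
have -> : a + b - ((a e : nat)%:R + (b e : nat)%:R) =
  (a - (a e : nat)%:R) + (b - (b e : nat)%:R) by ring.
by rewrite pdvdD ?residue_nat_pdvd.
Qed.

Lemma zactDr a x y : zact a (x + y) = zact a x + zact a y.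
Proof. by rewrite /zact mulrnDl. Qed.

Lemma zact_0r a : zact a 0 = 0.
Proof. by rewrite /zact mul0rn. Qed.

Lemma zact_pdvd a x : pdvd e a -> zact a x = 0.
Proof. by move=> ea; rewrite (@zact_nat a 0) ?subr0. Qed.

Lemma zact1 x : zact 1 x = x.
Proof. by rewrite (@zact_nat _ 1) ?subrr ?pdvd_0. Qed.

Lemma zactM a b x : zact (a * b) x = zact a (zact b x).
Proof.
apply: (etrans _ (mulrnA x (b e) (a e))); apply: zact_nat; rewrite natrM.
have -> : a * b - (b e : nat)%:R * (a e : nat)%:R =
  (a - (a e : nat)%:R) * b + (b - (b e : nat)%:R) * (a e : nat)%:R by ring.
by rewrite pdvdD ?pdvdMr ?residue_nat_pdvd.
Qed.

Lemma delta0 x : delta x 0 = 0.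
Proof. by apply: (addrI (delta x 0)); rewrite -deltaD !addr0. Qed.

Lemma deltaMn x y k : delta x (y *+ k) = delta x y *+ k.
Proof. by elim: k => [|k IH]; rewrite ?mulr0n ?delta0// !mulrS deltaD IH. Qed.

Lemma delta_sum (I : finType) x (f : I -> G) : delta x (\sum_i f i) = \sum_i delta x (f i).
Proof. by rewrite (big_morph _ (deltaD x) (delta0 x)). Qed.

Lemma delta_zact x y a c : ptors e c = delta x y -> delta x (zact a y) = ptors e (a * c).
Proof.
move=> cE; rewrite deltaMn -cE -ptorsMn; apply/ptors_eq.
rewrite -mulr_natl -mulrBl -pdvdN -mulNr opprB.
by rewrite pdvdMr// residue_nat_pdvd.
Qed.

Section Tuple.
Variable m : nat.
Implicit Types (g : 'I_m -> G) (x y : 'cV[Zp]_m) (M Y d : 'M[Zp]_m).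

Definition gmap g x : G := \sum_i zact (x i 0) (g i).

Lemma gmapD g x y : gmap g (x + y) = gmap g x + gmap g y.
Proof. by rewrite /gmap -big_split; apply: eq_bigr => i _; rewrite mxE zactDl. Qed.

Lemma gmap0 g : gmap g 0 = 0.
Proof. by apply: (addrI (gmap g 0)); rewrite -gmapD !addr0. Qed.

Lemma gmapZ g a x : gmap g (a *: x) = zact a (gmap g x).
Proof.
rewrite /gmap (big_morph _ (zactDr a) (zact_0r a)).
by apply: eq_bigr => i _; rewrite mxE zactM.
Qed.

Lemma gmap_delta g i : gmap g (delta_mx i 0) = g i.
Proof.
rewrite /gmap (bigD1 i)//= mxE !eqxx zact1 big1 ?addr0// => j /negPf ji.
by rewrite mxE ji zact_pdvd ?pdvd_0.
Qed.

(** Additivity already implies linearity over [Z_p]: [a] differs from the natural number [a e] by a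
    multiple of [p^e], and [p^e] kills [G]. *)
Lemma additive_gmap (phi : 'cV[Zp]_m -> G) : {morph phi : x y / x + y} ->
  phi =1 gmap (fun i => phi (delta_mx i 0)).
Proof.
move=> phiD; have phi0 : phi 0 = 0 by apply: (addrI (phi 0)); rewrite -phiD !addr0.
have phiMn x k : phi (x *+ k) = phi x *+ k.
  by elim: k => [|k IH]; rewrite ?mulr0n// !mulrS phiD IH.
have phiZ a x : phi (a *: x) = zact a (phi x).
  have /pdvdP[b bE] := residue_nat_pdvd a.
  have -> : a *: x = x *+ (a e) + (b *: x) *+ (p ^ e).
    rewrite -[x *+ _]scaler_nat -[_ *+ (p ^ e)]scaler_nat scalerA -scalerDl natrX -bE.
    by rewrite addrC subrK.
  by rewrite phiD !phiMn expG addr0.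
move=> x; rewrite /gmap {1}[x]matrix_sum_delta (big_morph _ phiD phi0).
by apply: eq_bigr => i _; rewrite big_ord1 phiZ.
Qed.

Lemma delta_gmap g d x y : (forall i j, ptors e (d i j) = delta (g i) (g j)) ->
  delta (gmap g x) (gmap g y) = ptors e ((x^T *m d *m y) 0 0).
Proof.
move=> dE; rewrite {2}/gmap delta_sum !mxE ptors_sum; apply: eq_bigr => j _.
rewrite [_ * y j 0]mulrC; apply: delta_zact; rewrite deltaC /gmap delta_sum mxE ptors_sum.
by apply: eq_bigr => i _; rewrite mxE; apply/esym/delta_zact; rewrite deltaC.
Qed.

Definition generates g : Prop := forall u, exists x, gmap g x = u.

(** By bilinearity [(d x)_i / p^e] is the pairing of [g i] with [gmap g x]. Since [g] generates and
    [delta] is nondegenerate, all of these vanish only if [gmap g x = 0]. *)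
Lemma gmap_ker g d x : generates g -> (forall i j, ptors e (d i j) = delta (g i) (g j)) ->
  gmap g x = 0 <-> forall i, pdvd e ((d *m x) i 0).
Proof.
move=> gen dE; split=> [gx0 i|dx].
  apply/ptors_eq0; have := delta_gmap (delta_mx i 0) x dE; rewrite gx0 delta0 => ->.
  by rewrite -mulmxA trmx_delta -rowE [in RHS]mxE.
apply: delta_inj => u; have [y <-] := gen u; rewrite deltaC (delta_gmap _ _ dE).
apply/ptors_eq0; rewrite -mulmxA mxE; apply: pdvd_sum => i _.
by rewrite pdvdMl.
Qed.

(* [M^-1] lifts the Gram matrix of [g], stated through [Y = p^e M^-1]. *)
Definition presents M g : Prop := exists Y : 'M[Zp]_m,
  M *m Y = (p%:R ^+ e)%:M /\ forall i j, ptors e (Y i j) = delta (g i) (g j).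

(** Evaluating [Y^T M Y] in two ways gives [p^k Y^T = p^k Y]; transposing [M Y = p^k] then gives the
    product in the other order. *)
Lemma scaled_inv_sym M Y k : M^T = M -> M *m Y = (p%:R ^+ k)%:M ->
  Y^T = Y /\ Y *m M = (p%:R ^+ k)%:M.
Proof.
move=> sM MY; have YtM : Y^T *m M = (p%:R ^+ k)%:M by rewrite -{1}sM -trmx_mul MY tr_scalar_mx.
have YE : Y^T = Y.
  apply: (@scalepXI _ p_pr k); rewrite -mul_mx_scalar -MY mulmxA YtM.
  by rewrite mul_scalar_mx.
by split=> //; rewrite -{1}YE.
Qed.

(** With [Y = p^e M^-1], the congruence of [gmap_ker] says that [M^-1 x] is integral. *)
Lemma presents_ker M g x : M^T = M -> generates g -> presents M g ->
  gmap g x = 0 <-> exists z, x = M *m z.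
Proof.
move=> sM gen [Y [MY YE]]; have [_ YM] := scaled_inv_sym sM MY.
rewrite (gmap_ker _ gen YE); split=> [dv|[z ->] i]; last first.
  by rewrite mulmxA YM mul_scalar_mx mxE pdvdMr// pdvd_pX.
have /choice[z zP] i : exists z, (Y *m x) i 0 = p%:R ^+ e * z by apply/pdvdP.
exists (\col_i z i); apply: (@scalepXI _ p_pr e).
rewrite -mul_scalar_mx -MY -mulmxA scalemxAr; congr (_ *m _).
by apply/matrixP => i j; rewrite ord1 zP !mxE.
Qed.

Lemma presents_in_lattice M g x : presents M g -> in_lattice M x.
Proof. by move=> [Y [MY _]]; exists e, (Y *m x); rewrite mulmxA MY mul_scalar_mx. Qed.

Lemma presents_coker_map M g : M^T = M -> generates g -> presents M g ->
  coker_map M delta (gmap g).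
Proof.
move=> sM gen Mg; split.
- by move=> x y _ _; rewrite gmapD.
- by move=> u; have [x <-] := gen u; exists x => //; apply: presents_in_lattice Mg.
- by move=> x _; apply: presents_ker.
- move=> k x y z xz _; have [Y [MY YE]] := Mg; have [sY YM] := scaled_inv_sym sM MY.
  rewrite (delta_gmap _ _ YE); apply: ptors_change.
  have : p%:R ^+ k *: (x^T *m Y *m y) = p%:R ^+ e *: (z^T *m y).
    rewrite -[x^T *m Y]trmxK trmx_mul trmxK sY.
    have -> : p%:R ^+ k *: ((Y *m x)^T *m y) = (p%:R ^+ k *: (Y *m x))^T *m y.
      by rewrite scalemxAl; congr (_ *m _); apply/matrixP => i j; rewrite !mxE.
    rewrite scalemxAr xz mulmxA YM mul_scalar_mx scalemxAl; congr (_ *m _).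
    by apply/matrixP => i j; rewrite !mxE.
  by move=> /matrixP/(_ 0 0); rewrite !mxE.
Qed.

Lemma coker_map_presents M phi : (forall x, in_lattice M x) -> coker_map M delta phi ->
  generates (fun i => phi (delta_mx i 0)) /\ presents M (fun i => phi (delta_mx i 0)).
Proof.
move=> lat [phiD phi_surj phi_ker phi_pair].
have phiE : phi =1 gmap (fun i => phi (delta_mx i 0)).
  by apply: additive_gmap => x y; apply: phiD.
split; first by move=> u; have [x _ <-] := phi_surj u; exists x.
(* [y j] is column [j] of [p^e M^-1]; it is integral because [phi] kills [p^e] times each basis
   vector. *)
have /choice[y yP] (j : 'I_m) : exists y, p%:R ^+ e *: (delta_mx j 0 : 'cV_m) = M *m y.
  apply/phi_ker => //; rewrite phiE gmapZ zact_pdvd// pdvd_pX//.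
exists (\matrix_(i, j) y j i 0); split.
  apply/matrixP => i j; have /matrixP/(_ i 0) := yP j; rewrite !mxE => yE.
  transitivity (p%:R ^+ e * ((i == j) && (0 == 0 :> 'I_1))%:R : Zp).
    by rewrite yE; apply: eq_bigr => k _; rewrite mxE.
  by rewrite andbT mulr_natr.
move=> i j; rewrite deltaC (phi_pair e _ _ (y j))//.
by rewrite -colE !mxE.
Qed.

Lemma nonsing_in_lattice M x : \det M != 0 -> in_lattice M x.
Proof.
move=> /padic_valuation[k [u [uu dE]]]; exists k, (u^-1 *: (\adj M *m x)).
rewrite -scalemxAr mulmxA mul_mx_adj dE mul_scalar_mx scalerA mulrCA mulVr//.
by rewrite mulr1.
Qed.

Lemma presents_det M g : presents M g -> \det M != 0.
Proof.
move=> [Y [/(congr1 determinant)]]; rewrite det_mulmx det_scalar => dE _.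
by apply: contra_eq_neq dE => ->; rewrite mul0r eq_sym expf_neq0// pX_neq0.
Qed.

(** These tuples form a torsor under [aut_pairing delta]. The action on [g0] is free since [g0]
    generates. It is transitive since [gmap g] and [gmap g0] both have kernel [M Z_p^m], and the
    induced bijection preserves [delta] because [M] determines [Y]. *)
Lemma card_presents M (g0 : 'I_m -> G) : M^T = M -> generates g0 -> presents M g0 ->
  #|[set g : {ffun 'I_m -> G} | `[< generates g >] && `[< presents M g >]]| =
  #|aut_pairing delta|.
Proof.
move=> sM gen0 M0.
pose h (a : {perm G}) := [ffun i => a (g0 i)].
have autD (a : {perm G}) : a \in aut_pairing delta -> {morph a : x y / x + y}.
  rewrite inE => /andP[aA _] x y.
  by have /morphicP := Aut_morphic aA; apply; rewrite inE.
have aut_gmap a x : a \in aut_pairing delta -> a (gmap g0 x) = gmap (h a) x.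
  move=> aA; have aD := autD _ aA.
  rewrite (@additive_gmap (fun x => a (gmap g0 x))); last first.
    by move=> y z /=; rewrite gmapD aD.
  by apply: eq_bigr => i _; rewrite gmap_delta ffunE.
have h_inj : {in aut_pairing delta &, injective h}.
  move=> a b aA bA hab; apply/permP => u; have [x <-] := gen0 u.
  by rewrite !aut_gmap// hab.
rewrite -(card_in_imset h_inj); apply: eq_card => g; rewrite inE.
apply/andP/imsetP => [[/asboolP gen /asboolP Mg]|[a aA ->]]; last first.
  split; apply/asboolP.
    move=> u; have [x xE] := gen0 ((a^-1)%g u); exists x.
    by rewrite -aut_gmap// xE permKV.
  have [Y [MY YE]] := M0; exists Y; split=> // i j; rewrite !ffunE YE.
  by move: aA; rewrite inE => /andP[_ /forallP/(_ (g0 i))/forallP/(_ (g0 j))/eqP].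
have /choice[s sP] u : exists x, gmap g0 x = u := gen0 u.
have eq_ker x y : gmap g0 x = gmap g0 y <-> gmap g x = gmap g y.
  have gmapB g' x' y' : gmap g' x' = gmap g' y' <-> gmap g' (x' - y') = 0.
    have -> : gmap g' x' = gmap g' (x' - y') + gmap g' y' by rewrite -gmapD subrK.
    split=> [/eqP|->]; last by rewrite add0r.
    by rewrite addrC -subr_eq0 addrAC subrr add0r => /eqP.
  by rewrite !gmapB !(presents_ker _ sM).
pose a0 u := gmap g (s u).
have a0E x : a0 (gmap g0 x) = gmap g x by apply/eq_ker.
have a0_inj : injective a0 by move=> u v /eq_ker; rewrite !sP.
have a0_pair u v : delta (a0 u) (a0 v) = delta u v.
  have [Y [MY YE]] := M0; have [Y' [MY' YE']] := Mg.
  have YY' : Y = Y'.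
    have [_ YM] := scaled_inv_sym sM MY.
    apply: (@scalepXI _ p_pr e); rewrite -mul_mx_scalar -MY' mulmxA YM.
    by rewrite mul_scalar_mx.
  by rewrite /a0 (delta_gmap _ _ YE') -{2}(sP u) -{2}(sP v) (delta_gmap _ _ YE) YY'.
exists (perm a0_inj); last first.
  by apply/ffunP => i; rewrite ffunE permE -[g0 i]gmap_delta a0E gmap_delta.
rewrite inE; apply/andP; split; last first.
  by apply/forallP => u; apply/forallP => v; rewrite !permE a0_pair.
rewrite inE; apply/andP; split; first by apply/fintype.subsetP => u; rewrite inE.
apply/morphicP => u v _ _; rewrite !permE.
have [x <-] := gen0 u; have [y <-] := gen0 v.
by have := gmapD g0 x y => /esym xyE; rewrite [LHS](congr1 a0 xyE) !a0E gmapD.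
Qed.

End Tuple.
End Generators.

Section PadicMatrix.
Variables (p : nat) (p_pr : prime p).
Local Notation Zp := (padic_int p_pr).

Lemma pdvd_pXE j k : pdvd k (p%:R ^+ j : Zp) = (k <= j)%N.
Proof.
apply/idP/idP => [|/pdvd_pX//]; apply: contraTT; rewrite -ltnNge => jk.
apply/negP => /(pdvd_le jk); rewrite -addn1 -[_ ^+ j]mulr1 pdvdM2l.
by rewrite -red_eq0 rmorph1 oner_eq0.
Qed.

Lemma pdvd_mulmx k m n l (A : 'M[Zp]_(m, n)) (B : 'M[Zp]_(n, l)) :
  (forall i j, pdvd k (B i j)) -> forall i j, pdvd k ((A *m B) i j).
Proof. by move=> kB i j; rewrite mxE; apply: pdvd_sum => h _; rewrite pdvdMl. Qed.

Lemma pdvd_mulmxr k m n l (A : 'M[Zp]_(m, n)) (B : 'M[Zp]_(n, l)) :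
  (forall i j, pdvd k (A i j)) -> forall i j, pdvd k ((A *m B) i j).
Proof. by move=> kA i j; rewrite mxE; apply: pdvd_sum => h _; rewrite pdvdMr. Qed.

(** The exponent [k] is [e] minus the valuation of [c], truncated at 0. *)
Lemma pdvd_factor (c : Zp) e : exists k, forall y, pdvd e (c * y) = pdvd k y.
Proof.
have [->|/padic_valuation[a [u [uu ->]]]] := eqVneq c 0.
  by exists 0%N => y; rewrite mul0r pdvd_0 pdvd0.
have unit_pdvd k y : pdvd k (u * y) = pdvd k y.
  by apply/idP/idP => [h|/pdvdMl//]; rewrite -(mulKr uu y) pdvdMl.
have [ae|ea] := leqP a e.
  by exists (e - a)%N => y; rewrite -{1}(subnKC ae) -mulrA pdvdM2l unit_pdvd.
by exists 0%N => y; rewrite pdvd0 -mulrA pdvdMr// pdvd_pX// ltnW.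
Qed.

Lemma nat_approx k (y : Zp) : exists2 n, (n < p ^ k)%N & pdvd k (y - n%:R).
Proof.
case: k => [|k]; first by exists 0%N; rewrite ?expn0 ?pdvd0.
exists (y k); first exact: residue_lt.
by have [z zE] := residue_expand y k; rewrite {1}zE addrC addKr pdvdMr// pdvd_pX.
Qed.

Lemma pdvd_matrix k m n (A : 'M[Zp]_(m, n)) : (forall i j, pdvd k (A i j)) ->
  exists B, A = p%:R ^+ k *: B.
Proof.
move=> kA; have /choice[b bP] (ij : 'I_m * 'I_n) : exists y, A ij.1 ij.2 = p%:R ^+ k * y.
  exact/pdvdP.
by exists (\matrix_(i, j) b (i, j)); apply/matrixP => i j; rewrite !mxE (bP (i, j)).
Qed.

End PadicMatrix.

(** * The matrices that present a fixed tuple *)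

Section NormalForm.
Variables (p : nat) (p_pr : prime p) (G : finZmodType) (delta : G -> G -> QmodZ).
Variable e : nat.
Hypothesis expG : forall x : G, x *+ (p ^ e) = 0.
Hypothesis deltaC : forall x y, delta x y = delta y x.
Hypothesis deltaD : forall x, {morph delta x : y z / y + z}.
Hypothesis delta_inj : forall x, (forall y, delta x y = 0) -> x = 0.
Local Notation Zp := (padic_int p_pr).
Variable m : nat.
Implicit Types (g : 'I_m -> G) (M : 'M[Zp]_m).

Local Notation gmap := (gmap e).
Local Notation generates := (@generates p p_pr G e m).
Local Notation presents := (@presents p p_pr G delta e m).

(* [S = M^-1 - A^-1] is integral, and [T = S M S - S]. *)
Lemma presents_coset g A : A^T = A -> presents A g ->
  forall M, M^T = M -> presents M g <->
    exists T : 'M[Zp]_m, [/\ T^T = T, M = A + A *m T *m A & 1%:M + T *m A \in unitmx].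
Proof.
move=> sA [Y0 [AY0 Y0E]] M sM; have [sY0 Y0A] := scaled_inv_sym sA AY0.
split=> [[Y [MY YE]]|[T [sT ME uT]]]; last first.
  set W := 1%:M + T *m A in uT.
  have MW : M = A *m W by rewrite ME mulmxDr mulmx1 mulmxA.
  exists (invmx W *m Y0); split; first by rewrite MW mulmxA mulmxK.
  move=> i j; rewrite -Y0E; apply/ptors_eq.
  have -> : (invmx W *m Y0) i j - Y0 i j = (invmx W *m Y0 - Y0) i j by rewrite !mxE.
  (* That is, [M^-1 - A^-1 = - W^-1 T], which is integral. *)
  have -> : invmx W *m Y0 - Y0 = p%:R ^+ e *: - (invmx W *m T).
    rewrite -[X in _ - X](mulKmx uT) {2}/W mulmxDl mul1mx -mulmxA AY0 mul_mx_scalar.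
    by rewrite mulmxDr opprD addrA subrr add0r -scalemxAr scalerN.
  by rewrite mxE pdvdMr// pdvd_pX.
have [sY YM] := scaled_inv_sym sM MY.
have [S SE] : exists S : 'M[Zp]_m, Y - Y0 = p%:R ^+ e *: S.
  apply: pdvd_matrix => i j; rewrite !mxE; apply/ptors_eq.
  by rewrite YE Y0E.
have sS : S^T = S.
  apply: (@scalepXI _ p_pr e); rewrite -SE -[RHS](_ : (Y - Y0)^T = _).
    by rewrite SE; apply/matrixP => i j; rewrite !mxE.
  by rewrite linearB /= sY sY0.
have M1 : A - M = M *m S *m A.
  apply: (@scalepXI _ p_pr e); rewrite scalemxAl scalemxAr -SE mulmxBr MY mulmxBl.
  by rewrite mul_scalar_mx -mulmxA Y0A mul_mx_scalar scalerBr.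
have M2 : A - M = A *m S *m M.
  by have := congr1 trmx M1; rewrite linearB /= !trmx_mul sA sM sS mulmxA.
exists (S *m M *m S - S); split.
- by rewrite linearB /= !trmx_mul sM sS mulmxA.
- have h : A *m (S *m M *m S) *m A = A *m S *m M *m S *m A by rewrite !mulmxA.
  rewrite mulmxBr mulmxBl h -M2 mulmxBl mulmxBl -M1.
  by rewrite [_ - _ - A *m S *m A]addrAC subrr add0r opprB addrC subrK.
have WE : 1%:M + (S *m M *m S - S) *m A = 1%:M - S *m M.
  have h : S *m M *m S *m A = S *m (M *m S *m A) by rewrite !mulmxA.
  rewrite mulmxBl h -M1 mulmxBr.
  by rewrite addrAC subrr add0r.
(* [1 - S M = A^-1 M] has the inverse [M^-1 A = 1 + S A], which is integral as well. *)
rewrite WE; have /mulmx1_unit[] // : (1%:M - S *m M) *m (1%:M + S *m A) = 1%:M.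
have h : S *m M *m (S *m A) = S *m (M *m S *m A) by rewrite !mulmxA.
rewrite mulmxDr mulmx1 mulmxBl mul1mx h -M1 mulmxBr opprB [S *m A + _]addrC subrK.
by rewrite subrK.
Qed.

Definition pdiag (f : 'I_m -> nat) : 'M[Zp]_m := diag_mx (\row_i p%:R ^+ f i).

Lemma gram_lift g : exists d : 'M[Zp]_m,
  d^T = d /\ forall i j, ptors e (d i j) = delta (g i) (g j).
Proof.
(* The lift is a function of the value [t] alone, so the lifted Gram matrix inherits the symmetry of
   [delta]. *)
have /choice[l lP] (t : QmodZ) : exists k : nat, t *+ (p ^ e) = 0 -> t = ptors e (k%:R : Zp).
  have [/(ptors_surj p_pr)[k kE]|t0] := pselect (t *+ (p ^ e) = 0); first by exists k.
  by exists 0%N.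
exists (\matrix_(i, j) (l (delta (g i) (g j)))%:R); split.
  by apply/matrixP => i j; rewrite !mxE deltaC.
by move=> i j; rewrite mxE -lP// -deltaMn// expG delta0.
Qed.

(** Write a lifted Gram matrix as [d = U c V]. The kernel condition [d x = 0] modulo [p^e] decouples
    in the coordinates [V x] into [c_i (V x)_i = 0] modulo [p^e], so [P = V^-1] works; growing
    valuations of [c] make [f] nonincreasing. *)
Lemma diagonal_generators g : generates g -> exists (P : 'M[Zp]_m) (f : 'I_m -> nat),
  [/\ P \in unitmx, forall i j : 'I_m, (i <= j)%N -> (f j <= f i)%N
    & forall y, gmap g (P *m y) = 0 <-> forall i, pdvd (f i) (y i 0)].
Proof.
move=> gen; have [d [sd dE]] := gram_lift g.
have [U [V [c [uU uV UcV cP]]]] := smith_form d.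
have /choice[f fP] i := pdvd_factor (c i) e.
exists (invmx V), f; split; first by rewrite unitmx_inv.
  move=> i j ij; rewrite -(@pdvd_pXE _ p_pr) -fP.
  have cf k l : pdvd e (c k * p%:R ^+ l) = pdvd (e - l) (c k).
    have [le|el] := leqP l e; last first.
      by rewrite pdvdMl ?pdvd_pX 1?ltnW// (eqP (ltnW el)) pdvd0.
    by rewrite -{1}(subnKC le) mulrC pdvdM2l.
  by rewrite cf; apply: cP ij _; rewrite -cf fP pdvd_pX.
move=> y; rewrite (gmap_ker deltaC deltaD delta_inj _ gen dE).
set Dc := (\matrix_(i, j) _) in UcV.
have DcE i : (Dc *m y) i 0 = c i * y i 0.
  rewrite mxE (bigD1 i)//= mxE eqxx mul1r big1 ?addr0// => k /negPf ki.
  by rewrite mxE eq_sym ki mul0r mul0r.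
have -> : d *m (invmx V *m y) = U *m (Dc *m y) by rewrite UcV !mulmxA mulmxK.
split=> [dv i|dv i].
  rewrite -fP -DcE -[Dc *m y](mulKmx uU); apply: pdvd_mulmx => j k; rewrite (ord1 k).
  exact: dv.
by apply: pdvd_mulmx => j k; rewrite (ord1 k) DcE fP.
Qed.

(** The tuple [g'] is [g] in the coordinates [P], and [p^(f i)] kills [g' i]. Its Gram matrix,
    lifted and corrected to [X], then satisfies [X D = p^e N] with [D = diag(p^f)]. As [N] is
    invertible, [A' = D N^-1] presents [g'], and [A = P A' P^T] presents [g]. The two factors [A] in
    [A T A] each contribute one [D]. *)
Lemma presents_normal_form g : generates g ->
  exists (A L : 'M[Zp]_m) (f : 'I_m -> nat) (g' : 'I_m -> G),
  [/\ [/\ A^T = A, L \in unitmx & forall i j : 'I_m, (i <= j)%N -> (f j <= f i)%N],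
      generates g', forall y : 'cV[Zp]_m, gmap g' y = 0 <-> forall i, pdvd (f i) (y i 0)
    & forall M, M^T = M -> presents M g <-> exists T : 'M[Zp]_m, [/\ T^T = T,
        M = A + L *m (pdiag f *m T *m pdiag f) *m L^T
      & 1%:M + map_mx (@red p p_pr) T *m (\matrix_(i, j) ((i == j) && (f i == 0)%N)%:R)
          \in unitmx]].
Proof.
move=> gen; have [P [f [uP f_mono kerP]]] := diagonal_generators gen.
have [d [sd dE]] := gram_lift g.
pose g' i := gmap g (col i P).
have gmapE y : gmap g' y = gmap g (P *m y).
  rewrite (@additive_gmap _ p_pr G e expG m (fun y => gmap g (P *m y))).
    by apply: eq_bigr => i _; rewrite -colE.
  by move=> x z; rewrite mulmxDr gmapD.
have gen' : generates g'.
  by move=> u; have [x <-] := gen u; exists (invmx P *m x); rewrite gmapE mulKVmx.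
have ker' (y : 'cV[Zp]_m) : gmap g' y = 0 <-> forall i, pdvd (f i) (y i 0) by rewrite gmapE.
pose d' := P^T *m d *m P.
have sd' : d'^T = d' by rewrite /d' !trmx_mul trmxK sd mulmxA.
have d'E i j : ptors e (d' i j) = delta (g' i) (g' j).
  rewrite /g' (delta_gmap deltaC deltaD _ _ dE) /d' !colE trmx_mul trmx_delta.
  by rewrite mulmxA -colE [in RHS]mxE -!mulmxA -rowE [in RHS]mxE.
have dd' : d = (invmx P)^T *m d' *m invmx P.
  by rewrite /d' !mulmxA -trmx_mul mulmxV// trmx1 mul1mx mulmxK.
clearbody d'.
have g'0 i : f i = 0%N -> g' i = 0.
  move=> fi; rewrite -[g' i](@gmap_delta _ p_pr _ e expG); apply/ker' => j.
  by rewrite mxE; case: eqP => [->|_]; rewrite ?fi ?pdvd0 ?pdvd_0.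
have d'0 i j : f i = 0%N -> pdvd e (d' i j).
  by move=> /g'0 gi; apply/ptors_eq0; rewrite d'E gi deltaC delta0.
have d'f i j : pdvd e (p%:R ^+ f j * d' i j).
  apply/ptors_eq0; rewrite -(delta_zact deltaD (x := g' i) (y := g' j))//.
  suff -> : zact e (p%:R ^+ f j : Zp) (g' j) = 0 by rewrite delta0.
  rewrite -[g' j](@gmap_delta _ p_pr _ e expG) -gmapZ//; apply/ker' => k.
  by rewrite !mxE; case: eqP => [->|_]; rewrite ?mulr0 ?pdvd_0// pdvdMr// pdvd_pX.
have /choice[N0 N0E] (ij : 'I_m * 'I_m) : exists t,
  p%:R ^+ f ij.2 * d' ij.1 ij.2 = p%:R ^+ e * t by apply/pdvdP.
(* [d'] alone may be singular: at the indices with [g' i = 0] it is replaced by [p^e] times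
   the identity, which makes [N = p^-e X diag(p^f)] invertible. *)
pose triv i j := (f i == 0)%N || (f j == 0)%N.
pose X : 'M[Zp]_m := \matrix_(i, j) if triv i j then p%:R ^+ e *+ (i == j) else d' i j.
pose N : 'M[Zp]_m := \matrix_(i, j) if triv i j then (i == j)%:R else N0 (i, j).
have XE i j : X i j = if triv i j then p%:R ^+ e *+ (i == j) else d' i j by rewrite mxE.
have NE i j : N i j = if triv i j then (i == j)%:R else N0 (i, j) by rewrite mxE.
clearbody X N.
have sX : X^T = X.
  apply/matrixP => i j; rewrite mxE !XE /triv orbC [j == i]eq_sym; case: ifP => // _.
  by rewrite -{1}sd' mxE.
have XD : X *m pdiag f = p%:R ^+ e *: N.
  apply/matrixP => i j; rewrite mul_mx_diag !mxE XE NE.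
  case: ifP => [|_]; last by rewrite mulrC (N0E (i, j)).
  rewrite /triv; have [->|ij] := eqVneq i j; last by rewrite !mulr0n mul0r mulr0.
  by rewrite orbb => /eqP ->; rewrite mulr1n mulr1.
have Xd' i j : pdvd e (X i j - d' i j).
  rewrite XE; case: ifP => [tij|_]; last by rewrite subrr pdvd_0.
  apply: pdvdB; first by rewrite -mulr_natr pdvdMr// pdvd_pX.
  have [fi|fj] := orP tij; first exact/d'0/eqP.
  by rewrite -sd' mxE; apply/d'0/eqP.
have uN : N \in unitmx.
  rewrite unitmx_red -unitmx_tr; apply/unitmx_kerP => x xN.
  pose y : 'cV[Zp]_m := \col_i (x 0 i : nat)%:R.
  have yE i : red (y i 0) = x 0 i by rewrite mxE red_nat_of.
  clearbody y.
  have Ny i : pdvd 1 ((N *m y) i 0).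
    rewrite -red_eq0 mxE rmorph_sum /=; apply/eqP.
    have /matrixP/(_ 0 i) := xN; rewrite [LHS]mxE [RHS]mxE => xN0.
    rewrite -[RHS]xN0; apply: eq_bigr => j _.
    by rewrite rmorphM /= yE !mxE mulrC.
  (* This is [D y / p], with 0 where [f i = 0]. From [N y = 0] modulo [p] follows [d' w = 0] modulo
     [p^e], so [w] is a relation among the [g' i]; hence [p^(f i)] divides [p^(f i - 1) y_i].
     Indices with [f i = 0] are settled by the identity rows of [N]. *)
  pose w : 'cV[Zp]_m := \col_i if (f i == 0)%N then 0 else p%:R ^+ (f i).-1 * y i 0.
  have /ker' wf : gmap g' w = 0.
    apply/(gmap_ker deltaC deltaD delta_inj _ gen' d'E) => i.
    have [fi|fi] := eqVneq (f i) 0%N.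
      by rewrite mxE; apply: pdvd_sum => j _; rewrite pdvdMr// d'0.
    have /pdvdP[t tE] := Ny i; apply/pdvdP; exists t.
    apply: (@mulpXI _ p_pr 1); rewrite mulrCA -tE expr1 !mxE !mulr_sumr.
    apply: eq_bigr => j _; rewrite mxE NE /triv (negPf fi) /=.
    have [fj|fj] := eqVneq (f j) 0%N.
      have /negPf-> : i != j by apply: contraNneq fi => ->; rewrite fj.
      by rewrite mul0r !mulr0.
    rewrite [RHS]mulrA -(N0E (i, j)) /= -{2}(prednK (_ : 0 < f j)%N) ?lt0n// exprS.
    by ring.
  apply/rowP => i; rewrite mxE -yE; apply/eqP; rewrite red_eq0.
  have [fi|fi] := eqVneq (f i) 0%N.
    have := Ny i; rewrite mxE (bigD1 i)//= big1 ?addr0.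
      by rewrite NE /triv fi !eqxx mul1r.
    by move=> j /negPf ji; rewrite NE /triv fi eqxx /= eq_sym ji mul0r.
  have := wf i; rewrite mxE (negPf fi) -{1}(prednK (_ : 0 < f i)%N) ?lt0n// -addn1.
  by rewrite pdvdM2l.
pose A' := pdiag f *m invmx N.
have XA' : X *m A' = (p%:R ^+ e)%:M.
  by rewrite mulmxA XD -scalemxAl mulmxV// scalemx1.
have [sA' A'X] := scaled_inv_sym sX XA'.
have A'D : A' = pdiag f *m invmx N by [].
clearbody A'.
have A'E : A' = (invmx N)^T *m pdiag f.
  by rewrite -sA' A'D trmx_mul tr_diag_mx.
pose A := P *m A' *m P^T.
have sA : A^T = A by rewrite /A !trmx_mul trmxK sA' mulmxA.
have APi : A *m (invmx P)^T = P *m A'.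
  by rewrite /A -mulmxA -trmx_mul mulVmx// trmx1 mulmx1.
have PiA : invmx P *m A = A' *m P^T by rewrite /A -mulmxA mulKmx.
have presA : presents A g.
  exists ((invmx P)^T *m X *m invmx P); split.
    rewrite !mulmxA APi -[P *m A' *m X]mulmxA A'X mul_mx_scalar -scalemxAl mulmxV//.
    by rewrite scalemx1.
  move=> i j; rewrite -dE; apply/ptors_eq.
  have subE (B C : 'M[Zp]_m) k l : B k l - C k l = (B - C) k l by rewrite !mxE.
  rewrite dd'; set Z := invmx P; have -> : (Z^T *m X *m Z) i j - (Z^T *m d' *m Z) i j =
      (Z^T *m (X - d') *m Z) i j.
    by rewrite subE mulmxBr mulmxBl.
  apply: pdvd_mulmxr; apply: pdvd_mulmx => k l.
  by have := Xd' k l; rewrite [(X - d') _ _]mxE [(- d') _ _]mxE.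
exists A, (P *m (invmx N)^T), f, g'; split=> //.
  by split=> //; rewrite unitmx_mul uP unitmx_tr unitmx_inv.
(* If [f i > 0], row [i] of [A' = D N^-1] is divisible by [p]. If [f j = 0], column [j] of [X] is
   [p^e] times a basis vector, so column [j] of [A'] is that vector. *)
have redA' : map_mx (@red p p_pr) A' = \matrix_(i, j) ((i == j) && (f i == 0)%N)%:R.
  have A'col i j : f j = 0%N -> A' i j = (i == j)%:R.
    move=> fj; have /matrixP/(_ i j) := A'X; rewrite [LHS]mxE [RHS]mxE (bigD1 j)//= big1.
      rewrite XE /triv fj !eqxx orbT mulr1n addr0 mulrC => h.
      by apply: (@mulpXI _ p_pr e); rewrite h mulr_natr.
    by move=> k /negPf kj; rewrite XE /triv fj eqxx orbT kj mulr0.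
  apply/matrixP => i j; rewrite [LHS]mxE [RHS]mxE.
  have [fi|fi] := eqVneq (f i) 0%N.
    by rewrite andbT -sA' mxE A'col// rmorph_nat eq_sym.
  rewrite andbF A'D mul_diag_mx !mxE rmorphM rmorphXn /=.
  rewrite -[X in red X]expr1; apply/eqP; rewrite mulf_eq0 expf_eq0 lt0n fi /=.
  by rewrite red_eq0 -[p%:R]expr1 pdvd_pX.
(* Writing the left [A'] as [N^-T D] and the right one as [D N^-1] moves both diagonals next to
   [T]. *)
have conjE T : A *m ((invmx P)^T *m T *m invmx P) *m A =
    P *m (invmx N)^T *m (pdiag f *m T *m pdiag f) *m (P *m (invmx N)^T)^T.
  transitivity (P *m A' *m T *m (A' *m P^T)); first by rewrite -PiA -APi !mulmxA.
  by rewrite {1}A'E A'D trmx_mul trmxK !mulmxA.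
have unitE T : (1%:M + (invmx P)^T *m T *m invmx P *m A \in unitmx) =
  (1%:M + map_mx (@red p p_pr) T *m (\matrix_(i, j) ((i == j) && (f i == 0)%N)%:R) \in unitmx).
  have -> : 1%:M + (invmx P)^T *m T *m invmx P *m A = (invmx P)^T *m (1%:M + T *m A') *m P^T.
    have h1 : (invmx P)^T *m P^T = 1%:M by rewrite -trmx_mul (mulmxV uP) trmx1.
    by rewrite mulmxDr mulmxDl mulmx1 h1 -[_ *m invmx P *m A]mulmxA PiA !mulmxA.
  rewrite !unitmx_mul !unitmx_tr unitmx_inv uP andbT unitmx_red.
  by rewrite map_mxD map_mx1 map_mxM redA'.
move=> M sM; rewrite (presents_coset sA presA sM); split=> -[T [sT ME uT]].
  exists (P^T *m T *m P); have TE : T = (invmx P)^T *m (P^T *m T *m P) *m invmx P.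
    by rewrite !mulmxA -trmx_mul mulmxV// trmx1 mul1mx mulmxK.
  split; first by rewrite !trmx_mul trmxK sT mulmxA.
    by rewrite -conjE -TE.
  by rewrite -unitE -TE.
exists ((invmx P)^T *m T *m invmx P); split; first by rewrite !trmx_mul trmxK sT mulmxA.
  by rewrite conjE.
by rewrite unitE.
Qed.

End NormalForm.

(** * Counting generating tuples *)

Lemma card_family_prod (aT rT : finType) (F : aT -> pred rT) :
  #|[set f : {ffun aT -> rT} | [forall x, F x (f x)]]| = (\prod_x #|F x|)%N.
Proof.
transitivity #|(family F : simpl_pred {ffun aT -> rT})|.
  by apply: eq_card => f; rewrite inE; apply/forallP/familyP.
by rewrite card_family foldrE big_map enumT.
Qed.

Section CountGenerators.
Variables (p : nat) (p_pr : prime p) (G : finZmodType) (e : nat).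
Hypothesis expG : forall x : G, x *+ (p ^ e) = 0.
Local Notation Zp := (padic_int p_pr).
Variable m : nat.

Local Notation gmap := (gmap e).
Local Notation generates := (@generates p p_pr G e m).
Local Notation V := (modpG G p_pr).
Local Notation pi := (@modpG_pi p p_pr G).

Lemma modpG_pi0 : pi 0 = 0.
Proof. by apply: (addrI (pi 0)); rewrite -modpG_piD !addr0. Qed.

Lemma modpG_piMn x k : pi (x *+ k) = pi x *+ k.
Proof. by elim: k => [|k IH]; rewrite ?mulr0n ?modpG_pi0// !mulrS modpG_piD IH. Qed.

Lemma modpG_pi_eq x y : (pi x = pi y) <-> exists z, x - y = z *+ p.
Proof.
split=> [/eqP|h]; last apply/eqP; rewrite /modpG_pi generic_quotient.eqmodE /= /Quotient.equiv.
  by move=> /existsP[z /eqP zE]; exists z.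
by case: h => z zE; apply/existsP; exists z; rewrite zE.
Qed.

Lemma modpG_scaleE (a : 'F_p) (v : V) : a *: v = v *+ a. Proof. by []. Qed.

Lemma modpG_scale_nat k (v : V) : (k%:R : 'F_p) *: v = v *+ k.
Proof. by rewrite modpG_scaleE val_Fp_nat// modpG_mulr_mod. Qed.

Lemma pi_zact (a : Zp) x : pi (zact e a x) = red a *: pi x.
Proof.
rewrite /zact modpG_piMn -modpG_scale_nat; congr (_ *: _).
have rp : red (p%:R : Zp) = 0 by apply/eqP; rewrite red_eq0 -[p%:R]expr1 pdvd_pX.
have [y aE] := residue_expand a e; rewrite {2}aE rmorphD rmorph_nat rmorphM rmorphXn /=.
by rewrite rp expr0n /= mul0r addr0.
Qed.

Lemma pi_gmap (g : 'I_m -> G) (x : 'cV[Zp]_m) : pi (gmap g x) = \sum_i red (x i 0) *: pi (g i).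
Proof.
rewrite /gmap (big_morph pi (@modpG_piD _ _ _) modpG_pi0).
by apply: eq_bigr => i _; rewrite pi_zact.
Qed.

(** [gmap g] identifies [G] with the direct sum of the [Z_p / p^(f i)], where naturals below
    [p ^ f i] are representatives. *)
Lemma card_kernel_pdvd (g : 'I_m -> G) (f : 'I_m -> nat) : generates g ->
  (forall y, gmap g y = 0 <-> forall i, pdvd (f i) (y i 0 : Zp)) ->
  #|G| = (p ^ (\sum_i f i))%N.
Proof.
move=> gen ker; have fe i : (f i <= e)%N.
  rewrite -(@pdvd_pXE _ p_pr).
  have /ker/(_ i) : gmap g (p%:R ^+ e *: (delta_mx i 0 : 'cV[Zp]_m)) = 0.
    by rewrite gmapZ// zact_pdvd// pdvd_pX.
  by rewrite !mxE !eqxx mulr1.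
have pe0 : (0 < p ^ e)%N by rewrite expn_gt0 prime_gt0.
(* As [f i <= e], all coordinates can share the type ['I_(p ^ e)]; [F] imposes the true bound. *)
pose F i : pred 'I_(p ^ e) := fun k => (k < p ^ f i)%N.
have cF i : #|F i| = (p ^ f i)%N.
  have le : (p ^ f i <= p ^ e)%N by rewrite leq_exp2l ?prime_gt1.
  have w_inj : injective (widen_ord le).
    by move=> a b /(congr1 val) /= ab; apply: val_inj.
  rewrite -[RHS]card_ord -cardsT -(card_imset _ w_inj).
  apply: eq_card => k; apply/idP/imsetP => [kF|[j _ ->]]; last exact: (ltn_ord j).
  by exists (Ordinal (kF : (k < p ^ f i)%N)) => //; apply: val_inj.
pose h (x : {ffun 'I_m -> 'I_(p ^ e)}) := gmap g (\col_i ((x i : nat)%:R : Zp)).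
have h_inj : {in [set x : {ffun 'I_m -> 'I_(p ^ e)} | [forall i, F i (x i)]] &, injective h}.
  move=> x y; rewrite !inE => /forallP xF /forallP yF hxy; apply/ffunP => i; apply: val_inj.
  have /ker/(_ i) : gmap g (\col_i ((x i : nat)%:R : Zp) - \col_i ((y i : nat)%:R : Zp)) = 0.
    apply: (addIr (gmap g (\col_i ((y i : nat)%:R : Zp)))).
    by rewrite -gmapD// subrK add0r.
  rewrite !mxE => /(@pdvd_nat_mod _ p_pr).
  by rewrite !modn_small ?xF ?yF//; [exact: yF|exact: xF].
rewrite expn_sum -(eq_bigr _ (fun i _ => cF i)) -card_family_prod -(card_in_imset h_inj).
rewrite -cardsT; apply: eq_card => u; rewrite inE; apply/esym/imsetP.
have [y <-] := gen u.
have /choice[n nP] i : exists k, (k < p ^ f i)%N /\ pdvd (f i) (y i 0 - k%:R).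
  by have [k k1 k2] := nat_approx (f i) (y i 0); exists k.
have ne i : (n i < p ^ e)%N.
  by rewrite (leq_trans (nP i).1)// leq_exp2l ?prime_gt1.
exists [ffun i => Ordinal (ne i)].
  by rewrite inE; apply/forallP => i; rewrite ffunE /F /= (nP i).1.
rewrite /h -[y](subrK (\col_i ((n i)%:R : Zp))) gmapD//.
have /ker-> : forall i, pdvd (f i) ((y - \col_i ((n i)%:R : Zp)) i 0).
  by move=> i; rewrite !mxE (nP i).2.
by rewrite add0r; congr gmap; apply/matrixP => i j; rewrite !mxE ffunE.
Qed.

(** The classes of the [g i] with [f i > 0] form a basis of [G/pG]. They span because [f i = 0]
    forces [g i = 0]. A relation with coefficients [c] has value [p z] with [z = gmap g y], so
    [c - p y] lies in the kernel and [p] divides [c] wherever [f i > 0]. *)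
Lemma dim_kernel_pdvd (g : 'I_m -> G) (f : 'I_m -> nat) : generates g ->
  (forall y, gmap g y = 0 <-> forall i, pdvd (f i) (y i 0 : Zp)) ->
  \dim {: V} = #|[set i | (0 < f i)%N]|.
Proof.
move=> gen ker; set I := [set i | _].
pose X := [tuple pi (g (enum_val i)) | i < #|I|].
have XE (i : 'I_#|I|) : X`_i = pi (g (enum_val i)) by rewrite -tnth_nth tnth_mktuple.
apply: (@size_basis _ _ _ _ X); rewrite /basis_of andbC; apply/andP; split.
  apply/freeP => k; under eq_bigr do rewrite XE modpG_scaleE -modpG_piMn.
  rewrite -(big_morph pi (@modpG_piD _ _ _) modpG_pi0) -modpG_pi0 => /modpG_pi_eq[z].
  rewrite subr0 => zE i; have [y yE] := gen z.
  pose c : 'cV[Zp]_m := \col_j \sum_(i | enum_val i == j) (k i : nat)%:R.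
  have cE i' : c (enum_val i') 0 = (k i' : nat)%:R.
    rewrite mxE (bigD1 i')//= big1 ?addr0// => j /andP[/eqP/enum_val_inj ->].
    by rewrite eqxx.
  have gc : gmap g c = \sum_(i < #|I|) g (enum_val i) *+ k i.
    have zact_sum (J : finType) (P : pred J) (a : J -> Zp) (x : G) :
        zact e (\sum_(j | P j) a j) x = \sum_(j | P j) zact e (a j) x.
      have zD : {morph (fun b : Zp => zact e b x) : b b' / b + b' >-> b + b'}.
        by move=> b b'; exact: zactDl.
      have z0 : zact e (0 : Zp) x = 0 by rewrite zact_pdvd ?pdvd_0.
      by rewrite (big_morph _ zD z0).
    rewrite /gmap; under eq_bigr do rewrite mxE zact_sum.
    rewrite (exchange_big_dep predT)//=; apply: eq_bigr => j _.
    rewrite (big_pred1 (enum_val j)) => [|l]; last by rewrite eq_sym.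
    by rewrite (@zact_nat _ _ _ _ expG _ (k j))// subrr pdvd_0.
  have /ker/(_ (enum_val i)) : gmap g (c - p%:R *: y) = 0.
    apply: (addIr (gmap g (p%:R *: y))); rewrite -gmapD// subrK add0r gc zE gmapZ// yE.
    by rewrite (@zact_nat _ _ _ _ expG _ p)// subrr pdvd_0.
  have fi : (0 < f (enum_val i))%N by have := enum_valP i; rewrite inE.
  move=> /(pdvd_le fi); rewrite [X in pdvd _ X]mxE cE !mxE => dv.
  have : pdvd 1 ((k i : nat)%:R : Zp).
    rewrite -(subrK (p%:R * y (enum_val i) 0) (k i : nat)%:R) pdvdD//.
    by rewrite pdvdMr// -[p%:R]expr1 pdvd_pX.
  by rewrite -red_eq0 red_nat_of => /eqP.
rewrite eqEsubv subvf; apply/subvP => v _; have [u ->] := modpG_piP v; have [y <-] := gen u.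
rewrite pi_gmap; apply: rpred_sum => i _; apply: rpredZ.
have [fi|fi] := posnP (f i).
  suff -> : g i = 0 by rewrite modpG_pi0 rpred0.
  rewrite -[g i](@gmap_delta _ p_pr _ e expG); apply/ker => j.
  by rewrite mxE; case: eqP => [->|_]; rewrite ?fi ?pdvd0 ?pdvd_0.
have iI : i \in I by rewrite inE.
apply: memv_span; rewrite -(enum_rankK_in iI iI); apply/tnthP.
by exists (enum_rank_in iI i); rewrite tnth_mktuple.
Qed.

Local Notation dV := (\dim {: V}).
Definition modp_coord (v : V) : 'rV['F_p]_dV := \row_j coord (vbasis {: V}) j v.

Lemma modp_coord_linear : linear modp_coord.
Proof. by move=> a u v; apply/rowP => j; rewrite !mxE linearP. Qed.
HB.instance Definition _ := GRing.isLinear.Build _ _ _ _ modp_coord modp_coord_linear.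

Lemma modp_coord_inj : injective modp_coord.
Proof.
move=> u v /rowP uv; rewrite (coord_vbasis (memvf u)) (coord_vbasis (memvf v)).
by apply: eq_bigr => j _; have := uv j; rewrite !mxE => ->.
Qed.

Lemma modp_coord_surj w : exists u, modp_coord (pi u) = w.
Proof.
have [u uE] := modpG_piP (\sum_j w 0 j *: (vbasis {: V})`_j : V).
exists u; rewrite -uE; apply/rowP => j; rewrite mxE.
by rewrite coord_sum_free// (basis_free (vbasisP _)).
Qed.

Definition modp_mx (g : 'I_m -> G) : 'M['F_p]_(m, dV) := \matrix_i modp_coord (pi (g i)).

Lemma modp_mx_gmap g (x : 'cV[Zp]_m) : modp_coord (pi (gmap g x)) = (\row_i red (x i 0)) *m modp_mx g.
Proof.
rewrite pi_gmap linear_sum mulmx_sum_row; apply: eq_bigr => i _.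
by rewrite linearZ rowK mxE.
Qed.

(* Nakayama's lemma *)
Lemma generatesP g : generates g <-> row_full (modp_mx g).
Proof.
split=> [gen|full].
  rewrite -sub1mx; apply/row_subP => i; have [u uE] := modp_coord_surj (row i 1%:M).
  by have [x xE] := gen u; rewrite -uE -xE modp_mx_gmap submxMl.
have step u : exists (x : 'cV[Zp]_m) y, u = gmap g x + y *+ p.
  have /submxP[c cE] : (modp_coord (pi u) <= modp_mx g)%MS by rewrite submx_full.
  pose x : 'cV[Zp]_m := \col_i (c 0 i : nat)%:R.
  have /modpG_pi_eq[y yE] : pi u = pi (gmap g x).
    apply: modp_coord_inj; rewrite modp_mx_gmap cE; congr (_ *m _).
    by apply/rowP => i; rewrite !mxE red_nat_of.
  by exists x, y; rewrite -yE addrC subrK.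
move=> u; suff [x [y ->]] : exists (x : 'cV[Zp]_m) y, u = gmap g x + y *+ (p ^ e).
  by exists x; rewrite expG addr0.
elim: (e in (p ^ e)%N) => [|n [x [y uE]]]; first by exists 0, u; rewrite gmap0 ?add0r.
have [x' [y' yE]] := step y; exists (x + (p ^ n)%:R *: x'), y'.
rewrite {1}uE yE gmapD// gmapZ// mulrnDl -mulrnA -expnS addrA; congr (_ + _ + _).
by rewrite (@zact_nat _ _ _ _ expG _ (p ^ n)%N)// subrr pdvd_0.
Qed.

(** Reduction modulo [p] maps the generating tuples onto the matrices of full rank, with fibres of
    size [K ^ m], where [K] is the order of [pG] and [#G = p ^ dV * K]. The factor [p ^ (dV * m)]
    keeps the identity in [nat]. *)
Lemma card_generates :
  (#|[set g : {ffun 'I_m -> G} | `[< generates g >]]| * p ^ (dV * m) =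
   (\prod_(i < dV) (p ^ m - p ^ i)) * #|G| ^ m)%N.
Proof.
pose K := #|[set u : G | modp_coord (pi u) == 0]|.
have cK w : #|[pred u : G | modp_coord (pi u) == w]| = K.
  have [u0 u0E] := modp_coord_surj w; rewrite -[RHS](card_imset _ (addIr u0)).
  apply: eq_card => u; apply/idP/imsetP => [|[u1]].
    rewrite inE => /eqP uw; exists (u - u0); last by rewrite subrK.
    rewrite inE; apply/eqP; apply: (addIr (modp_coord (pi u0))).
    by rewrite -linearD /= -modpG_piD subrK uw u0E add0r.
  by rewrite !inE => /eqP u10 ->; rewrite modpG_piD linearD /= u10 add0r u0E.
have GK : #|G| = (p ^ dV * K)%N.
  rewrite -sum1_card (partition_big (fun u => modp_coord (pi u)) predT)//=.
  under eq_bigr => w _.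
    rewrite sum1_card (_ : #|_| = K); last by rewrite -(cK w); apply: eq_card => u; rewrite !inE.
    over.
  by rewrite sum_nat_const card_mx mul1n card_Fp.
have -> : #|[set g : {ffun 'I_m -> G} | `[< generates g >]]| =
    (#|[set B : 'M['F_p]_(m, dV) | row_full B]| * K ^ m)%N.
  rewrite -sum1_card (partition_big (fun g : {ffun 'I_m -> G} => modp_mx g)
    (fun B => B \in [set B : 'M['F_p]_(m, dV) | row_full B]))/=; last first.
    move=> g gS; rewrite inE; apply: (generatesP g).1.
    by move: gS; rewrite inE => /asboolP.
  rewrite -sum_nat_const; apply: eq_bigr => B; rewrite inE => fB.
  rewrite sum1_card -[m in RHS]card_ord -prod_nat_const.
  rewrite -(eq_bigr _ (fun i _ => cK (row i B))) -card_family_prod.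
  apply: eq_card => g; rewrite !inE; apply/andP/forallP => [[_ /eqP gB] i|gB].
    by rewrite /= -gB rowK.
  have gBE : modp_mx g = B by apply/row_matrixP => i; rewrite rowK; exact/eqP/gB.
  split; last exact/eqP.
  by rewrite inE; apply/asboolP; apply: (generatesP g).2; rewrite gBE.
have -> : #|[set B : 'M['F_p]_(m, dV) | row_full B]| =
    #|[set B : 'M['F_p]_(dV, m) | row_free B]|.
  rewrite -(card_imset _ (@trmx_inj _ _ _)); apply: eq_card => B.
  apply/imsetP/idP => [[B' + ->]|].
    by rewrite !inE /row_full /row_free mxrank_tr.
  by rewrite inE => fB; exists B^T; rewrite ?trmxK// inE /row_full mxrank_tr.
rewrite card_row_free card_Fp// GK expnMn -expnM -!mulnA; congr (_ * _)%N.
by rewrite mulnC.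
Qed.

End CountGenerators.

(** * Haar measure on Sym^0 *)

Section DoubleCounting.
Variables (d : measure_display) (T : measurableType d) (R : realType).
Variable mu : probability T R.
Variables (I : finType) (A : {set I}) (F : I -> set T).
Hypothesis mF : forall i, measurable (F i).

Lemma integral_indicT (S : set T) : measurable S ->
  (\int[mu]_x (\1_S x : R)%:E)%E = mu S.
Proof. by move=> mS; rewrite integral_indic// setIT. Qed.

Lemma sum_measureE : (\sum_(i in A) mu (F i))%E =
  (\int[mu]_x (#|[set i in A | x \in F i]|%:R : R)%:E)%E.
Proof.
rewrite -big_enum /=; under eq_bigr do rewrite -integral_indicT//.
rewrite -ge0_integral_sum//; last by move=> i; apply/measurable_EFinP; exact: measurable_indic.
apply: eq_integral => x _; rewrite big_enum /= sumEFin; congr EFin.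
under eq_bigr do rewrite indicE.
rewrite -natr_sum -sum1_card big_mkcond /= [in RHS]big_mkcond /=; congr (_%:R).
by apply: eq_bigr => i _; rewrite inE; case: (i \in A) => //=; case: (x \in F i).
Qed.

(** Applied with [c = 1] to partitions into boxes and with [c] the order of the automorphism group
    to the covering of the event by tuples. *)
Lemma sum_measure_count (S : set T) (c : nat) : measurable S ->
  (forall x, #|[set i in A | x \in F i]| = ((x \in S) * c)%N) ->
  (\sum_(i in A) mu (F i))%E = ((c%:R)%:E * mu S)%E.
Proof.
move=> mS cS; rewrite sum_measureE.
under eq_integral => x _ do rewrite cS natrM EFinM muleC -indicE.
rewrite ge0_integralZl_EFin//; first by rewrite integral_indicT.
  apply/measurable_EFinP; exact: measurable_indic.
Qed.

Lemma sum_measure_le (c : nat) : (forall x, (#|[set i in A | x \in F i]| <= c)%N) ->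
  (\sum_(i in A) mu (F i) <= (c%:R)%:E)%E.
Proof.
move=> cS; rewrite sum_measureE.
have -> : ((c%:R : R)%:E = \int[mu]_x (cst (c%:R : R)%:E x))%E.
  by rewrite integral_cst// [X in (_ * X)%E]probability_setT mule1.
apply: ge0_le_integral => //.
  have -> : (fun x => (#|[set i in A | x \in F i]|%:R : R)%:E) =
      (fun x => \sum_(i <- enum A) (\1_(F i) x : R)%:E)%E.
    apply/funext => x; rewrite big_enum /= sumEFin; congr EFin.
    under eq_bigr do rewrite indicE.
    rewrite -natr_sum -sum1_card big_mkcond /= [in RHS]big_mkcond /=; congr (_%:R).
    by apply: eq_bigr => i _; rewrite inE; case: (i \in A) => //=; case: (x \in F i).
  by apply: emeasurable_sum => i; apply/measurable_EFinP; exact: measurable_indic.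
by move=> x _; rewrite lee_fin ler_nat.
Qed.

End DoubleCounting.

Lemma mule_EFin_eq (R : realFieldType) (c y : R) (x : \bar R) : 0 < c ->
  (c%:E * x = y%:E)%E -> x = (y / c)%:E.
Proof.
move=> c0; case: x => [x||].
- by rewrite -EFinM => -[<-]; rewrite mulrC mulrA mulVf ?mul1r ?gt_eqF.
- by rewrite gt0_muley ?lte_fin.
- by rewrite gt0_muleNy ?lte_fin.
Qed.

(** * Sym^0 of size m + 1 as the symmetric matrices of size m *)

Section Sym0Structure.
Variables (p : nat) (p_pr : prime p) (m : nat).
Local Notation Zp := (padic_int p_pr).
Local Notation S0 := (sym0 p_pr m.+1).

(** Its kernel is spanned by the all-ones vector, which every matrix of Sym^0 kills; [unbdry_mx] is
    a right inverse. *)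
Definition bdry_mx : 'M[Zp]_(m, 1 + m) := row_mx (const_mx (- 1)) 1%:M.
Definition unbdry_mx : 'M[Zp]_(1 + m, m) := col_mx 0 1%:M.

Lemma bdry_mxK : bdry_mx *m unbdry_mx = 1%:M.
Proof. by rewrite mul_row_col mulmx0 add0r mul1mx. Qed.

Definition minor0 (A : 'M[Zp]_(1 + m)) : 'M[Zp]_m := unbdry_mx^T *m A *m unbdry_mx.
Definition extend0 (M : 'M[Zp]_m) : 'M[Zp]_(1 + m) := bdry_mx^T *m M *m bdry_mx.

Lemma extend0K M : minor0 (extend0 M) = M.
Proof.
rewrite /minor0 /extend0 !mulmxA -trmx_mul bdry_mxK trmx1 mul1mx -mulmxA bdry_mxK.
by rewrite mulmx1.
Qed.

Lemma minor0_sym (A : S0) : (minor0 A)^T = minor0 A.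
Proof.
have /sym0_predP[sA _ _] := valP A.
by rewrite /minor0 !trmx_mul trmxK sA mulmxA.
Qed.

Lemma minor0K (A : S0) : extend0 (minor0 A) = A.
Proof.
have /sym0_predP[sA rA _] := valP A; rewrite /= in sA rA.
have AE : (A : 'M[Zp]_(1 + m)) *m (unbdry_mx *m bdry_mx) = A.
  (* The correction term has all its columns in the span of the all-ones vector, hence is killed by
     [A]. *)
  have -> : unbdry_mx *m bdry_mx = 1%:M - const_mx 1 *m row_mx (1%:M : 'M[Zp]_1) 0.
    rewrite -[const_mx 1](@col_mx_const _ 1 m) !mul_col_row !mul0mx !mul1mx !mulmx0 mulmx1.
    rewrite [1%:M in RHS]scalar_mx_block opp_block_mx add_block_mx !oppr0 !addr0 !add0r.
    congr block_mx; first by apply/matrixP => i j; rewrite !mxE ord1 (ord1 j) eqxx subrr.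
    by rewrite mulmx1; apply/matrixP => i j; rewrite !mxE.
  rewrite mulmxBr mulmx1 mulmxA (_ : A *m const_mx 1 = 0) ?mul0mx ?subr0//.
  by apply/matrixP => i j; rewrite !mxE -[RHS](rA i); apply: eq_bigr => k _; rewrite mxE mulr1.
transitivity ((unbdry_mx *m bdry_mx)^T *m ((A : 'M[Zp]_(1 + m)) *m (unbdry_mx *m bdry_mx))).
  by rewrite /extend0 /minor0 trmx_mul !mulmxA.
by rewrite AE -{1}sA -trmx_mul AE sA.
Qed.

Lemma extend0_sym0 M : M^T = M -> extend0 M \in @sym0_pred p p_pr m.+1.
Proof.
move=> sM; have C1 : bdry_mx *m (const_mx 1 : 'cV_(1 + m)) = 0.
  rewrite -(vsubmxK (const_mx 1 : 'cV_(1 + m))) mul_row_col mul1mx.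
  by apply/matrixP => i j; rewrite !mxE big_ord1 !mxE mulr1 addNr.
have sE : (extend0 M)^T = extend0 M by rewrite /extend0 !trmx_mul trmxK sM mulmxA.
have r0 i : \sum_j extend0 M i j = 0.
  transitivity ((extend0 M *m (const_mx 1 : 'cV_(1 + m))) i 0).
    by rewrite mxE; apply: eq_bigr => k _; rewrite [X in _ * X]mxE mulr1.
  by rewrite /extend0 -mulmxA C1 mulmx0 mxE.
apply/sym0_predP; split=> // j; rewrite -[RHS](r0 j); apply: eq_bigr => i _.
by rewrite -{1}sE mxE.
Qed.

Definition sym0_of M (sM : M^T = M) : S0 := Sym0 (extend0_sym0 sM).

Lemma minor0D A B : minor0 (A + B) = minor0 A + minor0 B.
Proof. by rewrite /minor0 mulmxDr mulmxDl. Qed.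

Lemma minor0N A : minor0 (- A) = - minor0 A.
Proof. by rewrite /minor0 mulmxN mulNmx. Qed.

Lemma sym0_open (U : set S0) :
  (forall A, U A -> exists k, forall B : S0,
     (forall i j, pdvd k.+1 (sym0_mx B i j - sym0_mx A i j)) -> U B) -> open U.
Proof.
move=> UP; rewrite openE => A /UP[k kU]; rewrite /interior.
have : nbhs (sym0_mx A) [set B : 'M[Zp]_m.+1 | forall i j, B i j k = A i j k]%classic.
  exists (fun i j => [set y : Zp | y k = A i j k]%classic).
    by move=> i j; exists k.
  by move=> B BA i j; exact: BA.
move=> /initial_continuous h.
have {h} : nbhs A [set B : S0 | forall i j, sym0_mx B i j k = A i j k]%classic := h.
apply: filterS => B /= BA; apply: kU => i j.
by rewrite pdvd_residue_eq BA.
Qed.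

Lemma sym0_measurable (U : set S0) :
  (forall A, U A -> exists k, forall B : S0,
     (forall i j, pdvd k.+1 (sym0_mx B i j - sym0_mx A i j)) -> U B) ->
  measurable (U : set (borel_sym0 p_pr m.+1)).
Proof. by move=> UP; apply: sub_sigma_algebra; exact: sym0_open. Qed.

Lemma minor0_pdvd k (A B : 'M[Zp]_(1 + m)) : (forall i j, pdvd k (B i j - A i j)) ->
  forall i j, pdvd k (minor0 B i j - minor0 A i j).
Proof.
move=> BA i j; have -> : minor0 B i j - minor0 A i j = minor0 (B - A) i j.
  by rewrite minor0D minor0N !mxE.
apply: pdvd_mulmxr; apply: pdvd_mulmx => i' j'.
by have := BA i' j'; rewrite [(B - A) _ _]mxE [(- A) _ _]mxE.
Qed.

Lemma haar_translate (R : realType) (mu : probability (borel_sym0 p_pr m.+1) R)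
    (U U' : set S0) (b : S0) : is_haar mu -> measurable (U : set (borel_sym0 p_pr m.+1)) ->
  (forall A : S0, U' A <-> U (A - b)) -> mu U' = mu U.
Proof.
move=> haar mU UU'; rewrite -(haar b _ mU); congr (mu _); apply/seteqP; split=> A /=.
  by move=> /UU' UA; exists (A - b) => //; rewrite addrC subrK.
by move=> [X UX <-]; apply/UU'; rewrite addrC addKr.
Qed.

End Sym0Structure.

Lemma mx_subE (V : zmodType) n1 n2 (A B : 'M[V]_(n1, n2)) i j : (A - B) i j = A i j - B i j.
Proof. by rewrite !mxE. Qed.

Lemma mulrn_EFin (R : realType) (x : \bar R) n : x \is a fin_num ->
  x *+ n = (n%:R%:E * x)%E.
Proof.
case: x => // x _; elim: n => [|n IH]; first by rewrite mulr0n mul0e.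
by rewrite mulrS IH -!EFinM -EFinD -{1}[x]mul1r -mulrDl -mulrS.
Qed.

Lemma root_char_polyN (K : comNzRingType) n (M : 'M[K]_n) t :
  root (char_poly (- M)) t = (\det (M + t%:M) == 0).
Proof.
rewrite /root /char_poly -[X in X == _]/(horner_eval t _) -det_map_mx.
congr (\det _ == _); apply/matrixP => i j; rewrite !mxE /horner_eval.
by rewrite /= /horner_eval hornerD hornerN hornerC hornerMn hornerX opprK addrC.
Qed.

(** * Measure of the singular set and of congruence boxes *)

Section HaarComputations.
Variables (p : nat) (p_pr : prime p) (m : nat) (R : realType).
Local Notation Zp := (padic_int p_pr).
Local Notation S0 := (sym0 p_pr m.+1).
Local Notation B0 := (borel_sym0 p_pr m.+1).
Variable mu : probability B0 R.
Hypothesis haar : is_haar mu.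

Lemma det_pdvd k n (A B : 'M[Zp]_n) : (forall i j, pdvd k (B i j - A i j)) ->
  pdvd k (\det B - \det A).
Proof.
case: k => [|k] BA; first exact: pdvd0.
pose rk := (fun x : Zp => x k).
have rkD : zmod_morphism rk by [].
have rkM : monoid_morphism rk by [].
pose h : {rmorphism Zp -> 'Z_(p ^ k.+1)} :=
  HB.pack rk (GRing.isZmodMorphism.Build _ _ rk rkD) (GRing.isMonoidMorphism.Build _ _ rk rkM).
rewrite pdvd_residue_eq; change (h (\det B) == h (\det A)).
rewrite -!det_map_mx; apply/eqP; congr (\det _); apply/matrixP => i j; rewrite !mxE.
by apply/eqP; have := BA i j; rewrite pdvd_residue_eq.
Qed.

(** Arbitrary factors [L] and [N] let one statement serve both the determinant of [minor0] and the
    minors that detect the rank. *)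
Lemma det_neq0_open n (L : 'M[Zp]_(n, 1 + m)) (N : 'M[Zp]_(1 + m, n)) (A : S0) :
  \det (L *m A *m N) != 0 -> exists k, forall B : S0,
    (forall i j, pdvd k.+1 (sym0_mx B i j - sym0_mx A i j)) -> \det (L *m B *m N) != 0.
Proof.
move=> dA; have [k nk] : exists k, ~~ pdvd k.+1 (\det (L *m A *m N)).
  apply: contrapT => h; move/eqP: dA; apply; apply: pdvd_all_eq0 => -[|k].
    exact: pdvd0.
  by apply/negPn/negP => hk; apply: h; exists k.
exists k => B BA; apply: contraNneq nk => dB.
rewrite -[X in pdvd _ X]opprK pdvdN -[X in pdvd _ X]add0r -dB.
apply: det_pdvd => i j.
have -> : (L *m B *m N) i j - (L *m A *m N) i j =
    (L *m ((B : 'M[Zp]_(1 + m)) - A) *m N) i j.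
  by rewrite mulmxBr mulmxBl mx_subE.
apply: pdvd_mulmxr; apply: pdvd_mulmx => i' j'.
by rewrite mx_subE; exact: BA.
Qed.

Definition singular0 : set B0 := [set A : S0 | \det (minor0 A) = 0]%classic.

Lemma singular0_measurable : measurable singular0.
Proof.
rewrite -[singular0]setCK; apply: measurableC; apply: sym0_measurable => A /= /eqP dA.
have [k kP] := det_neq0_open dA; exists k => B BA.
by apply/eqP; exact: kP.
Qed.

(* The translates of the singular set by scalars have equal measure and multiplicity at most [m]. *)
Lemma singular0_null : mu singular0 = 0%E.
Proof.
have sI (t : nat) : ((t%:R)%:M : 'M[Zp]_m)^T = (t%:R)%:M by rewrite tr_scalar_mx.
have key N : ((N%:R)%:E * mu singular0 <= (m%:R)%:E)%E.
  pose F (t : 'I_N) : set B0 := [set A : S0 | \det (minor0 A + (t%:R)%:M) = 0]%classic.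
  have FE (t : 'I_N) (A : S0) : F t A <-> singular0 (A - - sym0_of (sI t)).
    rewrite /F /singular0 /= opprK.
    have -> : minor0 (sym0_mx (A + sym0_of (sI t))) = minor0 A + (t%:R)%:M.
      by rewrite minor0D extend0K.
    by [].
  have mF (t : 'I_N) : measurable (F t).
    rewrite -[F t]setCK; apply: measurableC; apply: sym0_measurable => A /= /eqP dA.
    have dA' : \det (minor0 (sym0_mx (A + sym0_of (sI t)))) != 0.
      by rewrite minor0D extend0K.
    have [k kP] := det_neq0_open dA'; exists k => B BA; apply/eqP.
    have := kP (B + sym0_of (sI t)); rewrite -/(minor0 _) minor0D extend0K; apply=> i j.
    by rewrite /= !mxE opprD addrACA subrr addr0; exact: BA.
  have muF (t : 'I_N) : mu (F t) = mu singular0.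
    by apply: (haar_translate haar singular0_measurable (FE t)).
  have -> : ((N%:R)%:E * mu singular0 = \sum_(t in [set: 'I_N]) mu (F t))%E.
    under [RHS]eq_bigr do rewrite muF.
    rewrite sumr_const cardsT card_ord mulrn_EFin//.
    exact: fin_num_measure singular0_measurable.
  apply: sum_measure_le => // A.
  pose q := char_poly (- minor0 (sym0_mx A)).
  (* wrong *)
  set I := [set t in _ | _].
  have szq : size q = m.+1 by rewrite size_char_poly.
  rewrite cardE -ltnS -szq -(size_map (fun t : 'I_N => ((t : nat)%:R : Zp))).
  apply: max_poly_roots; first by rewrite -size_poly_gt0 szq.
    apply/allP => x /mapP[t]; rewrite mem_enum inE => /andP[_ /set_mem At] ->.
    by rewrite root_char_polyN; apply/eqP.
  rewrite map_inj_uniq ?enum_uniq// => s t /(@natr_padic_inj _ p_pr) st.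
  exact: val_inj.
have fin := fin_num_measure mu _ singular0_measurable.
have ge0 : 0 <= fine (mu singular0) by rewrite fine_ge0.
rewrite -(fineK fin) in key *; congr EFin; apply/eqP; rewrite eq_le ge0 andbT leNgt.
apply/negP => gt0; set s := fine _ in key gt0.
have := key (Num.bound (m%:R / s)); rewrite -EFinM lee_fin leNgt => /negP; apply.
rewrite -ltr_pdivrMr//; apply: le_lt_trans (archi_boundP _); rewrite ?ler_norm//.
by rewrite divr_ge0// ltW.
Qed.

Variables (L : 'M[Zp]_m) (uL : L \in unitmx).

Definition lcoord (A : 'M[Zp]_(1 + m)) : 'M[Zp]_m := invmx L *m minor0 A *m (invmx L)^T.

Lemma lcoord_sym (A : S0) : (lcoord A)^T = lcoord A.
Proof. by rewrite /lcoord trmx_mul trmxK trmx_mul minor0_sym mulmxA. Qed.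

Lemma lcoord_pdvd k (A B : 'M[Zp]_(1 + m)) : (forall i j, pdvd k (B i j - A i j)) ->
  forall i j, pdvd k (lcoord B i j - lcoord A i j).
Proof.
move=> BA i j; have -> : lcoord B i j - lcoord A i j =
    (invmx L *m (minor0 B - minor0 A) *m (invmx L)^T) i j.
  by rewrite mulmxBr mulmxBl mx_subE.
apply: pdvd_mulmxr; apply: pdvd_mulmx => i' j'.
by rewrite mx_subE; exact: minor0_pdvd.
Qed.

Lemma conj_sym (W : 'M[Zp]_m) : W^T = W -> (L *m W *m L^T)^T = L *m W *m L^T.
Proof. by move=> sW; rewrite !trmx_mul trmxK sW mulmxA. Qed.

Lemma lcoord_sub (A : S0) W (sW : W^T = W) :
  lcoord (sym0_mx (A - sym0_of (conj_sym sW))) = lcoord A - W.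
Proof.
rewrite /lcoord minor0D minor0N extend0K mulmxBr mulmxBl; congr (_ - _).
by rewrite !mulmxA mulVmx// mul1mx -mulmxA -trmx_mul mulVmx// trmx1 mulmx1.
Qed.

Variable k : 'I_m -> 'I_m -> nat.
Hypothesis kC : forall i j, k i j = k j i.

Definition box (W : 'M[Zp]_m) : set B0 :=
  [set A : S0 | forall i j, pdvd (k i j).+1 (lcoord A i j - W i j)]%classic.

Lemma box_measurable W : measurable (box W).
Proof.
pose K := (\max_(ij : 'I_m * 'I_m) k ij.1 ij.2)%N.
apply: sym0_measurable => A AW; exists K => B BA i j.
have -> : lcoord B i j - W i j = (lcoord B i j - lcoord A i j) + (lcoord A i j - W i j).
  by rewrite addrA subrK.
apply: pdvdD (AW i j); apply: pdvd_le (lcoord_pdvd BA i j).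
by rewrite ltnS (leq_bigmax (i, j)).
Qed.

Lemma box_translate W : W^T = W -> mu (box W) = mu (box 0).
Proof.
move=> sW; apply: (haar_translate (b := sym0_of (conj_sym sW)) haar (box_measurable 0)).
by move=> A; rewrite /box /= (lcoord_sub A sW); split=> AW i j; have := AW i j; rewrite !mxE subr0.
Qed.

Definition box_index : nat := (\prod_(ij : 'I_m * 'I_m | ij.1 <= ij.2) p ^ (k ij.1 ij.2).+1)%N.

Lemma mu_box W : W^T = W -> mu (box W) = (box_index%:R^-1)%:E.
Proof.
move=> sW; rewrite box_translate//.
pose K := (\max_(ij : 'I_m * 'I_m) k ij.1 ij.2)%N.
have pK : (0 < p ^ K.+1)%N by rewrite expn_gt0 prime_gt0.
pose N := (p ^ K.+1).-1; have NE : N.+1 = (p ^ K.+1)%N by rewrite prednK.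
have kN i j : (p ^ (k i j).+1 <= N.+1)%N.
  by rewrite NE leq_exp2l ?prime_gt1// ltnS (leq_bigmax (i, j)).
pose F (ij : 'I_m * 'I_m) : pred 'I_N.+1 :=
  fun x => if (ij.1 <= ij.2)%N then (x < p ^ (k ij.1 ij.2).+1)%N else x == ord0.
pose I := [set x : {ffun 'I_m * 'I_m -> 'I_N.+1} | [forall ij, F ij (x ij)]].
have cI : #|I| = box_index.
  rewrite card_family_prod /box_index [in RHS]big_mkcond; apply: eq_bigr => -[i j] _ /=.
  rewrite /F /=; case: ifP => _; last exact: card1.
  have w_inj : injective (widen_ord (kN i j)).
    by move=> a b /(congr1 val) /= ab; apply: val_inj.
  rewrite -[RHS]card_ord -cardsT -(card_imset _ w_inj).
  apply: eq_card => x; apply/idP/imsetP => [xF|[y _ ->]]; last exact: (ltn_ord y).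
  by exists (Ordinal (xF : (x < p ^ (k i j).+1)%N)) => //; apply: val_inj.
pose W_ (x : {ffun 'I_m * 'I_m -> 'I_N.+1}) : 'M[Zp]_m :=
  \matrix_(i, j) (x (if (i <= j)%N then (i, j) else (j, i)) : nat)%:R.
have WE x i j : W_ x i j = (x (if (i <= j)%N then (i, j) else (j, i)) : nat)%:R.
  by rewrite mxE.
have sW_ x : (W_ x)^T = W_ x.
  apply/matrixP => i j; rewrite !mxE.
  by case: (ltngtP i j) => // /val_inj ->.
have cnt (A : B0) : #|[set x in I | A \in box (W_ x)]| = ((A \in [set: B0]%classic) * 1)%N.
  rewrite in_setT mul1n.
  pose xA : {ffun 'I_m * 'I_m -> 'I_N.+1} := [ffun ij : 'I_m * 'I_m =>
    if (ij.1 <= ij.2)%N then inord (lcoord A ij.1 ij.2 (k ij.1 ij.2)) else ord0].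
  have inordE i j : (inord (lcoord A i j (k i j)) : 'I_N.+1) = lcoord A i j (k i j) :> nat.
    by rewrite inordK// (leq_trans (residue_lt _ _)).
  have nat_res (a : Zp) l : pdvd l.+1 (a - ((a l : nat)%:R : Zp)).
    by rewrite pdvd_residue_eq residue_nat; apply/eqP/esym/modZ_natr.
  rewrite (_ : [set x in I | _] = [set xA]) ?cards1//; apply/setP => x; rewrite !inE.
  apply/andP/eqP => [[/forallP xF /set_mem xA']|->].
    apply/ffunP => -[i j]; rewrite ffunE /=; have := xF (i, j); rewrite /F /=.
    have [ij xlt|_ /eqP //] := boolP (i <= j)%N; apply: val_inj; rewrite /= inordE.
    have := xA' i j; rewrite WE ij => dv.
    have dv' : pdvd (k i j).+1 ((x (i, j) : nat)%:R - (lcoord A i j (k i j) : nat)%:R : Zp).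
      have -> : (x (i, j) : nat)%:R - (lcoord A i j (k i j) : nat)%:R =
        (lcoord A i j - (lcoord A i j (k i j) : nat)%:R) - (lcoord A i j - (x (i, j) : nat)%:R)
        :> Zp by ring.
      by rewrite pdvdB.
    by have := pdvd_nat_mod dv'; rewrite !modn_small// residue_lt.
  split.
    apply/forallP => -[i j]; rewrite ffunE /F /=; have [_|//] := boolP (i <= j)%N.
    by rewrite inordE residue_lt.
  apply/mem_set => i j; rewrite WE; case: ifP => ij; rewrite ffunE /=.
    by rewrite ij inordE nat_res.
  have ji : (j <= i)%N by rewrite ltnW// ltnNge ij.
  rewrite ji inordE kC; have -> : lcoord A i j = lcoord A j i by rewrite -{1}lcoord_sym mxE.
  exact: nat_res.
have := sum_measure_count mu (fun x => box_measurable _) (measurableT : measurable [set: B0]%classic) cnt.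
rewrite (eq_bigr (fun=> mu (box 0))); last by move=> x _; rewrite box_translate.
rewrite mul1e [mu [set: B0]%classic]probability_setT sumr_const cI mulrn_EFin; last first.
  exact: fin_num_measure (box_measurable 0).
move=> /mule_EFin_eq -> //; first by rewrite div1r.
by rewrite ltr0n -cI cI prodn_gt0// => ij; rewrite expn_gt0 prime_gt0.
Qed.

End HaarComputations.

Section PairSums.
Variable m : nat.

Lemma sum_pairs_le (f : 'I_m -> nat) :
  (\sum_(ij : 'I_m * 'I_m | ij.1 <= ij.2) (f ij.1 + f ij.2) = m.+1 * \sum_i f i)%N.
Proof.
rewrite big_split /= addnC.
have -> : (\sum_(ij : 'I_m * 'I_m | ij.1 <= ij.2) f ij.2 =
    \sum_(i < m) \sum_(j < m | j <= i) f i)%N.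
  rewrite -(pair_big_dep xpredT (fun i j : 'I_m => (i <= j)%N) (fun i j => f j)) /=.
  by rewrite (exchange_big_dep xpredT).
have -> : (\sum_(ij : 'I_m * 'I_m | ij.1 <= ij.2) f ij.1 =
    \sum_(i < m) \sum_(j < m | i <= j) f i)%N.
  by rewrite -(pair_big_dep xpredT (fun i j : 'I_m => (i <= j)%N) (fun i j => f i)).
rewrite -big_split big_distrr /=; apply: eq_bigr => i _.
rewrite big_mkcond [X in (_ + X)%N]big_mkcond -big_split /=.
transitivity (\sum_(j < m) (f i + if j == i then f i else 0))%N.
  by apply: eq_bigr => j _; rewrite -val_eqE /=; case: ltngtP; rewrite ?addn0 ?add0n.
by rewrite big_split /= sum_nat_const card_ord -big_mkcond big_pred1_eq mulSn addnC.
Qed.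

Lemma card_sym_pairs (F : finFieldType) :
  #|sym_set F m| = (#|F| ^ (\sum_(ij : 'I_m * 'I_m | ij.1 <= ij.2) 1))%N.
Proof.
have sq : (#|sym_set F m| ^ 2 = #|F| ^ (m.+1 * m))%N.
  elim: m => [|n IH].
    rewrite muln0 expn0 (_ : sym_set F 0 = [set: 'M[F]_0]) ?cardsT ?card_mx ?mul0n//.
    by apply/setP => T; rewrite !inE; apply/eqP/matrixP => -[].
  by rewrite card_symS expnMn IH -expnM -expnD; congr (_ ^ _)%N; rewrite muln2; lia.
apply/eqP; rewrite -(@eqn_exp2r _ _ 2)// sq -expnM muln2 -addnn.
have := sum_pairs_le (fun=> 1%N); rewrite big_split /= => ->.
by rewrite sum_nat_const card_ord muln1.
Qed.

Lemma box_index_sum (p : nat) (p_pr : prime p) (f : 'I_m -> nat) :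
  box_index p (fun i j => (f i + f j)%N) =
  (#|sym_set 'F_p m| * (p ^ (\sum_i f i)) ^ m.+1)%N.
Proof.
rewrite card_sym_pairs (card_Fp p_pr) /box_index.
rewrite -(expn_sum p) -expnM -expnD; congr (_ ^ _)%N.
rewrite mulnC -sum_pairs_le -big_split; apply: eq_bigr => ij _ /=.
by rewrite add1n.
Qed.

Lemma nonincreasing_support (f : 'I_m -> nat) :
  (forall i j : 'I_m, (i <= j)%N -> (f j <= f i)%N) ->
  forall i, (f i == 0)%N = (#|[set j | (0 < f j)%N]| <= i)%N.
Proof.
move=> fm i; have cle (k : nat) : (k <= m)%N -> #|[set j : 'I_m | (j < k)%N]| = k.
  move=> km; have w_inj : injective (widen_ord km).
    by move=> a b /(congr1 val) /= ab; apply: val_inj.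
  rewrite -[RHS]card_ord -cardsT -(card_imset _ w_inj); apply: eq_card => x.
  rewrite inE; apply/idP/imsetP => [xk|[y _ ->]]; last exact: (ltn_ord y).
  by exists (Ordinal xk) => //; apply: val_inj.
have [fi|fi] := posnP (f i).
  apply/esym; rewrite -[X in (_ <= X)%N](cle i (ltnW (ltn_ord i))); apply: subset_leq_card.
  apply/fintype.subsetP => j; rewrite !inE; apply: contraTT.
  by rewrite -leqNgt => /fm; rewrite fi -leqNgt.
apply/esym/negbTE; rewrite -ltnNge -(cle i.+1)//; apply: subset_leq_card.
by apply/fintype.subsetP => j; rewrite !inE ltnS => /fm; apply: leq_trans.
Qed.

End PairSums.

Section PresentsMeasure.
Variables (p : nat) (p_pr : prime p) (G : finZmodType) (delta : G -> G -> QmodZ).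
Variable e : nat.
Hypothesis expG : forall x : G, x *+ (p ^ e) = 0.
Hypothesis deltaC : forall x y, delta x y = delta y x.
Hypothesis deltaD : forall x, {morph delta x : y z / y + z}.
Hypothesis delta_inj : forall x, (forall y, delta x y = 0) -> x = 0.
Local Notation Zp := (padic_int p_pr).
Variables (m : nat) (R : realType).
Local Notation S0 := (sym0 p_pr m.+1).
Local Notation B0 := (borel_sym0 p_pr m.+1).
Variable mu : probability B0 R.
Hypothesis haar : is_haar mu.

Local Notation generates := (@generates p p_pr G e m).
Local Notation presents := (@presents p p_pr G delta e m).

Definition presents_set (g : 'I_m -> G) : set B0 :=
  [set A : S0 | presents (minor0 A) g]%classic.

Lemma presents_set_measure g : generates g -> measurable (presents_set g) /\
  [/\ (\dim {: modpG G p_pr} <= m)%N & mu (presents_set g) =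
    (#|sym_unit_set 'F_p (m - \dim {: modpG G p_pr})|%:R /
     #|sym_set 'F_p (m - \dim {: modpG G p_pr})|%:R / (#|G| ^ m.+1)%:R)%:E].
Proof.
move=> gen; have [A0 [L [f [g' [[sA0 uL fm] gen' ker' MP]]]]] :=
  presents_normal_form expG deltaC deltaD delta_inj gen.
have dimE := dim_kernel_pdvd expG gen' ker'.
have cardE := card_kernel_pdvd expG gen' ker'.
set s := \dim _ in dimE *.
have sm : (s <= m)%N by rewrite dimE -[X in (_ <= X)%N]card_ord max_card.
have JE : \matrix_(i, j) ((i == j) && (f i == 0)%N)%:R = diag_from 'F_p m s.
  by apply/matrixP => i j; rewrite !mxE nonincreasing_support// -dimE.
pose k i j := (f i + f j)%N.
have kC i j : k i j = k j i by rewrite /k addnC.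
pose lift (T : 'M['F_p]_m) : 'M[Zp]_m := \matrix_(i, j) (T i j : nat)%:R.
have liftE T i j : red (lift T i j) = T i j by rewrite mxE red_nat_of.
have lift_sym T : T^T = T -> (lift T)^T = lift T.
  by move=> sT; apply/matrixP => i j; rewrite !mxE -{1}sT mxE.
clearbody lift.
pose S := lcoord L (extend0 A0).
have SE : S = invmx L *m A0 *m (invmx L)^T by rewrite /S /lcoord extend0K.
have sS : S^T = S by rewrite SE !trmx_mul trmxK sA0 mulmxA.
clearbody S.
pose W T := S + pdiag p_pr f *m lift T *m pdiag p_pr f.
have DE (X : 'M[Zp]_m) i j :
    (pdiag p_pr f *m X *m pdiag p_pr f) i j = p%:R ^+ k i j * X i j.
  by rewrite mul_mx_diag mul_diag_mx !mxE /k exprD mulrAC.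
have sW T : T^T = T -> (W T)^T = W T.
  move=> /lift_sym sT; rewrite /W linearD /= sS !trmx_mul tr_diag_mx sT mulmxA //.
have WE T i j : W T i j = S i j + p%:R ^+ k i j * lift T i j by rewrite mxE DE.
have LLi : L *m invmx L = 1%:M by rewrite mulmxV.
have coordE (A : S0) : minor0 A = L *m lcoord L A *m L^T.
  rewrite /lcoord !mulmxA LLi mul1mx -mulmxA -trmx_mul LLi trmx1 mulmx1 //.
have presE (A : S0) : presents_set g A <-> exists T : 'M[Zp]_m, [/\ T^T = T,
    forall i j, lcoord L A i j = S i j + p%:R ^+ k i j * T i j
    & map_mx (@red p p_pr) T \in sym_shift_set 'F_p m s].
  rewrite /presents_set /= MP ?minor0_sym// JE; split=> -[T [sT AE uT]]; exists T; split=> //.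
  - have -> : lcoord L A = S + pdiag p_pr f *m T *m pdiag p_pr f.
      rewrite /lcoord AE SE mulmxDr mulmxDl; congr (_ + _).
      rewrite !mulmxA mulVmx// mul1mx -[_ *m L^T *m _]mulmxA -trmx_mul mulVmx//.
      by rewrite trmx1 mulmx1.
    by move=> i j; rewrite mxE DE.
  - by rewrite !inE map_trmx sT eqxx.
  - have {}AE : lcoord L A = S + pdiag p_pr f *m T *m pdiag p_pr f.
      by apply/matrixP => i j; rewrite AE mxE DE.
    rewrite coordE AE SE mulmxDr mulmxDl !mulmxA LLi mul1mx; congr (_ + _).
    by rewrite -mulmxA -trmx_mul LLi trmx1 mulmx1.
  - by move: uT; rewrite inE => /andP[].
have boxP T (A : S0) : T \in sym_shift_set 'F_p m s -> box L k (W T) A ->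
    exists Z : 'M[Zp]_m, [/\ Z^T = Z,
      forall i j, lcoord L A i j = S i j + p%:R ^+ k i j * Z i j
      & map_mx (@red p p_pr) Z = T].
  rewrite 2!inE => /andP[/eqP sT _] AT.
  have /choice[z zP] (ij : 'I_m * 'I_m) : exists z,
      lcoord L A ij.1 ij.2 - W T ij.1 ij.2 = p%:R ^+ (k ij.1 ij.2).+1 * z.
    by apply/pdvdP; exact: AT.
  pose Z : 'M[Zp]_m := \matrix_(i, j) (lift T i j + p%:R * z (i, j)).
  have ZE i j : lcoord L A i j = S i j + p%:R ^+ k i j * Z i j.
    rewrite [Z i j]mxE mulrDr addrA -WE mulrA -exprSr -(zP (i, j)) /=.
    by rewrite addrC subrK.
  exists Z; split=> //; last first.
    apply/matrixP => i j; rewrite !mxE rmorphD rmorphM /= liftE.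
    have -> : red (p%:R : Zp) = 0 by apply/eqP; rewrite red_eq0 -[p%:R]expr1 pdvd_pX.
    by rewrite mul0r addr0.
  apply/matrixP => i j; rewrite [LHS]mxE; apply: (@mulpXI _ p_pr (k i j)).
  apply: (addrI (S i j)); rewrite -ZE -{1}sS mxE kC -ZE.
  by rewrite -{1}[lcoord L A]lcoord_sym mxE.
have presB (A : S0) : presents_set g A <->
    exists2 T, T \in sym_shift_set 'F_p m s & box L k (W T) A.
  rewrite presE; split=> [[T [sT AE rT]]|[T TS /(boxP _ _ TS)[Z [sZ ZE rZ]]]]; last first.
    by exists Z; split=> //; rewrite rZ.
  exists (map_mx (@red p p_pr) T) => // i j; rewrite AE WE opprD addrACA subrr add0r.
  rewrite -mulrBr -addn1 pdvdM2l -red_eq0 rmorphB /= liftE mxE subrr //.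
have mP : measurable (presents_set g).
  have -> : presents_set g =
      (\bigcup_(T in [set` sym_shift_set 'F_p m s]) box L k (W T))%classic.
    by apply/seteqP; split=> A; [move=> /presB[T TS AT]; exists T|
      move=> [T TS AT]; apply/presB; exists T].
  apply: fin_bigcup_measurable => [|T _]; first exact: finite_finset.
  exact: box_measurable.
split=> //; split=> //.
have := @sum_measure_count _ _ _ mu _ (sym_shift_set 'F_p m s) (fun T => box L k (W T))
  (fun T => box_measurable L k (W T)) (presents_set g) 1 mP.
rewrite mul1e (eq_bigr (fun=> ((box_index p k)%:R^-1)%:E)); last first.
  by move=> T; rewrite 2!inE => /andP[/eqP sT _]; rewrite mu_box// sW.
move=> <-; last first.
  move=> A; rewrite muln1; have [|nA] := boolP (A \in _).
    move=> /set_mem/presB[T TS AT].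
    rewrite (_ : [set _ in _ | _] = [set T]) ?cards1//; apply/setP => T'; rewrite !inE.
    apply/andP/eqP => [[T'S /set_mem AT']|->]; last first.
      by split; [move: TS; rewrite !inE|apply/mem_set].
    have T'S' : T' \in sym_shift_set 'F_p m s by rewrite !inE.
    have [Z [sZ ZE <-]] := boxP _ _ TS AT; have [Z' [sZ' ZE' <-]] := boxP _ _ T'S' AT'.
    congr map_mx; apply/matrixP => i j; apply: (@mulpXI _ p_pr (k i j)).
    by apply: (addrI (S i j)); rewrite -ZE -ZE'.
  apply/eqP; rewrite cards_eq0; apply/eqP/setP => T; rewrite [RHS]inE [LHS]inE.
  apply/negP => /andP[TS /set_mem AT]; move/negP: nA; apply; apply/mem_set/presB.
  by exists T.
rewrite sumr_const mulrn_EFin// -EFinM; congr EFin.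
rewrite /k box_index_sum// -cardE natrM invfM mulrA; congr (_ * _).
by rewrite card_sym_shift_ratio.
Qed.

End PresentsMeasure.

(** * Strata of constant rank *)

Section Strata.
Variables (p : nat) (p_pr : prime p).
Local Notation Zp := (padic_int p_pr).

Lemma det_mul_short s (K : comNzRingType) (X : 'M[K]_(1 + s, s)) (Y : 'M[K]_(s, 1 + s)) :
  \det (X *m Y) = 0.
Proof.
have -> : X *m Y = row_mx (0 : 'M[K]_(1 + s, 1)) X *m col_mx (0 : 'M[K]_(1, 1 + s)) Y.
  by rewrite mul_row_col mul0mx add0r.
rewrite det_mulmx (expand_det_col _ (lshift s 0)) big1 ?mul0r// => i _.
by rewrite row_mxEl mxE mul0r.
Qed.

Lemma sym_split n (A : 'M[Zp]_n) : A^T = A ->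
  exists (s : nat) (M : 'M[Zp]_s) (C : 'M[Zp]_(s, n)) (C' : 'M[Zp]_(n, s)),
  [/\ C *m C' = 1%:M, M^T = M, A = C^T *m M *m C & \det M != 0].
Proof.
move=> sA; have [U [V [c [uU uV AE _]]]] := smith_form A.
pose I := [set i | c i != 0].
pose ev (a : 'I_#|I|) : 'I_n := enum_val a.
have ev_eq a b : (ev a == ev b) = (a == b) by rewrite (inj_eq enum_val_inj).
pose C : 'M[Zp]_(#|I|, n) := \matrix_(a, j) V (ev a) j.
pose C' : 'M[Zp]_(n, #|I|) := \matrix_(i, a) invmx V i (ev a).
pose B : 'M[Zp]_(n, #|I|) := \matrix_(i, a) (U i (ev a) * c (ev a)).
have CC' : C *m C' = 1%:M.
  apply/matrixP => a b; rewrite !mxE -ev_eq; have := mulmxV uV.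
  move=> /matrixP/(_ (ev a) (ev b)); rewrite !mxE => <-.
  by apply: eq_bigr => j _; rewrite !mxE.
have BC : A = B *m C.
  rewrite AE; apply/matrixP => i j; rewrite [LHS]mxE [RHS]mxE.
  transitivity (\sum_k U i k * c k * V k j).
    apply: eq_bigr => k _; rewrite mxE (bigD1 k)//= big1 ?addr0.
      by rewrite mxE eqxx mul1r.
    by move=> l /negPf lk; rewrite mxE lk mul0r mulr0.
  rewrite (bigID (mem I)) /= [X in _ + X]big1 ?addr0; last first.
    by move=> k; rewrite inE negbK => /eqP ->; rewrite mulr0 mul0r.
  by rewrite big_enum_val; apply: eq_bigr => a _; rewrite !mxE.
have AC'C : A *m C' *m C = A by rewrite {1}BC -[B *m C *m C']mulmxA CC' mulmx1 -BC.
have CC'A : C^T *m (C'^T *m A) = A.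
  by have := congr1 trmx AC'C; rewrite !trmx_mul sA.
exists #|I|, (C'^T *m A *m C'), C, C'; split=> //.
- by rewrite !trmx_mul trmxK sA mulmxA.
- by rewrite [C^T *m _]mulmxA -mulmxA CC'A mulmxA AC'C.
pose Ui : 'M[Zp]_(#|I|, n) := \matrix_(a, i) invmx U (ev a) i.
have : (Ui *m C^T) *m (C'^T *m A *m C') = diag_mx (\row_a c (ev a)).
  rewrite -mulmxA [C^T *m _]mulmxA CC'A BC -[B *m C *m C']mulmxA CC' mulmx1.
  apply/matrixP => a b; rewrite !mxE.
  have := mulVmx uU => /matrixP/(_ (ev a) (ev b)); rewrite !mxE ev_eq => UU.
  transitivity ((\sum_j invmx U (ev a) j * U j (ev b)) * c (ev b)).
    by rewrite mulr_suml; apply: eq_bigr => j _; rewrite !mxE mulrA.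
  by rewrite UU mulr_natl; case: eqP => [->|]; rewrite ?mulr1n ?mulr0n.
move=> /(congr1 determinant); rewrite det_mulmx det_diag => dE.
have : \prod_a (\row_a c (ev a)) 0 a != 0.
  by apply/prodf_neq0 => a _; rewrite mxE; have := enum_valP a; rewrite inE.
by rewrite -dE mulf_eq0 => /norP[].
Qed.

Definition vanishing_minors n s (A : 'M[Zp]_n) :=
  forall (L : 'M[Zp]_(1 + s, n)) (N : 'M[Zp]_(n, 1 + s)), \det (L *m A *m N) = 0.

Lemma scaled_inv_det s (a Y : 'M[Zp]_s) k : a *m Y = (p%:R ^+ k)%:M -> \det a != 0.
Proof.
move=> /(congr1 determinant); rewrite det_mulmx det_scalar => dE.
by apply: contra_eq_neq dE => ->; rewrite mul0r eq_sym expf_neq0// pX_neq0.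
Qed.

Lemma det0_schur (K : idomainType) s (c x : K) (u : 'rV[K]_s) (v : 'cV[K]_s) (a Y : 'M[K]_s) :
  a *m Y = c%:M -> \det a != 0 -> \det (block_mx x%:M u v a) = 0 ->
  c * x = (u *m Y *m v) 0 0.
Proof.
move=> aY da d0; pose w := - (Y *m v).
have aw : v *m c%:M + a *m w = 0.
  by rewrite /w mulmxN mulmxA aY mul_scalar_mx mul_mx_scalar subrr.
have : \det (block_mx x%:M u v a *m block_mx c%:M 0 w 1%:M) = 0.
  by rewrite det_mulmx d0 mul0r.
rewrite mulmx_block aw !mulmx0 !mulmx1 !add0r det_ublock => /eqP.
rewrite mulf_eq0 (negPf da) orbF det_mx11 mxE -scalar_mxM [_%:M 0 0]mxE eqxx mulr1n.
have -> : (u *m w) 0 0 = - (u *m Y *m v) 0 0 by rewrite /w mulmxN mulmxA mxE.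
by rewrite subr_eq0 mulrC => /eqP.
Qed.

Lemma vanishing_minors_factor n s k (A : 'M[Zp]_n) (C : 'M[Zp]_(n, s)) (Y : 'M[Zp]_s) :
  (C^T *m A *m C) *m Y = (p%:R ^+ k)%:M -> vanishing_minors s A ->
  p%:R ^+ k *: A = (A *m C *m Y) *m (C^T *m A).
Proof.
move=> aY van; have da := scaled_inv_det aY; set a := C^T *m A *m C in aY da.
apply/matrixP => i j; rewrite [LHS]mxE.
pose u := row i A *m C; pose v := C^T *m col j A.
have d0 := van (col_mx (delta_mx 0 i) C^T) (row_mx (delta_mx j 0) C).
have bE : col_mx (delta_mx 0 i) C^T *m A *m row_mx (delta_mx j 0) C =
    block_mx (A i j)%:M u v a.
  rewrite mul_col_mx mul_col_row -rowE -!colE /u /v /a; congr block_mx.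
    by apply/matrixP => i' j'; rewrite !mxE !ord1 eqxx mulr1n.
  by rewrite !colE mulmxA.
rewrite (det0_schur aY da (etrans (esym (congr1 determinant bE)) d0)).
transitivity ((row i (A *m C *m Y) *m col j (C^T *m A)) 0 0).
  have -> : col j (C^T *m A) = v by rewrite /v !colE mulmxA.
  by rewrite !row_mul.
by rewrite [LHS]mxE [RHS]mxE; apply: eq_bigr => l _; rewrite [row _ _ _ _]mxE [col _ _ _ _]mxE.
Qed.

Variables (G : finZmodType) (delta : G -> G -> QmodZ) (e : nat).
Hypothesis expG : forall x : G, x *+ (p ^ e) = 0.
Hypothesis deltaC : forall x y, delta x y = delta y x.
Hypothesis deltaD : forall x, {morph delta x : y z / y + z}.
Hypothesis delta_inj : forall x, (forall y, delta x y = 0) -> x = 0.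

(* Within a fixed rank, a small perturbation of [A = C^T M C] is again of the form
   [C1^T M1 C1] with [M1] close to [M]. *)
Lemma coker_map_stratum n (A : 'M[Zp]_n) : A^T = A ->
  (exists phi, coker_map A delta phi) ->
  exists s, vanishing_minors s A /\
    forall A' : 'M[Zp]_n, A'^T = A' ->
      (forall i j, pdvd (e + e).+1 (A' i j - A i j)) ->
      vanishing_minors s A' -> exists phi, coker_map A' delta phi.
Proof.
move=> sA phiA; have [s [M [C [C' [CC' sM AE dM]]]]] := sym_split sA.
have CC't : C'^T *m C^T = 1%:M by rewrite -trmx_mul CC' trmx1.
exists s; split=> [L N|A' sA' A'A van].
  have -> : L *m A *m N = (L *m C^T *m M) *m (C *m N) by rewrite AE !mulmxA.
  exact: det_mul_short.
have [phi phiM] : exists phi, coker_map M delta phi.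
  by apply/(coker_map_congr M delta CC'); rewrite -AE.
have [gen [Y [MY YE]]] := coker_map_presents expG deltaC
  (fun x => nonsing_in_lattice x dM) phiM.
set g := (fun i => _) in gen YE.
have [D DE] : exists D, A' - A = p%:R ^+ (e + e).+1 *: D.
  by apply: pdvd_matrix => i j; rewrite mx_subE.
have {}DE : A' = A + p%:R ^+ (e + e).+1 *: D by rewrite -DE addrC subrK.
have pMY (X : 'M[Zp]_(s, s)) : p%:R ^+ (e + e).+1 *: X = M *m (p%:R ^+ e.+1 *: (Y *m X)).
  by rewrite -scalemxAr mulmxA MY mul_scalar_mx scalerA -exprD addSn.
have pMY' (X : 'M[Zp]_(s, n)) : p%:R ^+ (e + e).+1 *: X = M *m (p%:R ^+ e.+1 *: (Y *m X)).
  by rewrite -scalemxAr mulmxA MY mul_scalar_mx scalerA -exprD addSn.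
pose a := C'^T *m A' *m C'.
have aC : a = C'^T *m A' *m C' by [].
clearbody a.
have sa : a^T = a by rewrite aC !trmx_mul trmxK sA' mulmxA.
have C'A : C'^T *m A = M *m C by rewrite AE !mulmxA CC't mul1mx.
pose W := 1%:M + p%:R ^+ e.+1 *: (Y *m (C'^T *m D *m C')).
have aE : a = M *m W.
  rewrite aC DE mulmxDr mulmxDl C'A -mulmxA CC' mulmx1 -scalemxAr -scalemxAl pMY.
  by rewrite /W mulmxDr mulmx1.
have Wdv i j : pdvd e.+1 ((W - 1%:M) i j).
  by rewrite /W addrC addKr mxE pdvdMr// pdvd_pX.
have uW : W \in unitmx.
  rewrite unitmx_red (_ : map_mx _ W = 1%:M) ?unitmx1//.
  rewrite -[W](subrK 1%:M) map_mxD map_mx1 (_ : map_mx _ _ = 0) ?add0r//.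
  apply/matrixP => i j; rewrite [LHS]mxE [RHS]mxE; apply/eqP; rewrite red_eq0.
  by apply: pdvd_le (Wdv i j).
pose Y' := invmx W *m Y.
have aY' : a *m Y' = (p%:R ^+ e)%:M by rewrite aE mulmxA mulmxK.
have Y'Y : Y' - Y = - (invmx W *m ((W - 1%:M) *m Y)).
  by rewrite mulmxBl mul1mx mulmxBr mulKmx// opprB.
clearbody Y'.
have [sY' Y'a] := scaled_inv_sym sa aY'.
have pres : presents delta e a g.
  exists Y'; split=> // i j; rewrite -YE; apply/ptors_eq; rewrite -mx_subE.
  rewrite Y'Y mxE pdvdN; apply: pdvd_mulmx => k l; apply: pdvd_mulmxr => k' l'.
  by apply: pdvd_le (Wdv k' l').
pose Z := C + p%:R ^+ e.+1 *: (Y *m (C'^T *m D)).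
have C'A' : C'^T *m A' = M *m Z.
  by rewrite DE mulmxDr C'A -scalemxAr pMY' -mulmxDr.
pose C1 := invmx W *m Z.
have aC1 : a *m C1 = C'^T *m A' by rewrite aE mulmxA mulmxK// C'A'.
have C1C' : C1 *m C' = 1%:M.
  apply: (@scalepXI _ p_pr e); rewrite scalemx1 -Y'a.
  by rewrite [in RHS]aC -aC1 -mulmxA mulmxA Y'a mul_scalar_mx.
have A'E : A' = C1^T *m a *m C1.
  apply: (@scalepXI _ p_pr e).
  have A'C' : A' *m C' = C1^T *m a.
    by have := congr1 trmx aC1; rewrite !trmx_mul trmxK sA' sa.
  rewrite (@vanishing_minors_factor _ s e A' C' Y') -?aC// A'C' -aC1.
  by rewrite -[C1^T *m a *m Y']mulmxA aY' mul_mx_scalar -scalemxAl mulmxA.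
have phia : exists phi, coker_map a delta phi.
  by exists (gmap e g); exact: presents_coker_map.
by rewrite A'E; apply/(coker_map_congr a delta C1C').
Qed.

End Strata.

(** * The probability of a given finite cokernel *)

Section Event.
Variables (p : nat) (p_pr : prime p) (G : finZmodType) (delta : G -> G -> QmodZ).
Hypothesis G_pgroup : (p.-group [set: G]%G)%g.
Hypothesis delta_duality : duality_pairing delta.
Local Notation Zp := (padic_int p_pr).
Local Notation e := (logn p #|G|).

Let cardG : #|G| = (p ^ e)%N.
Proof. by have := card_pgroup G_pgroup; rewrite /= cardsT. Qed.

Let expG (x : G) : x *+ (p ^ e) = 0.
Proof. by rewrite -cardG mulrn_card. Qed.

Let deltaC x y : delta x y = delta y x.
Proof. by case: delta_duality. Qed.

Let deltaD x : {morph delta x : y z / y + z}.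
Proof. by case: delta_duality => _ dD _; exact: dD. Qed.

Let delta_inj x : (forall y, delta x y = 0) -> x = 0.
Proof.
move=> x0; have [_ _ /(_ (fun=> 0))[|u [_ uniq]]] := delta_duality.
  by move=> y z; rewrite addr0.
by rewrite -(uniq x x0); apply: uniq => y; rewrite deltaC delta0.
Qed.

Section FixedSize.
Variables (m : nat) (R : realType).
Local Notation S0 := (sym0 p_pr m.+1).
Local Notation B0 := (borel_sym0 p_pr m.+1).
Variable mu : probability B0 R.
Hypothesis haar : is_haar mu.

Definition isom_event : set B0 := [set A : S0 | fin_coker_isom A delta]%classic.

Lemma isom_eventP (A : S0) : isom_event A <-> exists phi, coker_map A delta phi.
Proof. by apply: fin_coker_isomP; case/sym0_predP: (valP A). Qed.

Lemma isom_event_measurable : measurable isom_event.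
Proof.
pose V s : set B0 := [set A : S0 | vanishing_minors s (sym0_mx A)]%classic.
pose O s : set B0 := [set A : S0 | exists k, forall B : S0,
  (forall i j, pdvd k.+1 (sym0_mx B i j - sym0_mx A i j)) -> V s B -> isom_event B]%classic.
have -> : isom_event = (\bigcup_s (O s `&` V s))%classic.
  apply/seteqP; split=> A.
    move=> /isom_eventP phiA; have /sym0_predP[sA _ _] := valP A.
    have [s [vA sP]] := coker_map_stratum expG deltaC deltaD delta_inj sA phiA.
    exists s => //; split=> //; exists (e + e)%N => B BA vB.
    by apply/isom_eventP; apply: sP => //; have /sym0_predP[] := valP B.
  move=> [s _ [[k kP] vA]]; apply: kP => // i j.
  by rewrite subrr pdvd_0.
apply: bigcupT_measurable => s; apply: measurableI.
  apply: sym0_measurable => A [k kP]; exists k => B BA; exists k => B' B'B.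
  apply: kP => i j; have -> : sym0_mx B' i j - sym0_mx A i j =
    (sym0_mx B' i j - sym0_mx B i j) + (sym0_mx B i j - sym0_mx A i j).
    by rewrite addrA subrK.
  by rewrite pdvdD.
rewrite -[V s]setCK; apply: measurableC; apply: sym0_measurable => A nV.
have [L [N dLN]] : exists (L : 'M[Zp]_(1 + s, 1 + m)) (N : 'M[Zp]_(1 + m, 1 + s)),
    \det (L *m sym0_mx A *m N) != 0.
  apply: contrapT => h; apply: nV => L N; apply/eqP/negPn/negP => dLN.
  by apply: h; exists L, N.
have [k kP] := det_neq0_open dLN; exists k => B /kP dB vB.
by move/eqP: dB; apply; exact: vB.
Qed.

Lemma isom_event_nonsing (A : S0) : \det (minor0 A) != 0 ->
  isom_event A <-> exists g : {ffun 'I_m -> G},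
    generates p_pr e g /\ presents delta e (minor0 A) g.
Proof.
move=> dA; rewrite isom_eventP -{1}(minor0K A).
have := coker_map_congr (minor0 A) delta (bdry_mxK p_pr m); rewrite -/(extend0 _) => ->.
split=> [[phi phiP]|[g [gen pres]]]; last first.
  exists (gmap e g); apply: presents_coker_map => //; exact: minor0_sym.
have [gen pres] := coker_map_presents expG deltaC (fun x => nonsing_in_lattice x dA) phiP.
exists [ffun i => phi (delta_mx i 0)].
have -> : ([ffun i => phi (delta_mx i 0)] : 'I_m -> G) = fun i => phi (delta_mx i 0).
  by apply/funext => i; rewrite ffunE.
by split.
Qed.

Lemma card_aut_gt0 : (0 < #|aut_pairing delta|)%N.
Proof.
apply/card_gt0P; exists 1%g; rewrite inE group1 /=.
by apply/forallP => x; apply/forallP => y; rewrite !perm1.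
Qed.

Lemma mu_isom_event : mu isom_event =
  (#|[set g : {ffun 'I_m -> G} | `[< generates p_pr e g >]]|%:R *
   (#|sym_unit_set 'F_p (m - \dim {: modpG G p_pr})|%:R /
    #|sym_set 'F_p (m - \dim {: modpG G p_pr})|%:R / (#|G| ^ m.+1)%:R)
   / #|aut_pairing delta|%:R)%:E.
Proof.
set Gen := [set g | _]; set v := (X in (_ * X / _)).
have mE := isom_event_measurable.
pose S := singular0 (p_pr := p_pr) (m := m).
have mS : measurable S by exact: singular0_measurable.
have -> : mu isom_event = mu (isom_event `\` S)%classic.
  have null : mu (isom_event `&` S)%classic = 0%E.
    apply: (subset_measure0 _ mS) (singular0_null haar); first exact: measurableI.
    exact: subIsetr.
  rewrite -(measureU0 (measurableD mE mS) (measurableI _ _ mE mS) null).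
  congr (mu _); apply/seteqP; split=> [A EA|A [[]|[]]//].
  by have [SA|nSA] := pselect (S A); [right|left].
pose F (g : {ffun 'I_m -> G}) : set B0 :=
  if g \in Gen then presents_set (p_pr := p_pr) delta e g else set0.
have genP g : g \in Gen -> generates p_pr e g by rewrite inE => /asboolP.
have presM g (gG : g \in Gen) := presents_set_measure expG deltaC deltaD delta_inj haar (genP g gG).
have mF g : measurable (F g).
  by rewrite /F; case: ifP => [/presM[]//|_]; exact: measurable0.
have := @sum_measure_count _ _ _ mu _ Gen F mF (isom_event `\` S)%classic
  #|aut_pairing delta| (measurableD mE mS).
rewrite (eq_bigr (fun=> v%:E)); last first.
  by move=> g gG; rewrite /F gG; have [_ [_ ->]] := presM g gG.
rewrite sumr_const mulrn_EFin// -EFinM => H.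
apply: mule_EFin_eq; first by rewrite ltr0n card_aut_gt0.
apply/esym; apply: H => A; have [|nA] := boolP (A \in _).
  move=> /set_mem[EA /eqP dA]; rewrite mul1n.
  have /(isom_event_nonsing dA)[g0 [gen0 pres0]] := EA.
  rewrite -(card_presents expG deltaC deltaD delta_inj (minor0_sym A) gen0 pres0).
  apply: eq_card => g; rewrite !inE /F; case: asboolP => //= gen.
  have -> : g \in Gen by rewrite inE; apply/asboolP.
  by apply/idP/asboolP => [/set_mem|h]; last exact/mem_set.
rewrite mul0n; apply/eqP; rewrite cards_eq0; apply/eqP/setP => g; rewrite [RHS]inE [LHS]inE.
apply/negP => /andP[gG]; rewrite /F gG => /set_mem pres; move/negP: nA; apply.
have dA : \det (minor0 (sym0_mx A)) != 0 := presents_det pres.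
apply/mem_set; split; last by apply/eqP.
by apply/(isom_event_nonsing dA); exists g; split=> //; exact: genP.
Qed.

End FixedSize.
End Event.

Lemma prod_exp_sub (K : numFieldType) (q m r : nat) : (0 < q)%N ->
  (\prod_(i < r) (q ^ m - q ^ i))%:R =
  (q ^ (r * m))%:R * \prod_(k < r) (1 - (q%:R : K) ^ (- (m.+1%:Z - r%:Z + k%:Z))).
Proof.
move=> q_gt0; have q0 : q%:R != 0 :> K by rewrite pnatr_eq0 -lt0n.
rewrite natr_prod; have [mr|rm] := ltnP m r.
  have k_lt : (r - m.+1 < r)%N by lia.
  rewrite (bigD1 (Ordinal mr))//= subnn mul0r [X in _ * X](bigD1 (Ordinal k_lt))//=.
  have -> : - (m.+1%:Z - r%:Z + (r - m.+1)%:Z) = 0 by lia.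
  by rewrite expr0z subrr mul0r mulr0.
rewrite (reindex_inj rev_ord_inj)/= mulnC expnM natrX.
rewrite -[r in _ ^+ r]card_ord -prodr_const -big_split/=; apply: eq_bigr => k _.
rewrite natrB; last by rewrite leq_pexp2l//; have := ltn_ord k; lia.
rewrite mulrBr mulr1 !natrX; congr (_ - _).
rewrite [LHS]exprnP (exprnP _ m) -expfzDr//; congr (_ ^ _); have := ltn_ord k; lia.
Qed.

Lemma cvg_unit_factors (R : realType) (q r : nat) : (1 < q)%N ->
  (\prod_(k < r) (1 - (q%:R : R) ^ (- (n%:Z - r%:Z + k%:Z))) @[n --> \oo] --> (1 : R))%classic.
Proof.
move=> q_gt1; have q0 : q%:R != 0 :> R by rewrite pnatr_eq0; lia.
rewrite [X in (_ --> X)%classic](_ : 1 = \prod_(k < r) (1 : R)); last by rewrite big1.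
apply: cvg_big => [|k _]; first exact: mul_continuous.
rewrite -[X in (_ --> X)%classic]subr0; apply: cvgB; first exact: cvg_cst.
rewrite [X in (X @ _)%classic](_ : _ = geometric ((q%:R : R) ^ (r%:Z - k%:Z)) (q%:R^-1)).
  apply: cvg_geometric; rewrite ger0_norm ?invr_ge0// invf_lt1 ?ltr1n//.
  by rewrite ltr0n; lia.
apply/funext => n; rewrite /geometric/= exprVn exprnN -expfzDr//; congr (_ ^ _); lia.
Qed.

Lemma cvg_odd_factors (R : realType) (q : nat) : (1 < q)%N ->
  cvgn (fun N : nat => \prod_(1 <= i < N.+1) (1 - (q%:R : R) ^ (1 - 2 * i%:Z)) : R)%classic.
Proof.
move=> q_gt1; have q0 : 0 < q%:R :> R by rewrite ltr0n; lia.
have factor i : (0 < i)%N -> 0 <= (1 - (q%:R : R) ^ (1 - 2 * i%:Z)) <= 1.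
  move=> i0; have -> : 1 - 2 * i%:Z = - (2 * i - 1)%N%:Z by lia.
  rewrite -exprnN subr_ge0 lerBlDr lerDl invr_ge0 exprn_ge0 ?(ltW q0)//.
  by rewrite andbT invf_le1 ?exprn_gt0// exprn_ege1// ler1n ltnW.
have prod_ge0 N : 0 <= \prod_(1 <= i < N.+1) (1 - (q%:R : R) ^ (1 - 2 * i%:Z)).
  by rewrite big_nat_cond; apply: prodr_ge0 => i /andP[/andP[/factor/andP[]]].
apply: nonincreasing_is_cvgn.
  apply/nonincreasing_seqP => N; rewrite (big_nat_recr N.+1)//=.
  by rewrite ler_piMr//; have /andP[] := factor N.+1 isT.
by exists 0 => _ [N _ <-]; exact: prod_ge0.
Qed.

Local Open Scope classical_set_scope.
Local Open Scope ring_scope.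

Lemma haar_fin_coker_isom (R : realType) (p : nat) (p_pr : prime p)
    (G : finZmodType) (delta : G -> G -> QmodZ) (r m : nat)
    (mu : probability (borel_sym0 p_pr m.+1) R) :
  (p.-group [set: G]%G)%g -> duality_pairing delta ->
  r = \dim {: modpG G p_pr}%VS -> is_haar mu ->
  mu [set A : sym0 p_pr m.+1 | fin_coker_isom A delta] =
  ((\prod_(k < r) (1 - (p%:R : R) ^ (- (m.+1%:Z - r%:Z + k%:Z))) *
    \prod_(1 <= i < (uphalf (m - r)).+1) (1 - (p%:R : R) ^ (1 - 2 * i%:Z)))
   / (#|G|%:R * #|aut_pairing delta|%:R))%:E.
Proof.
move=> G_pgroup delta_duality r_dim haar; have p_gt0 := prime_gt0 p_pr.
have G_gt0 : (0 < #|G|)%N by apply/card_gt0P; exists 0.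
have := mu_isom_event G_pgroup delta_duality haar.
rewrite /isom_event => ->; rewrite sym_unit_ratio card_Fp// -r_dim /=.
have expG x : x *+ (p ^ logn p #|G|) = 0 :> G.
  by have := card_pgroup G_pgroup; rewrite /= cardsT => <-; exact: mulrn_card.
have := congr1 (fun k => k%:R : R) (card_generates p_pr expG m).
rewrite -r_dim !natrM prod_exp_sub// => cardGen.
have pX0 : (p ^ (r * m))%:R != 0 :> R by rewrite pnatr_eq0 -lt0n expn_gt0 p_gt0.
have G0 : #|G|%:R != 0 :> R by rewrite pnatr_eq0 -lt0n.
rewrite mulrC -mulrA in cardGen; rewrite (mulfI pX0 cardGen).
rewrite expnS natrM natrX; congr (_%:E); field.
by rewrite G0 expf_neq0// !andbT pnatr_eq0 -lt0n card_aut_gt0.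
Qed.

Theorem theorem2p5 (R : realType) (p : nat) (p_pr : prime p)
    (G : finZmodType) (delta : G -> G -> QmodZ) (r : nat)
    (mu : forall n : nat, probability (borel_sym0 p_pr n) R)
    (G_pgroup : (p.-group [set: G]%G)%g)
    (delta_duality : duality_pairing delta)
    (r_dim : r = \dim {: modpG G p_pr}%VS)
    (mu_haar : forall n : nat, is_haar (mu n)) :
  (forall n : nat, (0 < n)%N ->
    mu n [set A : sym0 p_pr n | fin_coker_isom A delta] =
    ((\prod_(k < r) (1 - (p%:R : R) ^ (- (n%:Z - r%:Z + k%:Z))) *
      \prod_(1 <= i < (uphalf (n.-1 - r)).+1) (1 - (p%:R : R) ^ (1 - 2 * i%:Z)))
     / (#|G|%:R * #|aut_pairing delta|%:R))%:E) /\
  (mu n [set A : sym0 p_pr n | fin_coker_isom A delta] @[n --> \oo] -->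
    ((limn (fun N : nat =>
        \prod_(1 <= i < N.+1) (1 - (p%:R : R) ^ (1 - 2 * i%:Z)) : R))
     / (#|G|%:R * #|aut_pairing delta|%:R))%:E).
Proof.
have p_gt1 := prime_gt1 p_pr; split.
  by case=> [//|m] _; exact: haar_fin_coker_isom.
set c := _ * #|aut_pairing delta|%:R; set Q := (X in limn X).
have : (\prod_(k < r) (1 - (p%:R : R) ^ (- (n%:Z - r%:Z + k%:Z))) *
    Q (uphalf (n.-1 - r)) / c @[n --> \oo] --> limn Q / c).
  apply: cvgMr_tmp; rewrite -[X in _ --> X]mul1r; apply: cvgM; first exact: cvg_unit_factors.
  have limQ : Q x @[x --> \oo] --> limn Q by exact: cvg_odd_factors.
  apply: (cvg_comp (fun n => uphalf (n.-1 - r)) Q _ limQ).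
  apply/cvgnyPge => A; exists (2 * A + r).+1 => // n /= An.
  rewrite uphalf_half; lia.
move=> lim; apply: cvg_EFin.
  by exists 1 => // -[//|m] _; rewrite (haar_fin_coker_isom G_pgroup delta_duality r_dim).
apply: cvg_trans lim; apply: near_eq_cvg; exists 1 => // -[//|m] _ /=.
by rewrite (haar_fin_coker_isom G_pgroup delta_duality r_dim).
Qed.
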